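(* Let $N\in\mathbb{N}$ with $N\ge2$, let $1<p<q<\min\{N,p^*\}$ with $p^*=\frac{pN}{N-p}$, and let $\frac{p^*N'}{p'}\le\alpha\le\frac{p^*q'}{p'}$. Let $\phi$ satisfy (Φ1)–(Φ4) and $g$ satisfy (g1), (g2), (BL) together with the convention on $g$ (all stated in the context). Then the functional $J:\mathcal{W}_r\to\mathbb{R}$, $$J(u)=\frac12\int_{\mathbb{R}^N}\phi(|\nabla u|^2)\,dx-\int_{\mathbb{R}^N}G(u)\,dx,$$ satisfies the weak Palais-Smale condition with respect to $\mathcal{W}_r$ and $\mathcal{Y}_r$; that is, every sequence $(u_n)_n$ in $\mathcal{W}_r$ such that $(J(u_n))_n$ is bounded, $J'(u_n)\to0$ in $\mathcal{W}_r'$, and $(\|\nabla u_n\|_{p,q})_n$ is bounded has a subsequence converging in $\mathcal{W}_r$.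
   Context: $\mathbb{R}_+=[0,+\infty)$. For $r>1$, $r'=\frac{r}{r-1}$ is the conjugate exponent (so $N'=\frac{N}{N-1}$). Spaces. $\mathcal{D}(\mathbb{R}^N)_{\rm rad}$ is the set of radially symmetric $C^\infty$ functions on $\mathbb{R}^N$ with compact support. $\|u\|_{p,q}=\inf\{\|v\|_p+\|w\|_q: v\in L^p(\mathbb{R}^N), w\in L^q(\mathbb{R}^N), u=v+w\}$ is the norm of $L^p(\mathbb{R}^N)+L^q(\mathbb{R}^N)$ (scalar or $\mathbb{R}^N$-valued functions). $\mathcal{W}_r$ is the completion of $\mathcal{D}(\mathbb{R}^N)_{\rm rad}$ in the norm $\|u\|=\|u\|_\alpha+\|\nabla u\|_{p,q}$ ($\|\cdot\|_\alpha$ the $L^\alpha(\mathbb{R}^N)$ norm), and $\mathcal{Y}_r$ is the completion of $\mathcal{D}(\mathbb{R}^N)_{\rm rad}$ in the norm $\|\nabla\cdot\|_{p,q}$. Weak Palais-Smale condition. Let $E,F$ be Banach spaces with $E$ continuously embedded in $F$. A functional $I\in C^1(E,\mathbb{R})$ satisfies a weak Palais-Smale condition with respect to $E$ and $F$ if every sequence $(x_n)_n$ in $E$ such that (1) $I(x_n)$ is bounded, (2) $I'(x_n)\to0$ in $E'$, (3) $(\|x_n\|_F)_n$ is bounded, has a subsequence converging in the topology of $E$. Assumptions on $\phi\in C^1(\mathbb{R}_+,\mathbb{R}_+)$: (Φ1) $\phi(0)=0$; (Φ2) there is $c>0$ with $c\,t^{p/2}\le\phi(t)$ if $t\ge1$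 and $c\,t^{q/2}\le\phi(t)$ if $0\le t\le1$; (Φ3) there is $C>0$ with $\phi(t)\le C\,t^{p/2}$ if $t\ge1$ and $\phi(t)\le C\,t^{q/2}$ if $0\le t\le1$; (Φ4) $t\mapsto\phi(t^2)$ is strictly convex. Assumptions on the continuous function $g:\mathbb{R}\to\mathbb{R}$: (g1) $-\infty\le\limsup_{s\to+\infty}g(s)/s^{p^*-1}\le0$; (g2) $-\infty<\liminf_{s\to0^+}g(s)/s^{\alpha-1}\le\limsup_{s\to0^+}g(s)/s^{\alpha-1}=-m<0$, with $1<\alpha<p^*$; (BL) there is $\zeta>0$ with $G(\zeta)>0$, where $G(z)=\int_0^z g(s)\,ds$. Convention on $g$ (after the paper's standing modification of $g$): $\lim_{|s|\to\infty}|g(s)|/|s|^{p^*-1}=0$ and $g=g_1-g_2$ on $\mathbb{R}$, where $g_1(s)=(g(s)+m s^{\alpha-1})^+$ for $s\ge0$, $g_1(s)=0$ for $s<0$, $g_2(s)=g_1(s)-g(s)$ for $s\ge0$, and $g_2(s)=-g_2(-s)$ for $s<0$. With these assumptions $J$ is well defined and $C^1$ on $\mathcal{W}_r$. *)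

(* Defs.v *)
From HB Require Import structures.
From mathcomp Require Import all_boot all_order all_algebra.
From mathcomp Require Import all_classical all_reals all_analysis.

Set Implicit Arguments.
Unset Strict Implicit.
Unset Printing Implicit Defensive.

Import Order.TTheory GRing.Theory Num.Theory.
Import numFieldNormedType.Exports.

Local Open Scope classical_set_scope.
Local Open Scope ring_scope.

(* The space R^N is 'rV[R]_N.  Its topology is the product topology, its
   sigma-algebra the product one (equivalently, the Borel sigma-algebra). *)

Definition rV_display : measure_display. Proof. exact. Qed.

Section measurable_rV.
Context {R : realType} (n : nat).

Let coord (i : 'I_n) (x : 'rV[R]_n) : R := x ord0 i.

Let rV_set0 : g_sigma_preimage coord set0.
Proof. exact: sigma_algebra0. Qed.

Let rV_setC A : g_sigma_preimage coord A -> g_sigma_preimage coord (~` A).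
Proof. exact: sigma_algebraC. Qed.

Let rV_bigcup (F : _^nat) : (forall i, g_sigma_preimage coord (F i)) ->
  g_sigma_preimage coord (\bigcup_i (F i)).
Proof. exact: sigma_algebra_bigcup. Qed.

HB.instance Definition _ := @isMeasurable.Build rV_display 'rV[R]_n
  (g_sigma_preimage coord) rV_set0 rV_setC rV_bigcup.

End measurable_rV.

Section measurable_fun_rV.
Context {R : realType}.

Lemma measurable_rV_coord n (i : 'I_n) :
  measurable_fun [set: 'rV[R]_n] (fun x : 'rV[R]_n => x ord0 i).
Proof.
move=> _ Y mY; rewrite setTI; apply: sub_sigma_algebra => /=.
rewrite -bigcup_seq/=; exists i => /=; first by rewrite mem_index_enum.
by exists Y => //; rewrite setTI.
Qed.

Lemma measurable_fun_rV d (T : measurableType d) n (f : T -> 'rV[R]_n) :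
  (forall i, measurable_fun [set: T] (fun t => f t ord0 i)) ->
  measurable_fun [set: T] f.
Proof.
move=> mf; have prefS :
    g_sigma_preimage (fun i t => f t ord0 i) `<=` @measurable _ T.
  apply: smallest_sub; first exact: sigma_algebra_measurable.
  case: n f mf => [|m] f mf; first by rewrite big_ord0.
  rewrite -bigcup_mkord_ord; apply: bigcup_sub => i Ii A [B mB <-].
  exact: mf.
move=> _ A mA; rewrite setTI; apply: prefS.
pose coord (i : 'I_n) (x : 'rV[R]_n) : R := x ord0 i.
rewrite (g_sigma_preimage_comp coord f).
by exists A => //; rewrite setTI.
Qed.

End measurable_fun_rV.

Section lebesgue_rV.
Context {R : realType}.

Definition rV_cons n (z : measurableTypeR R * 'rV[R]_n) : 'rV[R]_(1 + n) :=
  row_mx (const_mx z.1) z.2.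

Definition rV_uncons n (x : 'rV[R]_(1 + n)) : measurableTypeR R * 'rV[R]_n :=
  (x ord0 ord0, rsubmx x).

Lemma rV_consK n : cancel (@rV_cons n) (@rV_uncons n).
Proof.
case=> t x; rewrite /rV_cons /rV_uncons /= row_mxKr; congr pair.
have -> : (ord0 : 'I_(1 + n)) = lshift n ord0 by apply: val_inj.
by rewrite row_mxEl mxE.
Qed.

Lemma rV_unconsK n : cancel (@rV_uncons n) (@rV_cons n).
Proof.
move=> x; rewrite /rV_cons /rV_uncons /= -[RHS]hsubmxK; congr row_mx.
apply/rowP => i; rewrite !mxE /=; congr (fun_of_matrix x).
by apply: val_inj; case: i => -[].
Qed.

Lemma measurable_rV_cons n : measurable_fun setT (@rV_cons n).
Proof.
apply: measurable_fun_rV => i; rewrite /rV_cons.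
case: (split_ordP i) => j ->.
- under eq_fun do rewrite row_mxEl mxE.
  exact: measurable_fst.
- under eq_fun do rewrite row_mxEr.
  apply: (@measurableT_comp _ _ _ _ _ _ (fun x : 'rV[R]_n => x ord0 j)) => //.
  exact: measurable_rV_coord.
Qed.

Lemma measurable_rV_uncons n : measurable_fun setT (@rV_uncons n).
Proof.
apply/measurable_fun_pairP; split => /=; first exact: measurable_rV_coord.
apply: measurable_fun_rV => i /=.
under eq_fun do rewrite mxE.
exact: measurable_rV_coord.
Qed.

Section step.
Variables (n : nat) (l : {sigma_finite_measure set (measurableTypeR R) -> \bar R}).
Variable m : {sigma_finite_measure set 'rV[R]_n -> \bar R}.

(* Image of the product measure on R * R^n *)
Definition lebesgue_step : set 'rV[R]_(1 + n) -> \bar R :=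
  pushforward (l \x m)%E (@rV_cons n).

Let m_cons := @measurable_rV_cons n.

Let lebesgue_step0 : lebesgue_step set0 = 0%E.
Proof. exact: measure0. Qed.

Let lebesgue_step_ge0 A : (0 <= lebesgue_step A)%E.
Proof. exact: measure_ge0. Qed.

Let lebesgue_step_sigma_additive : semi_sigma_additive lebesgue_step.
Proof.
move=> F mF tF mUF; rewrite /lebesgue_step /pushforward preimage_bigcup.
apply: measure_semi_sigma_additive.
- by move=> k; rewrite -[X in measurable X]setTI; exact: m_cons.
- apply/trivIsetP => /= i j _ _ ij; rewrite -preimage_setI.
  by move/trivIsetP : tF => /(_ _ _ _ _ ij) ->//; rewrite preimage_set0.
- by rewrite -preimage_bigcup -[X in measurable X]setTI; exact: m_cons.
Qed.

HB.instance Definition _ := isMeasure.Build _ _ _ lebesgue_step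
  lebesgue_step0 lebesgue_step_ge0 lebesgue_step_sigma_additive.

Let lebesgue_step_sigma_finite : sigma_finite setT lebesgue_step.
Proof.
have /sigma_finiteP[F [TF ndF Foo]] := sigma_finiteT l.
have /sigma_finiteP[G [TG ndG Goo]] := sigma_finiteT m.
exists (fun k => @rV_uncons n @^-1` (F k `*` G k)).
  rewrite -preimage_bigcup (_ : \bigcup_k _ = setT) ?preimage_setT//.
  rewrite -subTset => -[x y] _.
  have [i _ Fx] : (\bigcup_k F k) x by rewrite -TF.
  have [j _ Gy] : (\bigcup_k G k) y by rewrite -TG.
  exists (maxn i j) => //; split => /=.
  - by move: x Fx; apply/subsetPset/ndF/leq_maxl.
  - by move: y Gy; apply/subsetPset/ndG/leq_maxr.
move=> k; have [mF Fk] := Foo k; have [mG Gk] := Goo k; split.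
  rewrite -[X in measurable X]setTI; apply: measurable_rV_uncons => //.
  exact: measurableX.
rewrite /lebesgue_step /pushforward -comp_preimage.
rewrite (_ : _ \o _ = id) ?preimage_id; last exact/funext/rV_consK.
by rewrite product_measure1E// lte_mul_pinfty// ge0_fin_numE.
Qed.

HB.instance Definition _ := Measure_isSigmaFinite.Build _ _ _ lebesgue_step
  lebesgue_step_sigma_finite.

End step.

Fixpoint lebesgueN n : {sigma_finite_measure set 'rV[R]_n -> \bar R} :=
  match n with
  | 0 => [the {sigma_finite_measure set _ -> \bar R} of
            \d_ (0 : 'rV[R]_0)]
  | k.+1 => [the {sigma_finite_measure set _ -> \bar R} of
               lebesgue_step (@lebesgue_measure R) (lebesgueN k)]
  end.

Lemma lebesgueN_box n (A : 'I_n -> set R) : (forall i, measurable (A i)) ->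
  lebesgueN n [set x : 'rV[R]_n | forall i, A i (x ord0 i)] =
  (\prod_(i < n) @lebesgue_measure R (A i))%E.
Proof.
elim: n A => [|n IHn] A mA.
  rewrite big_ord0 /= diracE mem_set//= => -[].
  by [].
rewrite big_ord_recl /= /lebesgue_step /pushforward.
have E0 z : @rV_cons n z ord0 ord0 = z.1.
  by have := rV_consK z; case: z => t x /= [].
have ES z i : @rV_cons n z ord0 (lift ord0 i) = z.2 ord0 i.
  rewrite /rV_cons (_ : lift ord0 i = rshift 1 i) ?row_mxEr//.
  exact: val_inj.
have mB : measurable
    [set x : 'rV[R]_n | forall i, A (lift ord0 i) (x ord0 i)].
  rewrite [X in measurable X](_ : _ = \bigcap_(i in [set: 'I_n])
      ((fun x : 'rV[R]_n => x ord0 i) @^-1` A (lift ord0 i))).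
    apply: fin_bigcap_measurable => // i _; rewrite -[X in measurable X]setTI.
    by apply: measurable_rV_coord => //; exact: mA.
  by apply/seteqP; split => [x Ax i _|x Ax i]; apply: Ax.
rewrite (_ : _ @^-1` _ = A ord0 `*`
    [set x : 'rV[R]_n | forall i, A (lift ord0 i) (x ord0 i)]); last first.
  apply/seteqP; split => [z Az|z [A0 AS] i] /=.
    by split => [|i]; [rewrite -E0; exact: Az|rewrite -ES; exact: Az].
  by case: (unliftP ord0 i) => [j ->|->]; rewrite ?E0// ES; exact: AS.
rewrite product_measure1E//; last exact: mA.
by rewrite -(IHn (fun i => A (lift ord0 i))).
Qed.

End lebesgue_rV.

Section function_spaces.
Context {R : realType} {N : nat}.
Implicit Types (p q a : R) (f : 'rV[R]_N -> R) (U v w : 'rV[R]_N -> 'rV[R]_N).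

(* Euclidean norm; the norm `|x| of the library on 'rV[R]_N is the sup norm *)
Definition enorm (x : 'rV[R]_N) : R := Num.sqrt (\sum_i x ord0 i ^+ 2).

Definition partial (i : 'I_N) f : 'rV[R]_N -> R := 'D_(delta_mx ord0 i) f.

Definition grad f (x : 'rV[R]_N) : 'rV[R]_N := \row_i partial i f x.

Definition smooth f := forall s : seq 'I_N, let h := foldr partial f s in
  continuous h /\ forall i x, derivable h x (delta_mx ord0 i).

Definition radial f := forall x y, enorm x = enorm y -> f x = f y.

Definition Drad : set ('rV[R]_N -> R) :=
  [set f | [/\ smooth f, compact (closure [set x | f x != 0]) & radial f]].

Definition norm_L a f : \bar R := Lnorm (@lebesgueN R N) a%:E (EFin \o f).

Definition LpV p : set ('rV[R]_N -> 'rV[R]_N) :=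
  [set v | measurable_fun setT v /\ (norm_L p (enorm \o v) < +oo)%E].

Definition norm_pq p q U : \bar R :=
  ereal_inf [set z | exists v w, [/\ LpV p v, LpV q w,
    {ae @lebesgueN R N, forall x, U x = v x + w x} &
    z = (norm_L p (enorm \o v) + norm_L q (enorm \o w))%E]].

Definition norm_Y p q f : R := fine (norm_pq p q (grad f)).

Definition norm_W a p q f : R := fine (norm_L a f) + norm_Y p q f.

End function_spaces.

(* (E, i) is a completion of the normed space (D, nrm), where D is a linear
   subspace of V; the values of i outside D are irrelevant. *)
Record is_completion {R : realType} {V : lmodType R} (D : set V) (nrm : V -> R)
    (E : completeNormedModType R) (i : V -> E) : Prop := {
  completion_linear : forall a f g, D f -> D g -> i (a *: f + g) = a *: i f + i g;
  completion_isometry : forall f, D f -> `|i f| = nrm f;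
  completion_dense : dense (i @` D) }.

Section weak_Palais_Smale.
Context {R : realType}.

Definition dual_norm {E : normedModType R} (L : E -> R) : R :=
  sup [set `|L h| | h in [set h | `|h| <= 1]].

(* j is the embedding of E into F.  The paper's notion is for I of class C^1,
   for which the differentiability premise always holds; here it only states
   that the derivatives I'(x_n) exist. *)
Definition weak_PS {E F : completeNormedModType R} (j : E -> F) (I : E -> R) :=
  forall x : nat -> E,
    (exists M : R, forall n, `|I (x n)| <= M) ->
    (forall n, differentiable I (x n)) ->
    dual_norm ('d I (x n)) @[n --> \oo] --> (0 : R) ->
    (exists M : R, forall n, `|j (x n)| <= M) ->
  exists s : nat -> nat, {homo s : k l / (k < l)%N} /\ cvg (x (s n) @[n --> \oo]).

End weak_Palais_Smale.

Section functional.
Context {R : realType} {N : nat}.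
Implicit Types (p q a m : R) (phi g : R -> R).

(* Identification of a point u of the completion of (Drad, norm_W a p q) with a
   pair (u, grad u) of functions: u is the limit of some sequence f_n of test
   functions, f_n converges to fU.1 in L^a and grad f_n to fU.2 in L^p + L^q.
   Such a pair exists, and is unique up to almost everywhere equality. *)
Definition represents a p q (E : completeNormedModType R)
    (i : ('rV[R]_N -> R) -> E) (u : E)
    (fU : ('rV[R]_N -> R) * ('rV[R]_N -> 'rV[R]_N)) :=
  [/\ measurable_fun setT fU.1, measurable_fun setT fU.2 &
      exists f : nat -> 'rV[R]_N -> R, [/\ forall n, Drad (f n),
        i (f n) @[n --> \oo] --> u,
        norm_L a (f n \- fU.1) @[n --> \oo] --> 0%E &
        norm_pq p q (fun x => grad (f n) x - fU.2 x) @[n --> \oo] --> 0%E]].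

Definition rep a p q (E : completeNormedModType R)
    (i : ('rV[R]_N -> R) -> E) (u : E) :=
  xget (fun=> 0, fun=> 0) (represents a p q i u).

(* The integral of g from 0 to z, with the usual sign for z < 0 *)
Definition primitive g (z : R) : R :=
  if 0 <= z then \int[lebesgue_measure]_(s in `[0, z]) g s
  else - \int[lebesgue_measure]_(s in `[z, 0]) g s.

Definition J a p q phi g (E : completeNormedModType R)
    (i : ('rV[R]_N -> R) -> E) (u : E) : R :=
  let fU := rep a p q i u in
  2^-1 * (\int[@lebesgueN R N]_x phi (enorm (fU.2 x) ^+ 2))
  - \int[@lebesgueN R N]_x primitive g (fU.1 x).

End functional.

Section assumptions.
Context {R : realType}.
Implicit Types (p q a m : R) (phi g : R -> R).

Definition conj_exp (r : R) : R := r / (r - 1).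

Definition crit_exp (N : nat) p : R := p * N%:R / (N%:R - p).

(* phi is in C^1(R_+, R_+): only the values of phi on [0, +oo[ matter, and the
   derivative at 0 is one-sided *)
Definition C1_Rplus phi :=
  (forall t : R, 0 <= t -> 0 <= phi t) /\
  exists dphi : R -> R, [/\ {within `[0, +oo[, continuous dphi},
    forall t : R, 0 < t -> is_derive t 1 phi (dphi t) &
    h^-1 * (phi h - phi 0) @[h --> 0^'+] --> dphi 0].

Definition Phi1 phi := phi 0 = 0.

Definition Phi2 p q phi := exists2 c : R, 0 < c & forall t : R,
  (1 <= t -> c * t `^ (p / 2) <= phi t) /\
  (0 <= t <= 1 -> c * t `^ (q / 2) <= phi t).

Definition Phi3 p q phi := exists2 C : R, 0 < C & forall t : R,
  (1 <= t -> phi t <= C * t `^ (p / 2)) /\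
  (0 <= t <= 1 -> phi t <= C * t `^ (q / 2)).

Definition strictly_convex (f : R -> R) := forall x y t : R,
  x != y -> 0 < t < 1 -> f (t * x + (1 - t) * y) < t * f x + (1 - t) * f y.

Definition Phi4 phi := strictly_convex (fun t => phi (t ^+ 2)).

Definition g1_hyp (N : nat) p g :=
  (-oo <= limf_esup (fun s : R => (g s / s `^ (crit_exp N p - 1))%:E)
            (pinfty_nbhs R) <= 0)%E.

Definition g2_hyp (N : nat) p a m g :=
  let r (s : R) := (g s / s `^ (a - 1))%:E in
  [/\ 1 < a < crit_exp N p, 0 < m,
      (-oo < limf_einf r 0^'+)%E,
      (limf_einf r 0^'+ <= limf_esup r 0^'+)%E &
      limf_esup r 0^'+ = (- m)%:E].

Definition BL g := exists2 z : R, 0 < z & 0 < primitive g z.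

Definition g1_part a m g (s : R) : R :=
  if 0 <= s then Num.max (g s + m * s `^ (a - 1)) 0 else 0.

Definition g2_part a m g (s : R) : R :=
  if 0 <= s then g1_part a m g s - g s
  else - (g1_part a m g (- s) - g (- s)).

Definition g_convention (N : nat) p a m g :=
  let r (s : R) := `|g s| / `|s| `^ (crit_exp N p - 1) in
  [/\ r s @[s --> +oo] --> (0 : R), r s @[s --> -oo] --> (0 : R) &
      forall s, g s = g1_part a m g s - g2_part a m g s].

End assumptions.

(* Main.v *)
Require Import Defs.
From HB Require Import structures.
From mathcomp Require Import all_boot all_order all_algebra.
From mathcomp Require Import all_classical all_reals all_analysis.
From mathcomp Require Import measurable_realfun.
From mathcomp Require Import ring lra.
Import Order.TTheory GRing.Theory Num.Theory.
Import numFieldNormedType.Exports.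
Local Open Scope classical_set_scope.
Local Open Scope ring_scope.
Set Implicit Arguments.
Unset Strict Implicit.
Unset Printing Implicit Defensive.

(** Why the Palais-Smale sequences are compact.  Write psi(t) = phi(t^2); by
(Phi2) and (Phi3) psi has the growth of h(t) = min(t^p, t^q), and by (Phi4) the
map x |-> psi(|x|) is strictly convex on R^N.  A function of L^p + L^q is
measured through the modular rho(U), the integral of h(|U|), instead of the norm:
each of them is small when the other is (norm_pq_le, rho_norm_pq).

A point of the completion is a pair (u, U) of functions, unique up to null sets
(represents_ex, represents_unique).  For such pairs there are three estimates, all
consequences of one-dimensional inequalities for the profile of a radial test
function: the p*-integral of u is at most e times its a-integral plus a constant
depending on rho(U) (wpair_sobolev), |u| decays at infinity (wpair_decay), and
bounded sequences have subsequences for which u_n converges almost everywhere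
(wpair_compact, by equicontinuity of the profiles away from 0).

The functional is used only through an inequality.  Since psi(|.|) is convex, the
difference quotients of the kinetic term are monotone in the step, hence
(functional_convex_ineq), for x = (u, U), y = (v, V) and 0 < l < 1,
  D_l(U, V) / (2 l) <= kin(V)/2 - kin(U)/2 - int g(u) v + int g(u) u - J'(x)(y - x),
where kin(U) is the integral of psi(|U|) and D_l(U, V) the integral of the convexity
defect of psi(|.|) between U and V.  With y = 0 and the coercivity of -g(s)s near 0
this bounds the sequence in W (palais_smale_bounded); the bound on rho(U_n) comes
from the bound in Y.

Pass to a subsequence with u_n -> v almost everywhere and kin(U_n) convergent, and
take x = x_n, y = x_k.  Letting first k and then n tend to infinity, the inequality
gives limsup int -g(u_n) u_n <= int -g(v) v.  The opposite inequality is Fatou's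
lemma: by the decay, -g(u_n)u_n can be negative only inside a fixed ball, on which the
subcritical growth of g at infinity controls it.  Equality has two consequences:
u_n -> v in L^a (fatou_gap), and D_l(U_n, U_k) -> 0.  By strict convexity the latter makes U_k Cauchy in measure, so
that U_k -> V almost everywhere along a subsequence.  Finally h(|U_k|) is bounded by
a multiple of the defect between U_n and U_k plus h(|U_n|) if l is small
(convdef_coercive), and dominated convergence gives rho(U_k - V) -> 0. *)

(** * Lebesgue measure under dilations *)

Section scaling.
Context {R : realType}.
Local Notation leb1 := (@lebesgue_measure R).

(** By uniqueness of Lebesgue measure, which is r times its image under x |-> r x:
both give a half-open interval its length. *)
Lemma ge0_integral_scale1 (r : R) (k : R -> \bar R) : 0 < r ->
  measurable_fun [set: R] k -> (forall x, (0 <= k x)%E) ->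
  (\int[leb1]_x k (r * x)%R = (r^-1)%:E * \int[leb1]_x k x)%E.
Proof.
move=> r0 mk k0.
have mr : measurable_fun [set: measurableTypeR R] ( *%R r : measurableTypeR R -> measurableTypeR R).
  exact: measurable_funM.
pose rn : {nonneg R} := NngNum (ltW r0).
pose f : measurableTypeR R -> measurableTypeR R := *%R r.
pose nu : {measure set (measurableTypeR R) -> \bar R} :=
  mscale rn (measure_function_pushforward__canonical__measure_function_Measure leb1 (mr : measurable_fun setT f)).
have H A : measurable A -> leb1 A = nu A.
  apply: lebesgue_measure_unique => /= _ [[a b]] _ <-.
  rewrite /mscale /= /pushforward /=.
  have -> : *%R r @^-1` [set` `]a, b]] = [set` `]r^-1 * a, r^-1 * b]]%R.
    apply/seteqP; split => x /=; rewrite !in_itv/= !(mulrC r^-1) ltr_pdivrMr// ler_pdivlMr// mulrC //.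
  rewrite !lebesgue_measure_itv/= !lte_fin ltr_pM2l ?invr_gt0//.
  case: ifP => _; last by rewrite mule0.
  by rewrite -EFinD -EFinM -mulrBr mulrA divff ?mul1r// gt_eqF.
rewrite [in RHS](eq_measure_integral nu); last by move=> A mA _; exact: H.
rewrite ge0_integral_mscale//.
have E := ge0_integral_pushforward mr leb1 measurableT mk (fun y _ => k0 y).
rewrite preimage_setT in E.
transitivity ((r^-1)%:E * (r%:E * \int[pushforward leb1 f]_(y in setT) k y))%E => //.
by rewrite muleA -EFinM mulVf ?gt_eqF// mul1e E.
Qed.

(** Induction on the dimension: the first coordinate is rescaled in R, the other ones
by the induction hypothesis applied to the sections. *)
Lemma lebesgueN_scale n (r : R) (A : set 'rV[R]_n) : 0 < r -> measurable A ->
  (lebesgueN n ((fun x => r *: x)%R @^-1` A) = ((r^-1) ^+ n)%:E * lebesgueN n A)%E.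
Proof.
move=> r0; elim: n A => [|n IHn] A mA.
  rewrite expr0 mul1e /=; congr (\d_ _ _).
  by apply/seteqP; split => x; rewrite /preimage/= (thinmx0 x) scaler0.
rewrite /= /lebesgue_step /pushforward /=.
pose B := @rV_cons R n @^-1` A.
have mB : measurable B by rewrite -[X in measurable X]setTI; exact: measurable_rV_cons.
have -> : @rV_cons R n @^-1` ((fun x => r *: x) @^-1` A) =
    [set z | B (r * z.1, r *: z.2)].
  have E t (y : 'rV[R]_n) : r *: rV_cons (t, y) = rV_cons (r * t, r *: y).
    by rewrite /rV_cons /= scale_row_mx scalemx_const.
  by apply/seteqP; split => -[t y]; rewrite /B /preimage /mkset /= E.
rewrite /product_measure1 /=.
under eq_integral => t _.
  rewrite (_ : xsection _ t = (fun y => r *: y) @^-1` xsection B (r * t)); last first.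
    by apply/seteqP; split => y; rewrite /xsection /= !inE.
  rewrite IHn; last exact: measurable_xsection.
  over.
rewrite (@ge0_integral_scale1 r (fun t => (((r^-1) ^+ n)%:E * lebesgueN n (xsection B t))%E) r0); last 2 first.
- apply: emeasurable_funM => //.
  exact: measurable_fun_xsection.
- by move=> x; rewrite mule_ge0// lee_fin exprn_ge0// invr_ge0 ltW.
rewrite ge0_integralZl//; last 2 first.
- exact: measurable_fun_xsection.
- by rewrite lee_fin exprn_ge0// invr_ge0 ltW.
by rewrite muleA -EFinM -exprS.
Qed.
End scaling.

(** * Weighted Sobolev inequalities on an interval *)

Section calculus.
Context {R : realType}.
Implicit Types (f F G : R -> R) (a b s t x : R).
Local Notation leb1 := (@lebesgue_measure R).

Lemma continuous_integrable_itv f a b : continuous f ->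
  leb1.-integrable `[a, b] (EFin \o f).
Proof.
move=> cf; apply: continuous_compact_integrable; first exact: segment_compact.
exact: continuous_subspaceT.
Qed.

Lemma Rintegral_FTC2 f F a b : a <= b -> continuous f ->
  (forall x, is_derive x 1 F (f x)) ->
  \int[leb1]_(x in `[a, b]) f x = F b - F a.
Proof.
move=> ab cf dF; move: ab; rewrite le_eqVlt => /predU1P[<-|ab].
  by rewrite set_itv1 Rintegral_set1 subrr.
have cF : continuous F.
  move=> x; apply/differentiable_continuous/derivable1_diffP.
  by case: (dF x).
rewrite /Rintegral (@continuous_FTC2 _ f F)//.
- exact: continuous_subspaceT.
- split => [x _| |]; first by case: (dF x).
  + exact/cvg_at_right_filter/cF.
  + exact/cvg_at_left_filter/cF.
- by move=> x _; rewrite derive1E; case: (dF x) => _ ->.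
Qed.

Lemma continuous_normpow s : 0 < s -> continuous (fun y : R => `|y| `^ s).
Proof.
move=> s0 x; have [->|x0] := eqVneq x 0.
  rewrite /continuous_at normr0 powR0 ?gt_eqF//.
  apply/cvgrPdist_lt => e e0; near=> y.
  rewrite sub0r normrN ger0_norm ?powR_ge0//.
  have : `|y| < e `^ s^-1.
    near: y; apply/nbhs_normP; exists (e `^ s^-1) => /=; first exact: powR_gt0.
    by move=> y /=; rewrite sub0r normrN.
  move=> /(gt0_ltr_powR s0) => /(_ (normr_ge0 _) (powR_ge0 _ _)).
  by rewrite -powRrM mulVf ?gt_eqF// powRr1// ltW.
apply: (@continuous_comp _ _ _ (fun y : R => `|y|) (fun y => y `^ s)).
  exact: norm_continuous.
apply/differentiable_continuous/derivable1_diffP.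
by apply: derivable_powR; rewrite in_itv/= andbT normr_gt0.
Unshelve. all: by end_near. Qed.

Lemma is_derive_normpow t x : 1 < t ->
  is_derive x 1 (fun y : R => `|y| `^ t) (t * `|x| `^ (t - 1) * Num.sg x).
Proof.
move=> t1; have t0 : 0 < t by exact: lt_trans t1.
have [x0|x0|<-] := ltgtP 0 x.
- rewrite gtr0_sg// mulr1 gtr0_norm//.
  apply: (@near_eq_is_derive _ _ _ (fun y : R => y `^ t)); last exact: is_derive1_powR.
  by near=> y; rewrite gtr0_norm//; near: y; exact: lt_nbhsr.
- rewrite ltr0_sg// mulrN1 ltr0_norm//.
  have nx0 : 0 < - x by rewrite oppr_gt0.
  apply: (@near_eq_is_derive _ _ _ ((fun y : R => y `^ t) \o -%R)).
  + by near=> y; rewrite /= ltr0_norm//; near: y; exact: lt_nbhsl.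
  + have h1 := is_derive1_powR t nx0.
    have h2 : is_derive x 1 (-%R : R -> R) (- 1) by exact: is_deriveNid.
    have := @is_derive1_comp _ (fun y => y `^ t) -%R x _ _ h1 h2.
    by rewrite mulrN1.
- rewrite sgr0 mulr0.
  have H : (h^-1 *: ((fun y : R => `|y| `^ t) \o shift 0) (h *: (1:R)) - h^-1 *: `|0 : R| `^ t) @[h --> 0^'] --> (0 : R).
    apply/cvgr0Pnorm_lt => e e0.
    near=> h.
    rewrite /= addr0 /GRing.scale/= mulr1 normr0 (powR0 (lt0r_neq0 t0)) mulr0 subr0.
    have h0 : h != 0 by near: h; exact: nbhs_dnbhs_neq.
    rewrite normrM normfV norm_powR// normr_id.
    rewrite -(@mulr_powRB1 _ `|h| t)// mulrA mulVf ?normr_eq0// mul1r.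
    near: h; apply: nbhs_dnbhs.
    have c := @continuous_normpow (t - 1) _ 0; move: c.
    rewrite subr_gt0 => /(_ t1) /cvgrPdist_lt /(_ e e0).
    apply: filterS => h; rewrite normr0 powR0 ?subr_eq0 ?gt_eqF//.
    by rewrite sub0r normrN ger0_norm ?powR_ge0.
  have E : (fun h => h^-1 *: (((fun y : R => `|y| `^ t) \o shift 0) (h *: (1:R)) - `|0 : R| `^ t)) @ 0^' --> (0 : R).
    by under eq_fun do rewrite scalerBr.
  split; first by apply/cvg_ex; exists 0.
  exact/cvg_lim.
Unshelve. all: by end_near. Qed.

Lemma le_Rintegral_itv f F a b : continuous f -> continuous F ->
  (forall x, a <= x <= b -> f x <= F x) ->
  \int[leb1]_(x in `[a, b]) f x <= \int[leb1]_(x in `[a, b]) F x.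
Proof.
move=> cf cF fF; apply: le_Rintegral => //; try exact: continuous_integrable_itv.
Qed.

Lemma le_Rintegral_subitv f a b c : continuous f -> (forall x, 0 <= f x) ->
  a <= c <= b ->
  \int[leb1]_(x in `[c, b]) f x <= \int[leb1]_(x in `[a, b]) f x.
Proof.
move=> cf f0 /andP[ac cb].
have int := @continuous_integrable_itv f.
apply: fine_le.
- exact: integrable_fin_num (int c b cf).
- exact: integrable_fin_num (int a b cf).
apply: ge0_subset_integral => //=.
- exact: measurable_int (int a b cf).
- by move=> x _; rewrite lee_fin.
- by move=> x /=; rewrite !in_itv/= => /andP[cx ->]; rewrite (le_trans ac cx).
Qed.

Section one_dimensional_sobolev.
Variables (n : nat) (b : R) (G g : R -> R).
Hypotheses (n0 : (0 < n)%N) (b0 : 0 <= b) (cg : continuous g)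
  (dG : forall x, is_derive x 1 G (g x)) (G0 : forall x, 0 <= G x) (Gb : G b = 0).

Let cG : continuous G.
Proof.
move=> x; apply/differentiable_continuous/derivable1_diffP.
by case: (dG x).
Qed.

Let cM f F : continuous f -> continuous F -> continuous (fun x => f x * F x).
Proof. by move=> cf cF x; apply: cvgM; [exact: cf|exact: cF]. Qed.

Let cN : continuous (fun x => `|g x|).
Proof. by move=> x; apply: cvg_norm; exact: cg. Qed.

Let cX m : continuous (fun x : R => x ^+ m).
Proof. exact: exprn_continuous. Qed.

Let I := \int[leb1]_(x in `[0, b]) (`|g x| * `|x| ^+ n).

Let cXn m : continuous (fun x : R => `|x| ^+ m).
Proof.
by move=> x; apply: (@continuous_comp _ _ _ (fun y : R => `|y|) (fun x => x ^+ m)); [exact: norm_continuous|exact: cX].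
Qed.

(** G x is minus the integral of g over [x, b], where the weight is at least x ^+ n. *)
Lemma sobolev1d_pointwise x : 0 <= x <= b -> G x * x ^+ n <= I.
Proof.
move=> /andP[x0 xb].
have E := Rintegral_FTC2 xb cg dG.
have H : G x <= \int[leb1]_(y in `[x, b]) `|g y|.
  have : `|\int[leb1]_(y in `[x, b]) g y| <= \int[leb1]_(y in `[x, b]) `|g y|.
    by apply: le_normr_Rintegral => //; exact: continuous_integrable_itv.
  by rewrite E Gb sub0r normrN ger0_norm.
apply: (@le_trans _ _ (\int[leb1]_(y in `[x, b]) (`|g y| * `|x| ^+ n))).
  rewrite RintegralZr//; last exact: continuous_integrable_itv.
  by rewrite (ger0_norm x0) ler_wpM2r// exprn_ge0.
apply: (@le_trans _ _ (\int[leb1]_(y in `[x, b]) (`|g y| * `|y| ^+ n))).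
  apply: le_Rintegral_itv; [apply: cM => // y; exact: cvg_cst|exact: cM|].
  move=> y /andP[xy yb]; rewrite ler_wpM2l// lerXn2r ?nnegrE// !ger0_norm//.
  exact: le_trans xy.
apply: le_Rintegral_subitv; [exact: cM| |by rewrite x0].
by move=> y; rewrite mulr_ge0.
Qed.

(** Integrate the derivative of G x ^+ n: both boundary terms vanish. *)
Lemma sobolev1d_hardy : \int[leb1]_(x in `[0, b]) (G x * x ^+ n.-1) <= I / n%:R.
Proof.
have n0' : 0 < n%:R :> R by rewrite ltr0n.
have dH x : is_derive x 1 (fun y => G y * y ^+ n) (G x * (n%:R * x ^+ n.-1) + x ^+ n * g x).
  have h := dG x.
  have h2 : is_derive x 1 (fun y : R => y ^+ n) (n%:R * x ^+ n.-1).
    have := @is_deriveX _ _ id n x 1 1 (is_derive_id _ _).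
    by rewrite -[_ *: _]/(_ * _) mulr1; congr is_derive; apply/funext => y; rewrite fctE.
  exact: is_deriveM.
have c1 : continuous (fun x => G x * (n%:R * x ^+ n.-1)).
  by apply: cM => //; apply: cM => // y; exact: cvg_cst.
have c2 : continuous (fun x => x ^+ n * g x) by exact: cM.
have cH : continuous (fun x => G x * (n%:R * x ^+ n.-1) + x ^+ n * g x).
  by move=> x; apply: cvgD; [exact: c1|exact: c2].
have E := Rintegral_FTC2 b0 cH dH.
move: E; rewrite RintegralD//; try exact: continuous_integrable_itv.
rewrite Gb mul0r expr0n gtn_eqF// mulr0 subrr => E.
rewrite ler_pdivlMr//.
have -> : \int[leb1]_(x in `[0, b]) (G x * x ^+ n.-1) * n%:R =
    \int[leb1]_(x in `[0, b]) (G x * (n%:R * x ^+ n.-1)).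
  rewrite -RintegralZr//; last by apply: continuous_integrable_itv; exact: cM.
  by apply: eq_Rintegral => x _; rewrite mulrAC mulrA.
rewrite (_ : \int[_]_(x in _) _ = - \int[leb1]_(x in `[0, b]) (x ^+ n * g x)); last first.
  by apply/eqP; rewrite -addr_eq0 E.
apply: le_trans (ler_norm _) _; rewrite normrN.
have H : `|\int[leb1]_(x in `[0, b]) (x ^+ n * g x)| <=
    \int[leb1]_(x in `[0, b]) `|x ^+ n * g x|.
  by apply: le_normr_Rintegral => //; exact: continuous_integrable_itv.
apply: le_trans H _.
apply: le_Rintegral_itv; [|exact: cM|].
- by move=> x; apply: cvg_norm; exact: c2.
- by move=> x _; rewrite normrM normrX mulrC lexx.
Qed.

(** Of the 1 + 1/n factors G, the power 1/n together with one x is bounded by the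
pointwise estimate; what remains is the integral of sobolev1d_hardy. *)
Lemma sobolev1d : \int[leb1]_(x in `[0, b]) (`|G x| `^ (1 + n%:R^-1) * x ^+ n) <=
  I `^ (1 + n%:R^-1) / n%:R.
Proof.
have n0' : 0 < n%:R :> R by rewrite ltr0n.
have ni0 : 0 < n%:R^-1 :> R by rewrite invr_gt0.
have I0 : 0 <= I.
  by apply: Rintegral_ge0 => x _; rewrite mulr_ge0.
have -> : I `^ (1 + n%:R^-1) / n%:R = (I / n%:R) * I `^ (n%:R^-1).
  rewrite powRD; first by rewrite powRr1// mulrAC.
  by apply/implyP; rewrite gt_eqF// addr_gt0.
apply: (@le_trans _ _ (\int[leb1]_(x in `[0, b]) ((G x * x ^+ n.-1) * I `^ (n%:R^-1)))).
  apply: le_Rintegral_itv.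
  - have cp : continuous (fun y : R => `|y| `^ (1 + n%:R^-1)).
      by apply: continuous_normpow; rewrite addr_gt0.
    apply: cM => // x.
    apply: (@continuous_comp _ _ _ G (fun y => `|y| `^ (1 + n%:R^-1))).
      exact: cG.
    exact: cp.
  - by apply: cM => //; [exact: cM|move=> x; exact: cvg_cst].
  - move=> x xb; have /andP[x0 _] := xb; rewrite ger0_norm//.
    rewrite powRD; last by apply/implyP; rewrite gt_eqF// addr_gt0.
    rewrite powRr1//.
    have -> : G x * G x `^ n%:R^-1 * x ^+ n = (G x * x ^+ n.-1) * (G x `^ n%:R^-1 * x).
      by rewrite -{2}(prednK n0) exprS; ring.
    rewrite ler_wpM2l ?mulr_ge0 ?exprn_ge0//.
    have -> : G x `^ n%:R^-1 * x = (G x * x ^+ n) `^ n%:R^-1.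
      rewrite powRM ?exprn_ge0// -(powR_mulrn n x0) -powRrM divff ?gt_eqF//.
      by rewrite powRr1.
    apply: ge0_ler_powR; [exact: ltW|by rewrite nnegrE mulr_ge0 ?exprn_ge0
      |by rewrite nnegrE|exact: sobolev1d_pointwise].
rewrite RintegralZr//; last by apply: continuous_integrable_itv; exact: cM.
by rewrite ler_wpM2r ?powR_ge0// sobolev1d_hardy.
Qed.

End one_dimensional_sobolev.
End calculus.

(** * The Euclidean norm *)

Section euclidean_norm.
Context {R : realType} {N : nat}.
Implicit Types (x y : 'rV[R]_N) (r : R).

Lemma enorm_ge0 x : 0 <= enorm x.
Proof. exact: sqrtr_ge0. Qed.

Lemma sqr_enorm x : enorm x ^+ 2 = \sum_i x ord0 i ^+ 2.
Proof. by rewrite sqr_sqrtr// sumr_ge0// => i _; rewrite sqr_ge0. Qed.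

Lemma enormZ r x : enorm (r *: x) = `|r| * enorm x.
Proof.
rewrite /enorm -sqrtr_sqr -sqrtrM ?sqr_ge0// mulr_sumr; congr Num.sqrt.
by apply: eq_bigr => i _; rewrite mxE exprMn.
Qed.

Lemma enorm0 : enorm (0 : 'rV[R]_N) = 0.
Proof. by rewrite -(scale0r 0) enormZ normr0 mul0r. Qed.

Lemma enormN x : enorm (- x) = enorm x.
Proof. by rewrite -scaleN1r enormZ normrN1 mul1r. Qed.

Lemma coord_le_enorm x i : `|x ord0 i| <= enorm x.
Proof.
rewrite -(ler_sqr (normr_ge0 _) (enorm_ge0 _)) sqr_enorm real_normK ?num_real//.
by rewrite (bigD1 i)//= lerDl sumr_ge0// => j _; rewrite sqr_ge0.
Qed.

Lemma enorm_eq0 x : enorm x = 0 -> x = 0.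
Proof.
move=> x0; apply/rowP => i; rewrite mxE; apply/eqP.
by rewrite -normr_le0 -x0 coord_le_enorm.
Qed.

Lemma dot_le_enorm x y : \sum_i x ord0 i * y ord0 i <= enorm x * enorm y.
Proof.
have [/enorm_eq0 ->|x0] := eqVneq (enorm x) 0.
  by rewrite enorm0 mul0r big1// => i _; rewrite mxE mul0r.
have [/enorm_eq0 ->|y0] := eqVneq (enorm y) 0.
  by rewrite enorm0 mulr0 big1// => i _; rewrite mxE mulr0.
have xy0 : 0 < enorm x * enorm y by rewrite mulr_gt0// lt0r ?x0 ?y0 enorm_ge0.
set a := enorm x; set b := enorm y; set s := \sum_i _.
have : 0 <= \sum_i (b * x ord0 i - a * y ord0 i) ^+ 2.
  by rewrite sumr_ge0// => i _; rewrite sqr_ge0.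
have -> : \sum_i (b * x ord0 i - a * y ord0 i) ^+ 2 = 2 * (a * b) * (a * b - s).
  transitivity (b ^+ 2 * (\sum_i x ord0 i ^+ 2) + a ^+ 2 * (\sum_i y ord0 i ^+ 2)
     - 2 * (a * b) * s).
    rewrite !mulr_sumr -big_split -sumrB /=; apply: eq_bigr => i _; ring.
  by rewrite -!sqr_enorm -/a -/b; ring.
by rewrite pmulr_rge0 ?subr_ge0// mulr_gt0.
Qed.

Lemma ler_enormD x y : enorm (x + y) <= enorm x + enorm y.
Proof.
rewrite -(ler_sqr (enorm_ge0 _)) ?nnegrE ?addr_ge0 ?enorm_ge0//.
rewrite sqr_enorm sqrrD !sqr_enorm.
have -> : \sum_i (x + y) ord0 i ^+ 2 = \sum_i x ord0 i ^+ 2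
    + (\sum_i x ord0 i * y ord0 i) *+ 2 + \sum_i y ord0 i ^+ 2.
  rewrite -sumrMnl -!big_split/=; apply: eq_bigr => i _; rewrite mxE; ring.
by rewrite lerD2r lerD2l lerMn2r dot_le_enorm.
Qed.

Lemma enorm_le_sum x : enorm x <= \sum_i `|x ord0 i|.
Proof.
rewrite -(ler_sqr (enorm_ge0 _)) ?nnegrE ?sumr_ge0// sqr_enorm.
rewrite expr2 mulr_suml; apply: ler_sum => i _.
rewrite -real_normK ?num_real// expr2 ler_wpM2l//.
by rewrite (bigD1 i)//= lerDl sumr_ge0.
Qed.

Lemma measurable_enorm : measurable_fun [set: 'rV[R]_N] (@enorm R N).
Proof.
apply: (@measurableT_comp _ _ _ _ _ _ (@Num.sqrt R)).
  by apply: continuous_measurable_fun; exact: sqrt_continuous.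
apply: measurable_sum => i; apply: measurable_funX.
exact: measurable_rV_coord.
Qed.

End euclidean_norm.

(** * Integrals of radial functions *)

Section polar.
Context {R : realType} {N : nat}.
Hypothesis N0 : (0 < N)%N.
Local Notation leb1 := (@lebesgue_measure R).
Local Notation leb := (@lebesgueN R N).
Local Open Scope ereal_scope.

Definition unit_ball_volume : R := fine (leb [set x | (enorm x <= 1)%R]).
Local Notation w := unit_ball_volume.

Lemma measurable_enorm_ball (r : R) : measurable [set x : 'rV[R]_N | (enorm x <= r)%R].
Proof.
rewrite [X in measurable X](_ : _ = (@enorm R N) @^-1` `]-oo, r]).
  by rewrite -[X in measurable X]setTI; exact: measurable_enorm.
by apply/seteqP; split => x /=; rewrite in_itv.
Qed.

Lemma leb_box (a b : R) : (a <= b)%R ->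
  leb [set x | forall i, `[a, b]%classic (x ord0 i)] = ((b - a) ^+ N)%:E.
Proof.
move=> ab; rewrite (lebesgueN_box (A := fun=> `[a, b]%classic))//.
under eq_bigr do rewrite lebesgue_measure_itv/= lte_fin.
have -> : (if (a < b)%R then b%:E - a%:E else 0) = (b - a)%:E.
  by case: ltP => // ba; rewrite (@le_anti _ _ a b) ?ab// subrr.
by rewrite prodEFin prodr_const card_ord.
Qed.

Lemma leb_enorm_le0 : leb [set x | (enorm x <= 0)%R] = 0.
Proof.
have E : leb [set x | forall i, `[0%R, 0%R]%classic (x ord0 i)] = 0.
  by rewrite leb_box// subrr expr0n gtn_eqF.
rewrite -[RHS]E; congr (leb _).
apply/seteqP; split => x /=.
  move=> x0 i; rewrite in_itv/= -eq_le.
  by rewrite (@enorm_eq0 _ _ x) ?mxE//; apply/le_anti; rewrite x0 enorm_ge0.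
move=> H; have -> : x = 0%R; last by rewrite enorm0.
by apply/rowP => i; move: (H i); rewrite in_itv/= -eq_le mxE eq_sym => /eqP.
Qed.

Lemma unit_ball_volumeE : leb [set x | (enorm x <= 1)%R] = w%:E.
Proof.
rewrite /w fineK// ge0_fin_numE//.
apply: (@le_lt_trans _ _ (leb [set x | forall i, `[(-1)%R, 1%R]%classic (x ord0 i)])).
  apply: le_measure; rewrite ?inE.
  - exact: measurable_enorm_ball.
  - rewrite [X in measurable X](_ : _ = \bigcap_(i in [set: 'I_N])
      ((fun x : 'rV[R]_N => x ord0 i) @^-1` `[(-1)%R, 1%R])).
      apply: fin_bigcap_measurable => // i _; rewrite -[X in measurable X]setTI.
      by apply: measurable_rV_coord.
    by apply/seteqP; split => [x Ax i _|x Ax i]; apply: Ax.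
  - by move=> x /= x1 i; rewrite in_itv/= -ler_norml (le_trans (coord_le_enorm _ _)).
by rewrite leb_box ?ltry//; lra.
Qed.

Lemma unit_ball_volume_gt0 : (0 < w)%R.
Proof.
rewrite -lte_fin -unit_ball_volumeE.
have Ni0 : (0 < N%:R^-1 :> R)%R by rewrite invr_gt0 ltr0n.
apply: (@lt_le_trans _ _ (leb [set x | forall i, `[0%R, N%:R^-1%R]%classic (x ord0 i)])).
  by rewrite leb_box ?ltW// lte_fin subr0 exprn_gt0.
apply: le_measure; rewrite ?inE.
- rewrite [X in measurable X](_ : _ = \bigcap_(i in [set: 'I_N])
      ((fun x : 'rV[R]_N => x ord0 i) @^-1` `[0%R, N%:R^-1%R])).
    apply: fin_bigcap_measurable => // i _; rewrite -[X in measurable X]setTI.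
    by apply: measurable_rV_coord.
  by apply/seteqP; split => [x Ax i _|x Ax i]; apply: Ax.
- exact: measurable_enorm_ball.
move=> x /= H; apply: le_trans (enorm_le_sum _) _.
apply: (@le_trans _ _ (\sum_(i < N) N%:R^-1)%R).
  by apply: ler_sum => i _; have := H i; rewrite in_itv/= => /andP[h ?]; rewrite ger0_norm.
by rewrite sumr_const card_ord -[leLHS]mulr_natr mulVf// pnatr_eq0 -lt0n.
Qed.

Lemma leb_ball (r : R) : (0 < r)%R ->
  leb [set x | (enorm x <= r)%R] = (w * r ^+ N)%:E.
Proof.
move=> r0; have := @lebesgueN_scale R N r^-1 _ _ (measurable_enorm_ball 1).
rewrite invr_gt0 => /(_ r0); rewrite invrK unit_ball_volumeE -EFinM mulrC => <-.
congr (leb _); apply/seteqP; split => x /=;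
  rewrite enormZ gtr0_norm ?invr_gt0// ler_pdivrMl ?mulr1//.
Qed.

(** The volume of the ball of radius |x|.  It maps Lebesgue measure to Lebesgue measure
on R_+, so that polar coordinates become a substitution in dimension one. *)
Definition radial_volume (x : 'rV[R]_N) : R := (w * enorm x ^+ N)%R.
Local Notation T := radial_volume.

Lemma measurable_radial_volume : measurable_fun setT T.
Proof.
apply: measurable_funM => //; apply: measurable_funX; exact: measurable_enorm.
Qed.

Lemma radial_volume_ge0 x : (0 <= T x)%R.
Proof. by rewrite mulr_ge0 ?exprn_ge0 ?enorm_ge0// ltW// unit_ball_volume_gt0. Qed.

Lemma radial_volume_le (s : R) : leb [set x | (T x <= s)%R] = (Num.max s 0)%:E.
Proof.
have w0 := unit_ball_volume_gt0.
have [s0|s0|->] := ltgtP s 0%R.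
- rewrite [X in leb X](_ : _ = set0) ?measure0//.
  apply/seteqP; split => x //= xs; have := radial_volume_ge0 x.
  by rewrite leNgt (le_lt_trans xs).
- pose r := ((s / w) `^ N%:R^-1)%R.
  have sw0 : (0 < s / w)%R by rewrite divr_gt0.
  have r0 : (0 < r)%R by rewrite powR_gt0.
  have rN : (r ^+ N = s / w)%R.
    rewrite -powR_mulrn ?ltW// /r -powRrM mulVf ?powRr1 ?ltW//.
    by rewrite pnatr_eq0 -lt0n.
  rewrite [X in leb X](_ : _ = [set x | (enorm x <= r)%R]).
    by rewrite leb_ball// rN mulrCA divff ?mulr1// gt_eqF.
  have TE x : (T x <= s)%R = (enorm x <= r)%R.
    by rewrite /T mulrC -ler_pdivlMr// -rN ler_pXn2r ?nnegrE ?enorm_ge0// ltW.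
  by apply/seteqP; split => x /=; rewrite TE.
- transitivity (0 : \bar R) => //; rewrite -[RHS]leb_enorm_le0; congr (leb _); apply/seteqP; split => x /=.
    rewrite /T pmulr_rle0// => H.
    have : (enorm x ^+ N == 0)%R by rewrite eq_le H exprn_ge0// enorm_ge0.
    by rewrite expf_eq0 N0 /= => /eqP ->.
  move=> x0; rewrite /T (_ : enorm x = 0%R) ?expr0n ?gtn_eqF ?mulr0//.
  by apply/le_anti; rewrite x0 enorm_ge0.
Qed.

Lemma ge0_integral_radial_volume (k : R -> \bar R) :
  measurable_fun [set: R] k -> (forall s, 0 <= k s) ->
  \int[leb]_x k (T x) = \int[leb1]_(s in `]0%R, +oo[) k s.
Proof.
move=> mk k0.
pose T' : 'rV[R]_N -> measurableTypeR R := T.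
have mT : measurable_fun setT T' by exact: measurable_radial_volume.
pose nu0 : {measure set (measurableTypeR R) -> \bar R} :=
  measure_function_pushforward__canonical__measure_function_Measure leb mT.
have mneg : measurable (`]-oo, 0%R] : set (measurableTypeR R)) by [].
(* the measure of the negative half-line is added to apply uniqueness on the whole line *)
pose nu : {measure set (measurableTypeR R) -> \bar R} :=
  measure_add nu0 (mrestr leb1 mneg).
have nuE A : nu A = leb (T' @^-1` A) + leb1 (A `&` `]-oo, 0%R]).
  exact: measure_addE.
have H A : measurable A -> leb1 A = nu A.
  apply: lebesgue_measure_unique => /= _ [[a b]] _ <-.
  rewrite nuE.
  rewrite lebesgue_measure_itv/= lte_fin.
  case: ifPn => [ab|]; last first.
    rewrite -leNgt => ba; rewrite set_itv_ge ?bnd_simp -?leNgt//.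
    by rewrite preimage_set0 set0I !measure0 adde0.
  have mle s : measurable [set x | (T x <= s)%R].
    rewrite [X in measurable X](_ : _ = T @^-1` `]-oo, s]).
      by rewrite -[X in measurable X]setTI; exact: measurable_radial_volume.
    by apply/seteqP; split => x /=; rewrite in_itv.
  have -> : T @^-1` `]a, b] = [set x | (T x <= b)%R] `\` [set x | (T x <= a)%R].
    apply/seteqP; split => x /=; rewrite in_itv/=.
      by move=> /andP[aT Tb]; split => //; apply/negP; rewrite -ltNge.
    by move=> [-> /negP]; rewrite -ltNge andbT.
  have -> : leb ([set x | (T x <= b)%R] `\` [set x | (T x <= a)%R]) =
      leb [set x | (T x <= b)%R] - leb ([set x | (T x <= b)%R] `&` [set x | (T x <= a)%R]).
    by apply: measureD => //; apply: le_lt_trans (ltry (Num.max b 0%R)); rewrite -radial_volume_le.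
  have -> : [set x | (T x <= b)%R] `&` [set x | (T x <= a)%R] = [set x | (T x <= a)%R].
    by apply/setIidr => x /= /le_trans; apply; exact: ltW.
  rewrite !radial_volume_le.
  have -> : `]a, b] `&` `]-oo, 0%R] = `]a, Num.min b 0%R]%classic.
    by apply/seteqP; split => x /=; rewrite !in_itv/= le_min;
      [move=> [/andP[-> ->] ->]|move=> /andP[-> /andP[-> ->]]].
  rewrite lebesgue_measure_itv/= lte_fin.
  rewrite lt_min ab /=.
  have [b0|b0] := leP b 0%R; have [a0|a0] := ltP a 0%R; rewrite /= -?EFinB -?EFinD; congr EFin; lra.
have E := ge0_integral_pushforward mT leb (D := `]0%R, +oo[%classic) (f := k).
transitivity (\int[leb]_(x in T' @^-1` `]0%R, +oo[) k (T x)).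
  have mD : measurable (T' @^-1` `]0%R, +oo[).
    by rewrite -[X in measurable X]setTI; apply: (measurable_radial_volume).
  rewrite -(setUv (T' @^-1` `]0%R, +oo[)) ge0_integral_setU//=; last 3 first.
  - exact: measurableC.
  - by rewrite setUv; exact: measurableT_comp.
  - by apply/disj_setPS; rewrite setICr.
  rewrite [X in _ + X]null_set_integral ?adde0//.
  - exact: measurableC.
  - by apply: measurable_funTS; exact: measurableT_comp.
  - rewrite -[RHS]leb_enorm_le0; congr (leb _); apply/seteqP; split => x /=.
      move=> /negP; rewrite in_itv/= andbT -leNgt /T' /T pmulr_rle0 ?unit_ball_volume_gt0// => H'.
      have : (enorm x ^+ N == 0)%R by rewrite eq_le H' exprn_ge0// enorm_ge0.
      by rewrite expf_eq0 N0 /= => /eqP ->.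
    move=> x0; apply/negP; rewrite in_itv/= andbT -leNgt.
    by rewrite /T' /T (_ : enorm x = 0%R) ?expr0n ?gtn_eqF ?mulr0//;
      apply/le_anti; rewrite x0 enorm_ge0.
rewrite -[LHS]E//; last exact: measurable_funTS.
rewrite [RHS](eq_measure_integral nu); last by move=> A mA _; exact: H.
apply: eq_measure_integral => A mA AD /=.
rewrite nuE.
rewrite [X in _ + leb1 X](_ : _ = set0) ?measure0 ?adde0//.
apply/seteqP; split => x //= [/AD]; rewrite /= !in_itv/= andbT => h.
by rewrite leNgt h.
Qed.

(** The substitution s = w r ^+ N in the integral over the values of the radial volume. *)
Lemma ge0_integral_polar (k : R -> R) (b : R) : (0 <= b)%R ->
  continuous k -> (forall r, (0 <= k r)%R) -> (forall r, (b <= r)%R -> k r = 0%R) ->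
  \int[leb]_x (k (enorm x))%:E =
  (w * N%:R * \int[leb1]_(r in `[0%R, b]) (k r * r ^+ N.-1))%:E.
Proof.
move=> b0 ck k0 kb.
have [b00|b00] := eqVneq b 0%R.
  rewrite b00 set_itv1 Rintegral_set1 mulr0 integral0_eq// => x _.
  by rewrite kb// b00 enorm_ge0.
have {b00}b0 : (0 < b)%R by rewrite lt0r b00.
have w0 := unit_ball_volume_gt0.
pose F r := (w * r ^+ N)%R.
pose rt s : R := (`|s / w| `^ N%:R^-1)%R.
have Ni0 : (0 < N%:R^-1 :> R)%R by rewrite invr_gt0 ltr0n.
have rtF r : (0 <= r)%R -> rt (F r) = r.
  move=> r0; rewrite /rt /F mulrAC divff ?gt_eqF// mul1r ger0_norm ?exprn_ge0//.
  by rewrite -powR_mulrn// -powRrM divff ?powRr1// pnatr_eq0 -lt0n.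
have crt : continuous rt.
  have c1 : continuous (fun s : R => s / w)%R.
    by move=> s; apply: cvgMr_tmp; exact: cvg_id.
  have c2 := continuous_normpow Ni0.
  by move=> s; apply: (@continuous_comp R R R (fun s => s / w)%R (fun y : R => `|y| `^ N%:R^-1)%R s (c1 s)); exact: c2.
have ckrt : continuous (k \o rt).
  by move=> s; apply: continuous_comp; [exact: crt|exact: ck].
pose K s := (k (rt s))%:E.
have -> : \int[leb]_x (k (enorm x))%:E = \int[leb]_x K (T x).
  by apply: eq_integral => x _; rewrite /K rtF ?enorm_ge0.
rewrite ge0_integral_radial_volume; last 2 first.
- by apply/measurable_EFinP; apply: continuous_measurable_fun.
- by move=> s; rewrite lee_fin.
have F0 : F 0%R = 0%R by rewrite /F expr0n gtn_eqF// mulr0.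
have dF (r : R) : is_derive r 1%R F (w * N%:R * r ^+ N.-1)%R.
  have h := @is_deriveX _ _ id N r 1%R 1%R (is_derive_id _ _).
  have := @is_deriveZ _ _ _ _ w r 1%R _ h.
  rewrite /GRing.scale/= mulr1 mulrA; congr is_derive.
  by apply/funext => y; rewrite /F !fctE.
have F'E : F^`()%classic = (fun r => w * N%:R * r ^+ N.-1)%R.
  by apply/funext => r; rewrite derive1E; case: (dF r) => _ ->.
have cF' : continuous (F^`()%classic).
  rewrite F'E => r; apply: cvgM; first exact: cvg_cst.
  exact: exprn_continuous.
have cF : continuous F.
  by move=> x; apply/differentiable_continuous/derivable1_diffP; case: (dF x).
have Fb0 : (0 < F b)%R by rewrite mulr_gt0// exprn_gt0.
transitivity (\int[leb1]_(s in `[0%R, F b]) K s).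
  rewrite -integral_itv_obnd_cbnd//; last first.
    by apply: measurable_funTS; apply/measurable_EFinP; exact: continuous_measurable_fun.
  rewrite [in LHS]integral_mkcond [in RHS]integral_mkcond.
  apply: eq_integral => s _; rewrite !patchE.
  have -> : (s \in `]0%R, F b]%classic) = ((s \in `]0%R, +oo[%classic) && (s <= F b)%R).
    apply/idP/idP => [|/andP[]].
      by rewrite inE/= in_itv/= => /andP[s0 ->]; rewrite andbT inE/= in_itv/= s0.
    by rewrite !inE/= !in_itv/= andbT => -> ->.
  case: (boolP (s \in _)) => //= s0; case: leP => //= Fbs.
  move: s0; rewrite inE/= in_itv/= andbT => s0.
  rewrite /K kb//.
  have -> : b = rt (F b) by rewrite rtF// ltW.
  apply: ge0_ler_powR; [exact: ltW|by rewrite nnegrE|by rewrite nnegrE|].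
  rewrite (ger0_norm (divr_ge0 (ltW Fb0) (ltW w0))) (ger0_norm (divr_ge0 (ltW s0) (ltW w0))).
  by rewrite ler_pM2r ?invr_gt0// ltW.
rewrite -[in LHS]F0 (@integration_by_substitution_increasing _ F (k \o rt) 0%R b)//.
- rewrite F'E /Rintegral EFinM fineK; last first.
    apply: integrable_fin_num => //; apply: continuous_integrable_itv.
    by move=> r; apply: cvgM; [exact: ck|exact: exprn_continuous].
  rewrite -integralZl//; last first.
    apply: continuous_integrable_itv.
    by move=> r; apply: cvgM; [exact: ck|exact: exprn_continuous].
  apply: eq_integral => r; rewrite inE/= in_itv/= => /andP[r0 _].
  rewrite -EFinM; congr EFin; rewrite !fctE /= rtF//; ring.
- exact: ltW.
- move=> x y; rewrite !in_itv/= => /andP[x0 _] /andP[y0 _] xy.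
  by rewrite /F ltr_pM2l// ltr_pXn2r ?nnegrE.
- by apply/cvg_ex; exists (F^`()%classic 0%R); apply/cvg_at_right_filter/cF'.
- by apply/cvg_ex; exists (F^`()%classic b); apply/cvg_at_left_filter/cF'.
- split.
  + by move=> r _; case: (dF r).
  + exact/cvg_at_right_filter/cF.
  + exact/cvg_at_left_filter/cF.
- exact: continuous_subspaceT.
Qed.

End polar.

(** * Radial test functions *)

Section test_functions.
Context {R : realType} {N : nat}.
Hypothesis N0 : (0 < N)%N.
Implicit Types (f g : 'rV[R]_N -> R) (x : 'rV[R]_N) (r : R).
Local Notation leb1 := (@lebesgue_measure R).
Local Notation leb := (@lebesgueN R N).
Let i0 : 'I_N := Ordinal N0.
Let e0 : 'rV[R]_N := delta_mx ord0 i0.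

(** A radial f is determined by its values on the first coordinate axis; r may be
negative, so that the profile is an even differentiable function on R. *)
Definition profile f r : R := f (r *: e0).
Definition dprofile f r : R := partial i0 f (r *: e0).

Let enorm_delta i : enorm (delta_mx ord0 i : 'rV[R]_N) = 1.
Proof.
rewrite /enorm (bigD1 i)//= big1 ?addr0 ?mxE ?eqxx ?expr1n ?sqrtr1// => j ji.
by rewrite mxE eqxx (negbTE ji) expr0n.
Qed.

Lemma radial_profile f x : radial f -> f x = profile f (enorm x).
Proof.
by move=> rf; apply: rf; rewrite enormZ enorm_delta mulr1 ger0_norm ?enorm_ge0.
Qed.

Lemma profile_even f r : radial f -> profile f (- r) = profile f r.
Proof. by move=> rf; apply: rf; rewrite !enormZ normrN. Qed.

Lemma is_derive_line f x i (d : R) : is_derive x (delta_mx ord0 i) f d <->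
  is_derive (0 : R) 1 (fun h : R => f (h *: delta_mx ord0 i + x)) d.
Proof.
have E : (fun h : R => h^-1 *: ((f \o shift x) (h *: delta_mx ord0 i) - f x)) =
  (fun h : R => h^-1 *: (((fun h : R => f (h *: delta_mx ord0 i + x)) \o shift 0) (h *: (1 : R))
      - f (0 *: delta_mx ord0 i + x))).
  by apply/funext => h /=; rewrite addr0 scale0r add0r /GRing.scale/= mulr1.
split => -[df Df]; split.
- by move: df; rewrite /derivable E.
- by rewrite -Df /derive E.
- by rewrite /derivable E.
- by rewrite -Df /derive E.
Qed.

Lemma is_derive_profile f r : smooth f ->
  is_derive r 1 (profile f) (dprofile f r).
Proof.
move=> sf; have [_ df] := sf [::].
have /is_derive_line h : is_derive (r *: e0) e0 f (dprofile f r).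
  by split => //; exact: df.
have h2 : is_derive r 1 (fun y : R => y - r) 1.
  have := @is_deriveB _ _ _ id (cst r) r 1 1 0 (is_derive_id _ _) (is_derive_cst _ _ _).
  by rewrite subr0.
have h3 : is_derive (r - r) 1 (fun h : R => f (h *: delta_mx ord0 i0 + r *: e0)) (dprofile f r).
  by rewrite subrr.
have := @is_derive1_comp _ _ (fun y : R => y - r) r _ _ h3 h2; rewrite mulr1.
congr is_derive; apply/funext => y /=; rewrite /profile -scalerDl.
by rewrite subrK.
Qed.

Lemma continuous_dprofile f : smooth f -> continuous (dprofile f).
Proof.
move=> sf; have [cf _] := sf [:: i0] => r.
apply: (@continuous_comp _ _ _ (fun r : R => r *: e0) (partial i0 f)).
  exact: scalel_continuous.
exact: cf.
Qed.

Lemma continuous_profile f : smooth f -> continuous (profile f).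
Proof.
move=> sf r; apply/differentiable_continuous/derivable1_diffP.
by case: (is_derive_profile r sf).
Qed.

(** An even function has a critical point at 0. *)
Lemma dprofile0 f : smooth f -> radial f -> dprofile f 0 = 0.
Proof.
move=> sf rf; have h := is_derive_profile 0 sf.
have h2 : is_derive (0 : R) 1 (-%R : R -> R) (- 1) by exact: is_deriveNid.
have h1 : is_derive (- 0 : R) 1 (profile f) (dprofile f 0) by rewrite oppr0.
have := @is_derive1_comp _ (profile f) -%R 0 _ _ h1 h2.
have -> : profile f \o -%R = profile f by apply/funext => r; exact: profile_even.
case: h => _ h [_]; rewrite h mulrN1; lra.
Qed.

(** The square of |x + h e_i| is a quadratic polynomial in h; at x = 0 radiality
reduces the claim to the first axis. *)
Lemma partial_radial f i x : smooth f -> radial f ->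
  partial i f x = dprofile f (enorm x) * (x ord0 i / enorm x).
Proof.
move=> sf rf; rewrite /partial.
have [x0|x0] := eqVneq (enorm x) 0.
  rewrite (enorm_eq0 x0) mxE !mul0r mulr0 -(dprofile0 sf rf).
  have : is_derive (0 : 'rV[R]_N) (delta_mx ord0 i) f (dprofile f 0).
    apply/is_derive_line.
    have -> : (fun h : R => f (h *: delta_mx ord0 i + 0)) = profile f.
      by apply/funext => h; apply: rf; rewrite addr0 !enormZ !enorm_delta.
    exact: is_derive_profile.
  by case.
have x1 : 0 < enorm x by rewrite lt0r x0 enorm_ge0.
suff : is_derive x (delta_mx ord0 i) f (dprofile f (enorm x) * (x ord0 i / enorm x)) by case.
apply/is_derive_line.
pose Q (h : R) := h ^+ 2 + 2 * x ord0 i * h + enorm x ^+ 2.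
have QE (h : R) : enorm (h *: delta_mx ord0 i + x) = Num.sqrt (Q h).
  rewrite -[LHS]ger0_norm ?enorm_ge0// -sqrtr_sqr; congr Num.sqrt.
  rewrite /Q !sqr_enorm (bigD1 i)//= [in RHS](bigD1 i)//= !mxE !eqxx mulr1.
  have -> : \sum_(j < N | j != i) (h *: delta_mx ord0 i + x) ord0 j ^+ 2 =
      \sum_(j < N | j != i) x ord0 j ^+ 2.
    by apply: eq_bigr => j ji; rewrite !mxE eqxx (negbTE ji) mulr0 add0r.
  ring.
have dQ : is_derive (0 : R) 1 Q (2 * x ord0 i).
  have d1 : is_derive (0 : R) 1 (fun h : R => h ^+ 2) 0.
    have := @is_deriveX _ _ id 2 (0 : R) 1 1 (is_derive_id _ _).
    rewrite /= mulr0 scale0r; congr is_derive.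
  have d2 : is_derive (0 : R) 1 (fun h : R => 2 * x ord0 i * h) (2 * x ord0 i).
    have := @is_deriveZ _ _ _ id (2 * x ord0 i) (0 : R) 1 1 (is_derive_id _ _).
    by rewrite /GRing.scale/= mulr1.
  have d3 := @is_derive_cst _ _ _ (enorm x ^+ 2) (0 : R) (1 : R).
  have := is_deriveD (is_deriveD d1 d2) d3.
  by rewrite add0r addr0.
have Q0 : Q 0 = enorm x ^+ 2 by rewrite /Q expr0n mulr0 !add0r.
have sQ0 : Num.sqrt (Q 0) = enorm x by rewrite Q0 sqrtr_sqr ger0_norm ?enorm_ge0.
have dsQ : is_derive (0 : R) 1 (Num.sqrt \o Q) (x ord0 i / enorm x).
  have Qp : 0 < Q 0 by rewrite Q0 exprn_gt0.
  have := is_derive1_comp (is_derive1_sqrt Qp) dQ; rewrite sQ0.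
  by rewrite invfM mulrACA mulVf ?pnatr_eq0// mul1r mulrC.
have dF : is_derive ((Num.sqrt \o Q) 0) 1 (profile f) (dprofile f (enorm x)).
  by rewrite /= sQ0; exact: is_derive_profile.
have := is_derive1_comp dF dsQ; congr is_derive.
by apply/funext => h /=; rewrite [RHS]radial_profile// QE.
Qed.

Lemma enorm_grad f x : smooth f -> radial f ->
  enorm (grad f x) = `|dprofile f (enorm x)|.
Proof.
move=> sf rf.
have -> : grad f x = (dprofile f (enorm x) / enorm x) *: x.
  by apply/rowP => i; rewrite !mxE partial_radial// mulrAC mulrA.
rewrite enormZ normrM normfV (ger0_norm (enorm_ge0 x)).
have [x0|x0] := eqVneq (enorm x) 0; last by rewrite mulfVK.
by rewrite x0 dprofile0// normr0 !mul0r.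
Qed.

Lemma measurable_radial f : smooth f -> radial f -> measurable_fun setT f.
Proof.
move=> sf rf; have -> : f = profile f \o enorm.
  by apply/funext => x; exact: radial_profile.
apply: measurableT_comp; last exact: measurable_enorm.
by apply: continuous_measurable_fun; exact: continuous_profile.
Qed.

Lemma measurable_grad f : smooth f -> radial f -> measurable_fun setT (grad f).
Proof.
move=> sf rf; apply: measurable_fun_rV => i.
have -> : (fun x => grad f x ord0 i) =
    (fun x => (dprofile f \o enorm) x * (x ord0 i * enorm x `^ (- 1))).
  by apply/funext => x; rewrite mxE partial_radial// powR_inv1// enorm_ge0.
apply: measurable_funM.
  apply: measurableT_comp; last exact: measurable_enorm.
  by apply: continuous_measurable_fun; exact: continuous_dprofile.
apply: measurable_funM; first exact: measurable_rV_coord.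
apply: (@measurableT_comp _ _ _ _ _ _ (fun y : R => y `^ (- 1))).
  exact: measurable_powR.
exact: measurable_enorm.
Qed.

Lemma profile_support f : compact (closure [set x | f x != 0]) ->
  exists2 b : R, 0 < b & forall r, b <= r -> profile f r = 0.
Proof.
move=> /compact_bounded [M [_ HM]].
have e00 : 0 < `|e0|.
  rewrite normr_gt0; apply: contraTneq (lt0r_neq0 (@ltr01 R)) => e00.
  by rewrite -(enorm_delta i0) -/e0 e00 enorm0 eqxx.
pose b := (`|M| + 1 + 1) / `|e0|.
exists b => [|r br]; first by rewrite divr_gt0// !addr_gt0 ?ltr_pwDr.
apply/eqP/negPn/negP => fr.
have := HM (`|M| + 1); rewrite (le_lt_trans (ler_norm _)) ?ltrDl// => /(_ isT).
move=> /(_ (r *: e0)) H.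
have : `|r *: e0| <= `|M| + 1 by apply: H; exact: subset_closure.
have r0 : 0 <= r.
  by apply: le_trans br; rewrite divr_ge0// !addr_ge0.
rewrite normrZ ger0_norm// -ler_pdivlMr// => h.
have := le_trans br h; rewrite /b ler_pM2r ?invr_gt0//.
by rewrite leNgt ltrDl ltr01.
Qed.

Lemma dprofile_support f b : smooth f -> (forall r, b <= r -> profile f r = 0) ->
  forall r, b < r -> dprofile f r = 0.
Proof.
move=> sf fb r br; have [_ <-] := is_derive_profile r sf.
rewrite -(@derive_cst R R R 0 r 1); apply: near_eq_derive.
near=> y; rewrite fb//; apply: ltW; near: y; exact: lt_nbhsr.
Unshelve. all: by end_near. Qed.

Lemma Drad_support f : Drad f -> exists2 b : R, 0 < b &
  forall r, b <= r -> profile f r = 0 /\ dprofile f r = 0.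
Proof.
move=> [sf /profile_support[b b0 fb] rf]; exists (b + 1); first by rewrite addr_gt0.
move=> r br; split; first by apply: fb; apply: le_trans br; rewrite lerDl.
by apply: (dprofile_support sf fb); apply: lt_le_trans br; rewrite ltrDl.
Qed.

End test_functions.

Section Drad_linear.
Context {R : realType} {N : nat}.
Implicit Types (f g : 'rV[R]_N -> R) (a : R).

Lemma foldr_partial_lin a f g s : smooth f -> smooth g ->
  foldr partial (a *: f + g) s = a *: foldr partial f s + foldr partial g s.
Proof.
move=> sf sg; elim: s => //= i s ->; apply/funext => x; rewrite /partial.
have df : derivable (foldr partial f s) x (delta_mx ord0 i) by case: (sf s) => _; exact.
have dg : derivable (foldr partial g s) x (delta_mx ord0 i) by case: (sg s) => _; exact.
rewrite deriveD//; last exact: derivableZ.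
by rewrite deriveZ.
Qed.

Lemma Drad_lin a f g : Drad f -> Drad g -> Drad (a *: f + g).
Proof.
move=> [sf kf rf] [sg kg rg]; split.
- move=> s; rewrite /= foldr_partial_lin//; have [cf df] := sf s; have [cg dg] := sg s.
  split => [x|i x].
    have c1 : {for x, continuous (a *: foldr partial f s)}.
      have c0 : {for x, continuous (fun _ : 'rV[R]_N => a)} by exact: cst_continuous.
      exact: (@continuousM R _ (fun _ => a) (foldr partial f s) x c0 (cf x)).
    exact: (continuousD c1 (cg x)).
  by apply: derivableD => //; exact: derivableZ.
- apply: (@subclosed_compact _ _ (closure [set x | f x != 0] `|` closure [set x | g x != 0])).
  + exact: closed_closure.
  + exact: compactU.
  + rewrite -closureU; apply: closure_subset => x /=.
    rewrite -[(_ + _) x]/(a * f x + g x).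
    case: (eqVneq (f x) 0) => [->|]; last by left.
    by rewrite mulr0 add0r; right.
- by move=> x y xy; rewrite -[LHS]/(a * f x + g x) (rf _ _ xy) (rg _ _ xy).
Qed.

Lemma DradB f g : Drad f -> Drad g -> Drad (f - g).
Proof.
by move=> Df Dg; have := Drad_lin (-1) Dg Df; rewrite scaleN1r addrC.
Qed.

Lemma gradB f g x : smooth f -> smooth g -> grad (f - g) x = grad f x - grad g x.
Proof.
move=> sf sg; apply/rowP => i; rewrite !mxE.
have := foldr_partial_lin (-1) [:: i] sg sf; rewrite /= !scaleN1r.
by rewrite (addrC (- g)) => ->; rewrite addrC.
Qed.

End Drad_linear.

(** * Powers and the modular of the sum space *)

Section powers.
Context {R : realType}.
Implicit Types (a b p q s t x y : R).

Lemma powR_le_add x a s b : 0 < a -> a <= s -> s <= b -> 0 <= x ->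
  x `^ s <= x `^ a + x `^ b.
Proof.
move=> a0 as_ sb; rewrite le_eqVlt => /predU1P[<-|x0].
  by rewrite !powR0 ?addr0 ?gt_eqF//; lra.
have [x1|x1] := leP x 1.
- by apply: ler_wpDr; [exact: powR_ge0|apply: ger_powR => //; rewrite x0].
- by apply: ler_wpDl; [exact: powR_ge0|apply: ler_powR => //; exact: ltW].
Qed.

Lemma powR_addl_le x y a : 0 < a -> 0 <= x -> 0 <= y ->
  (x + y) `^ a <= 2 `^ a * (x `^ a + y `^ a).
Proof.
move=> a0 x0 y0; wlog xy : x y x0 y0 / x <= y.
  move=> H; have [/H->//|/ltW/H] := leP x y.
  by rewrite addrC [x `^ _ + _]addrC; apply.
apply: (@le_trans _ _ ((2 * y) `^ a)).
  apply: ge0_ler_powR; rewrite ?nnegrE ?addr_ge0 ?mulr_ge0//; [exact: ltW|].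
  lra.
by rewrite powRM// ler_wpM2l ?powR_ge0// lerDr powR_ge0.
Qed.

Lemma young_powR x y p e : 0 <= x -> 0 <= y -> 1 < p -> 0 < e ->
  x * y <= e * x `^ (p / (p - 1)) + e `^ (1 - p) * y `^ p.
Proof.
move=> x0 y0 p1 e0.
have p10 : 0 < p - 1 by lra.
have hE : p / (p - 1) = 1 + (p - 1)^-1 by field; rewrite gt_eqF.
have pp : 0 < 1 + (p - 1)^-1 by rewrite addr_gt0// invr_gt0.
have [H|H] := leP y (e * x `^ (p - 1)^-1).
  apply: ler_wpDr; first by rewrite mulr_ge0 ?powR_ge0.
  rewrite hE powRD; last by rewrite gt_eqF.
  by rewrite powRr1// mulrCA ler_wpM2l.
apply: ler_wpDl; first by rewrite mulr_ge0 ?powR_ge0// ltW.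
have y1 : 0 < y by apply: le_lt_trans H; rewrite mulr_ge0 ?powR_ge0// ltW.
have hxy : x `^ (p - 1)^-1 < y / e by rewrite ltr_pdivlMr// mulrC.
have xy : x < (y / e) `^ (p - 1).
  have := @gt0_ltr_powR R _ p10 (x `^ (p - 1)^-1) (y / e).
  rewrite !nnegrE powR_ge0 divr_ge0 ?(ltW y1) ?(ltW e0)// => /(_ isT isT hxy).
  by rewrite -powRrM mulVf ?gt_eqF// powRr1.
apply: (@le_trans _ _ ((y / e) `^ (p - 1) * y)); first by rewrite ler_wpM2r// ltW.
have -> : (y / e) `^ (p - 1) = e `^ (1 - p) * y `^ (p - 1).
  rewrite powRM ?invr_ge0 ?(ltW y1) ?(ltW e0)// -powR_inv1 ?(ltW e0)// -powRrM mulrC.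
  by congr (_ `^ _ * _); ring.
rewrite -(@mulr_powRB1 _ y p) ?(ltW y1)//; last by rewrite (lt_trans ltr01).
by rewrite -mulrA (mulrC y).
Qed.

(** This two-power function has the growth of phi(t^2), and its integral is a modular
for L^p + L^q. *)
Definition hpq p q t : R := Num.min (t `^ p) (t `^ q).

Section hpq.
Variables (p q : R).
Hypotheses (p0 : 1 < p) (pq : p < q).
Local Notation h := (hpq p q).
Let p_gt0 : 0 < p. Proof. exact: lt_trans ltr01 p0. Qed.
Let q_gt0 : 0 < q. Proof. exact: lt_trans p_gt0 pq. Qed.

Lemma hpq_ge0 t : 0 <= h t.
Proof. by rewrite /hpq le_min !powR_ge0. Qed.

Lemma hpq_le_p t : h t <= t `^ p.
Proof. by rewrite /hpq ge_min lexx. Qed.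

Lemma hpq_le_q t : h t <= t `^ q.
Proof. by rewrite /hpq ge_min lexx orbT. Qed.

Lemma hpq_ge1 t : 1 <= t -> h t = t `^ p.
Proof. by move=> t1; rewrite /hpq min_l// ler_powR// ltW. Qed.

Lemma hpq0 : h 0 = 0.
Proof. by rewrite /hpq !powR0 ?minxx// gt_eqF. Qed.

Lemma hpq_le1 t : 0 <= t <= 1 -> h t = t `^ q.
Proof.
move=> /andP[]; rewrite le_eqVlt => /predU1P[<- _|t0 t1].
  by rewrite hpq0 powR0// gt_eqF.
by rewrite /hpq min_r// ger_powR ?t0// ltW.
Qed.

Lemma hpq_homo s t : 0 <= s -> s <= t -> h s <= h t.
Proof.
move=> s0 st; have t0 := le_trans s0 st.
rewrite /hpq le_min !ge_min; apply/andP; split; apply/orP; [left|right];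
  by apply: ge0_ler_powR; rewrite ?nnegrE// ltW.
Qed.

Lemma hpq_gt0 t : 0 < t -> 0 < h t.
Proof. by move=> t0; rewrite /hpq lt_min !powR_gt0. Qed.

Lemma hpq_scale_le1 l t : 0 <= l <= 1 -> 0 <= t -> h (l * t) <= l `^ p * h t.
Proof.
move=> /andP[]; rewrite le_eqVlt => /predU1P[<- _ t0|l0 l1 t0].
  by rewrite mul0r hpq0 mulr_ge0 ?powR_ge0 ?hpq_ge0.
rewrite /hpq !powRM ?(ltW l0)// minr_pMr ?powR_ge0// ge_min !le_min.
have : l `^ q * t `^ q <= l `^ p * t `^ q.
  by rewrite ler_wpM2r ?powR_ge0// ger_powR ?l0// ltW.
move=> H; rewrite lexx/= H.
have [//|h1] := leP (l `^ p * t `^ p) (l `^ p * t `^ q).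
by rewrite orbC (le_trans H (ltW h1)).
Qed.

Lemma hpq_scale_ge1 l t : 1 <= l -> 0 <= t -> h (l * t) <= l `^ q * h t.
Proof.
move=> l1 t0; have l0 : 0 < l by lra.
rewrite /hpq !powRM ?(ltW l0)// minr_pMr ?powR_ge0// ge_min !le_min.
have : l `^ p * t `^ p <= l `^ q * t `^ p.
  by rewrite ler_wpM2r ?powR_ge0// ler_powR// ltW.
move=> H; rewrite lexx/= H.
have [//|h1] := leP (l `^ q * t `^ q) (l `^ q * t `^ p).
  by rewrite orbT.
by rewrite andbT (le_trans H (ltW h1)).
Qed.

Lemma hpq_add s t : 0 <= s -> 0 <= t -> h (s + t) <= 2 `^ q * (h s + h t).
Proof.
move=> s0 t0; wlog st : s t s0 t0 / s <= t.
  move=> H; have [/H->//|/ltW/H] := leP s t.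
  by rewrite addrC [h s + _]addrC; apply.
apply: (@le_trans _ _ (h (2 * t))).
  by apply: hpq_homo; [exact: addr_ge0|lra].
apply: le_trans (hpq_scale_ge1 _ _) _; rewrite ?ler1n//.
by rewrite ler_wpM2l ?powR_ge0// lerDr hpq_ge0.
Qed.

(** For t > K, h t = t^p is at least K^(p-1) t. *)
Lemma hpq_linear K t : 1 <= K -> 0 <= t -> t <= K + K `^ (1 - p) * h t.
Proof.
move=> K1 t0; have K0 : 0 < K by lra.
have [tK|Kt] := leP t K.
  by apply: ler_wpDr => //; rewrite mulr_ge0 ?powR_ge0 ?hpq_ge0.
apply: ler_wpDl; first by rewrite ltW.
have t1 : 0 < t by lra.
rewrite hpq_ge1; last by lra.
rewrite -(@mulr_powRB1 _ t p)// mulrCA -[leLHS]mulr1 ler_wpM2l//.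
have -> : 1 - p = - (p - 1) by ring.
rewrite powRN mulrC ler_pdivlMr ?powR_gt0// mul1r.
by have := p0; move=> p0'; apply: ge0_ler_powR; rewrite ?nnegrE; lra.
Qed.

(** Young inequality with exponent p where h y = y^p and q where h y = y^q; since
e <= 1, e^(1-q) is the larger of the two constants. *)
Lemma young_hpq x y e : 0 <= x -> 0 <= y -> 0 < e <= 1 ->
  x * y <= e * (x `^ (p / (p - 1)) + x `^ (q / (q - 1))) + e `^ (1 - q) * h y.
Proof.
move=> x0 y0 /andP[e0 e1].
have [y1|y1] := leP 1 y.
  rewrite hpq_ge1//; apply: le_trans (young_powR x0 y0 p0 e0) _.
  have pq' := pq; apply: lerD.
    by apply: ler_wpM2l; [exact: ltW|rewrite lerDl powR_ge0].
  rewrite ler_wpM2r ?powR_ge0//; apply: ger_powR; rewrite ?e0//; lra.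
rewrite hpq_le1; last by rewrite y0 ltW.
apply: le_trans (young_powR x0 y0 (lt_trans p0 pq) e0) _.
by apply: lerD => //; apply: ler_wpM2l; [exact: ltW|rewrite lerDr powR_ge0].
Qed.

Lemma measurable_hpq : measurable_fun setT h.
Proof. by apply: measurable_minr; exact: measurable_powR. Qed.

End hpq.
End powers.

(** * Extraction of subsequences *)

Section extraction.
Context {R : realType}.
Implicit Types (s : nat -> nat) (u : nat -> R).

Definition extraction s := {homo s : k l / (k < l)%N}.

Lemma extraction_ge s n : extraction s -> (n <= s n)%N.
Proof. by move=> si; elim: n => // n IH; exact: leq_ltn_trans IH (si _ _ (ltnSn n)). Qed.

Lemma extraction_comp s s' : extraction s -> extraction s' -> extraction (s \o s').
Proof. by move=> si si' k l kl; apply: si; exact: si'. Qed.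

Lemma extraction_cvg s : extraction s -> s n @[n --> \oo] --> \oo.
Proof.
move=> si A [m _ HA]; exists m => // n /= mn; apply: HA => /=.
exact: leq_trans mn (extraction_ge n si).
Qed.

Lemma subseq_frequently (P : nat -> nat -> Prop) :
  (forall i m, exists2 n, (m <= n)%N & P i n) ->
  exists s, extraction s /\ forall i, P i (s i).
Proof.
move=> H.
pose s := fix s i := match i with 0 => s2val (cid2 (H 0 0)) | j.+1 =>
  s2val (cid2 (H j.+1 (s j).+1)) end.
exists s; split; last by case=> [|i] /=; case: cid2.
apply: homo_ltn => [x y z|i /=]; first exact: ltn_trans.
by case: cid2.
Qed.

Lemma bounded_subseq u (M : R) : (forall n, `|u n| <= M) ->
  exists s, extraction s /\ cvg (u (s n) @[n --> \oo]).
Proof.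
move=> uM.
have [l [_ cl]] : exists l : R, (`[- M, M]%classic `&` cluster (u n @[n --> \oo])) l.
  apply: segment_compact; exists 0%N => // n _ /=.
  by rewrite in_itv/= -ler_norml.
have [s [si sP]] : exists s, extraction s /\ forall i, `|l - u (s i)| < i.+1%:R^-1.
  apply: (subseq_frequently (P := fun i n => `|l - u n| < i.+1%:R^-1)) => i m.
  have H1 : (u n @[n --> \oo]) (u @` [set n | (m <= n)%N]).
    by exists m => // n /= mn; exists n.
  have nb : nbhs l (ball l i.+1%:R^-1) by apply: nbhsx_ballx; rewrite invr_gt0.
  have [y [[n /= mn <-] yl]] := cl _ _ H1 nb.
  by exists n => //; move: yl; rewrite -ball_normE.
exists s; split => //; apply/cvg_ex; exists l; apply/cvgrPdist_lt => e e0; near=> n.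
apply: lt_trans (sP n) _.
by near: n; exact: near_infty_natSinv_lt (PosNum e0).
Unshelve. all: by end_near. Qed.
(** Cantor diagonal extraction. *)
Lemma diagonal_subseq (X : nat -> nat -> R) : (forall i, exists M, forall n, `|X i n| <= M) ->
  exists s, extraction s /\ forall i, cvg (X i (s n) @[n --> \oo]).
Proof.
move=> HX.
have step i s : exists s', extraction s' /\ cvg (X i (s (s' n)) @[n --> \oo]).
  by have [M HM] := HX i; exact: (@bounded_subseq (fun n => X i (s n)) M).
pose sg i s := sval (cid (step i s)).
have sgP i s : extraction (sg i s) /\ cvg (X i (s (sg i s n)) @[n --> \oo]).
  exact: svalP (cid (step i s)).
pose S := fix S n := match n with 0 => sg 0%N id | k.+1 => S k \o sg k.+1 (S k) end.
have Sext n : extraction (S n).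
  elim: n => [|n IH] /=; first exact: (sgP 0%N id).1.
  by apply: extraction_comp => //; exact: (sgP n.+1 (S n)).1.
have Scvg n : cvg (X n (S n m) @[m --> \oo]).
  case: n => [|n] /=; first exact: (sgP 0%N id).2.
  exact: (sgP n.+1 (S n)).2.
have Sfac i n : (i <= n)%N -> exists t, extraction t /\ S n = S i \o t.
  move=> iN; rewrite -(subnK iN); elim: (n - i)%N => [|k [t [te tE]]].
    by exists id; split.
  rewrite addSn /=; exists (t \o sg (k + i).+1 (S (k + i)%N)); split.
    by apply: extraction_comp => //; exact: (sgP _ _).1.
  by rewrite tE.
exists (fun n => S n n); split.
  apply: homo_ltn => [x y z|n /=]; first exact: ltn_trans.
  apply: Sext; have := extraction_ge n.+1 (sgP n.+1 (S n)).1.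
  exact: leq_trans.
move=> i; case/cvg_ex : (Scvg i) => l Xl; apply/cvg_ex; exists l.
apply/cvgrPdist_lt => e e0; move/cvgrPdist_lt : Xl => /(_ e e0)[m _ Hm].
exists (maxn i m) => // n /=; rewrite geq_max => /andP[i_n mn].
have [t [te ->]] := Sfac i n i_n; apply: Hm => /=.
exact: leq_trans mn (extraction_ge n te).
Qed.

End extraction.

(** * Limit theorems for integrals *)

Section measure_toolkit.
Context d (T : measurableType d) {R : realType} (mu : {measure set T -> \bar R}).
Implicit Types (f g h : T -> R) (F G : (T -> R)^nat).

(** Convergence to 0 of the integrals, the first of which may be infinite. *)
Definition int_small F := forall e : R, 0 < e ->
  \forall n \near \oo, (\int[mu]_x (F n x)%:E <= e%:E)%E.

Lemma borel_cantelli_ae (A : (set T)^nat) : (forall n, measurable (A n)) ->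
  (forall n, (mu (A n) <= (1 / (2 ^ n.+1)%:R)%:E)%E) ->
  {ae mu, forall x, \forall n \near \oo, ~ A n x}.
Proof.
move=> mA muA; exists (lim_sup_set A); split.
- by apply: bigcap_measurable => // k _; exact: bigcup_measurable.
- apply: lim_sup_set_cvg0 => //.
  apply: (@le_lt_trans _ _ 1%E); last exact: ltry.
  apply: le_trans (epsilon_trick0 xpredT (ler01)).
  exact: lee_nneseries.
- move=> x /= nx n _; apply: contrapT => nA; apply: nx.
  exists n => // k /= nk Akx; apply: nA; by exists k.
Qed.

Lemma markov_measure f (e : R) : measurable_fun setT f -> (forall x, 0 <= f x) ->
  0 < e -> (e%:E * mu [set x | (e <= f x)%R] <= \int[mu]_x (f x)%:E)%E.
Proof.
move=> mf f0 e0.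
have := @le_integral_comp_abse _ _ _ mu setT measurableT (EFin \o f) e id
  (@measurable_id _ _ _) (fun r => id) _ _ e0.
rewrite setTI => /(_ _ _).
have -> : [set x | (e%:E <= `|(EFin \o f) x|)%E] = [set x | e <= f x].
  by apply/seteqP; split => x /=; rewrite lee_fin ger0_norm.
have -> : (\int[mu]_x id `|(EFin \o f) x| = \int[mu]_x (f x)%:E)%E.
  by apply: eq_integral => x _ /=; rewrite ger0_norm.
by apply=> //; exact/measurable_EFinP.
Qed.

Lemma subseq_ex (P : nat -> nat -> Prop) :
  (forall i, \forall n \near \oo, P i n) ->
  exists s, extraction s /\ forall i, P i (s i).
Proof.
move=> HP; apply: subseq_frequently => i m.
have [k _ Hk] := HP i; exists (maxn m k); first exact: leq_maxl.
by apply: Hk => /=; exact: leq_maxr.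
Qed.

(** Markov inequality along a subsequence with summable bounds, then Borel-Cantelli. *)
Lemma int_small_ae_subseq F : (forall n, measurable_fun setT (F n)) ->
  (forall n x, 0 <= F n x) -> int_small F ->
  exists s, extraction s /\
    {ae mu, forall x, F (s n) x @[n --> \oo] --> 0}.
Proof.
move=> mF F0 sF.
pose c i : R := 1 / (2 ^ i.+1)%:R.
have c0 i : 0 < c i by rewrite divr_gt0// ltr0n expn_gt0.
have [s [si sP]] := @subseq_ex (fun i n => (\int[mu]_x (F n x)%:E <= (c i * c i)%:E)%E)
  (fun i => sF _ (mulr_gt0 (c0 i) (c0 i))).
exists s; split => //.
have mA n : measurable [set x | c n <= F (s n) x].
  rewrite [X in measurable X](_ : _ = F (s n) @^-1` `[c n, +oo[).
    by rewrite -[X in measurable X]setTI; exact: mF.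
  by apply/seteqP; split => x /=; rewrite in_itv/= andbT.
have /(borel_cantelli_ae mA) : forall n, (mu [set x | (c n <= F (s n) x)%R] <= (c n)%:E)%E.
  move=> n; have := le_trans (markov_measure (mF (s n)) (F0 _) (c0 n)) (sP n).
  by rewrite (EFinM (c n) (c n)) lee_pmul2l// lte_fin.
apply: filterS => x Hx; apply/cvgr0Pnorm_lt => e e0.
have ce : \forall n \near \oo, c n < e.
  have := @cvg_geometric R 1 (2^-1); rewrite ger0_norm// invf_lt1// ltr1n => /(_ isT).
  move=> /cvgr0Pnorm_lt /(_ e e0); apply: filterS => n; apply: le_lt_trans.
  rewrite /geometric/= mul1r ger0_norm ?exprn_ge0// /c div1r natrX exprS invfM.
  by rewrite exprVn ler_piMl ?invr_ge0 ?exprn_ge0// invf_le1// ler1n.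
near=> n; rewrite ger0_norm//.
have [|//] := ltP (F (s n) x) e; rewrite ?ltNge // => h.
exfalso; apply: (near Hx n) => //=; apply: le_trans h; apply: ltW.
by near: n.
Unshelve. all: by end_near. Qed.

Lemma fatou_le F f (C : \bar R) : (forall n, measurable_fun setT (F n)) ->
  measurable_fun setT f ->
  (forall n x, 0 <= F n x) -> (forall x, 0 <= f x) ->
  {ae mu, forall x, F n x @[n --> \oo] --> f x} ->
  (\forall n \near \oo, (\int[mu]_x (F n x)%:E <= C)%E) ->
  (\int[mu]_x (f x)%:E <= C)%E.
Proof.
move=> mF mf F0 f0 cF HC.
have m1 n : measurable_fun setT (EFin \o F n) by exact/measurable_EFinP.
apply: (@le_trans _ _ (\int[mu]_x limn_einf (fun n => (F n x)%:E))%E).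
  have l0 x : (0 <= limn_einf (fun n => (F n x)%:E))%E.
    rewrite limn_einf_lim; apply: lime_ge; first exact: is_cvg_einfs.
    apply: nearW => n; apply: le_ereal_inf_tmp => _ [k /= _ <-].
    by rewrite lee_fin.
  have ml : measurable_fun setT (fun x => limn_einf (fun n => (F n x)%:E)).
    rewrite /limn_einf; apply: measurableT_comp => //.
    apply: measurable_fun_limn_esup => n; apply: measurableT_comp => //.
    exact: m1.
  have ae : {ae mu, forall x, setT x -> ((f x)%:E <= limn_einf (fun n => (F n x)%:E))%E}.
    apply: filterS cF => x Fx _.
    have /cvg_limn_einf_sup[-> _] : (F n x)%:E @[n --> \oo] --> (f x)%:E.
      by apply/cvg_EFin; [exact: nearW|exact: Fx].
    exact: lexx.
  have f0' : forall x, setT x -> (0 <= (EFin \o f) x)%E by move=> x _; rewrite lee_fin.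
  have mf' : measurable_fun setT (EFin \o f) by exact/measurable_EFinP.
  exact: (ae_ge0_le_integral measurableT f0' mf' (fun x _ => l0 x) ml ae).
apply: le_trans (fatou mu measurableT m1 _) _; first by move=> n x _; rewrite lee_fin.
rewrite limn_einf_lim; apply: lime_le; first exact: is_cvg_einfs.
case: HC => m _ Hm; near=> n.
apply: (@le_trans _ _ (\int[mu]_x (F n x)%:E)%E).
  by apply: ereal_inf_lbound; exists n => /=.
by apply: Hm => /=; near: n; exists m.
Unshelve. all: by end_near. Qed.

(** The positive part of F_n - G_n is dominated by h, hence its integral tends to 0.
This is dominated convergence with a tolerance: G_n need not converge. *)
Lemma int_small_dominated F G h (e : R) :
  (forall n, measurable_fun setT (F n)) -> (forall n, measurable_fun setT (G n)) ->
  measurable_fun setT h ->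
  (forall n x, 0 <= F n x) -> (forall n x, 0 <= G n x) -> (forall x, 0 <= h x) ->
  (\int[mu]_x (h x)%:E < +oo)%E ->
  {ae mu, forall x, F n x @[n --> \oo] --> 0} ->
  {ae mu, forall x, forall n, F n x <= G n x + h x} ->
  (\forall n \near \oo, (\int[mu]_x (G n x)%:E <= e%:E)%E) ->
  forall c, 0 < c -> \forall n \near \oo, (\int[mu]_x (F n x)%:E <= (e + c)%:E)%E.
Proof.
move=> mF mG mh F0 G0 h0 ih cF FGh Ge c c0.
pose D n x := Num.max (F n x - G n x) 0.
have mD n : measurable_fun setT (D n).
  by apply: measurable_maxr => //; exact: measurable_funB.
have D0 n x : 0 <= D n x by rewrite le_max lexx orbT.
have [] := @dominated_convergence _ T R mu setT measurableT (fun n => EFin \o D n)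
    (cst 0%E) (EFin \o h).
- by move=> n; exact/measurable_EFinP.
- by [].
- apply: filterS cF => x Fx _ /=; apply/cvg_EFin; first by near=> n.
  apply: (@squeeze_cvgr _ _ _ _ (cst 0) (fun n => F n x)) => //; last exact: cvg_cst.
  near=> n; rewrite D0 /D ge_max F0 andbT lerBlDr lerDl; exact: G0.
- apply/integrableP; split; first exact/measurable_EFinP.
  by under eq_integral => x _ do rewrite /= ger0_norm//.
- apply: filterS FGh => x Fx n _ /=; rewrite lee_fin ger0_norm//.
  by rewrite /D ge_max h0 andbT lerBlDl.
move=> _ _; rewrite integral0 => cD.
have HD : \forall n \near \oo, (\int[mu]_x (D n x)%:E <= c%:E)%E.
  have fD : \forall n \near \oo, (\int[mu]_x (D n x)%:E)%E \is a fin_num.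
    by case/fine_cvgP : cD.
  case/fine_cvgP : cD => _ /cvgr0Pnorm_lt /(_ c c0) H.
  near=> n; have fDn : (\int[mu]_x (D n x)%:E)%E \is a fin_num by near: n.
  rewrite -(fineK fDn) lee_fin ltW//; apply: le_lt_trans (ler_norm _) _.
  by near: n.
near=> n.
apply: (@le_trans _ _ (\int[mu]_x ((G n x)%:E + (D n x)%:E))%E).
  have m1 : measurable_fun setT (EFin \o F n) by exact/measurable_EFinP.
  have m2 : measurable_fun setT (fun x => (G n x)%:E + (D n x)%:E)%E.
    by apply: emeasurable_funD; exact/measurable_EFinP.
  apply: (ge0_le_integral mu measurableT _ m1 m2) => x _.
  - by rewrite lee_fin.
  - by rewrite -EFinD lee_fin -lerBlDl le_max lexx.
rewrite ge0_integralD//; [|by move=> x _; rewrite lee_fin|exact/measurable_EFinP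
  |by move=> x _; rewrite lee_fin|exact/measurable_EFinP].
by rewrite EFinD; apply: leeD; near: n.
Unshelve. all: by end_near. Qed.

(** Along a fast subsequence the increments are, off a null set, eventually bounded by
a geometric series (Borel-Cantelli). *)
Lemma cauchy_in_measure_subseq (V : completeNormedModType R) (X : nat -> T -> V) :
  (forall e : R, 0 < e -> exists n, forall k, (n <= k)%N -> exists A,
     [/\ measurable A, (mu A <= e%:E)%E & forall x, ~ A x -> `|X k x - X n x| < e]) ->
  exists s, extraction s /\
    {ae mu, forall x, cvg (X (s n) x @[n --> \oo])}.
Proof.
move=> H.
pose c i : R := 1 / (2 ^ i.+1)%:R.
have c0 i : 0 < c i by rewrite divr_gt0// ltr0n expn_gt0.
have H2 (e : R) : 0 < e -> \forall n \near \oo, forall k, (n <= k)%N -> exists A,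
     [/\ measurable A, (mu A <= e%:E)%E & forall x, ~ A x -> `|X k x - X n x| < e].
  move=> e0; have [n Hn] := H _ (divr_gt0 e0 (ltr0n R 2)).
  exists n => // m /= nm k mk.
  have [A [mA Ae HA]] := Hn _ (leq_trans nm mk).
  have [B [mB Be HB]] := Hn _ nm.
  exists (A `|` B); split; first exact: measurableU.
    apply: (@le_trans _ _ (mu A + mu B)%E); first exact: measureU2.
    by rewrite (splitr e) EFinD leeD.
  move=> x /not_orP[nA nB]; rewrite (splitr e).
  have -> : X k x - X m x = (X k x - X n x) - (X m x - X n x).
    by rewrite opprB addrA subrK.
  by apply: le_lt_trans (ler_normB _ _) _; apply: ltrD; [exact: HA|exact: HB].
have [s [si sP]] := subseq_ex (fun i => H2 _ (c0 i)).
exists s; split => //.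
have /choice [A HA] : forall i, exists A, [/\ measurable A, (mu A <= (c i)%:E)%E &
    forall x, ~ A x -> `|X (s i.+1) x - X (s i) x| < c i].
  by move=> i; apply: sP; apply: ltnW; exact: si.
have mA i : measurable (A i) by have [] := HA i.
have /(borel_cantelli_ae mA) : forall n, (mu (A n) <= (c n)%:E)%E by move=> i; have [] := HA i.
apply: filterS => x [m _ Hm].
have cau : forall i j, (m <= i)%N -> (i <= j)%N -> `|X (s j) x - X (s i) x| <= c i * 2.
  move=> i j mi ij.
  rewrite -(subnK ij) addnC; move: (j - i)%N => k.
  suff : `|X (s (i + k)%N) x - X (s i) x| <= c i * 2 - c (i + k)%N * 2.
    by move=> /le_trans; apply; rewrite gerBl mulr_ge0// ltW.
  elim: k => [|k IH]; first by rewrite addn0 !subrr normr0.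
  rewrite addnS.
  have -> : X (s (i + k).+1) x - X (s i) x =
    (X (s (i + k).+1) x - X (s (i + k)%N) x) + (X (s (i + k)%N) x - X (s i) x).
    by rewrite addrA subrK.
  apply: le_trans (ler_normD _ _) _.
  have [_ _ /(_ x)] := HA (i + k)%N.
  have nA : ~ A (i + k)%N x by apply: Hm => /=; rewrite (leq_trans mi)// leq_addr.
  move=> /(_ nA) /ltW h.
  have cS : c (i + k).+1 * 2 = c (i + k)%N.
    by rewrite /c !div1r expnS natrM invfM mulrAC mulVf ?mul1r// pnatr_eq0.
  by rewrite cS; have := lerD h IH; lra.
apply/cauchy_cvgP; apply/cauchy_exP => e e0.
have : exists2 i, (m <= i)%N & c i * 2 < e.
  have : \forall n \near \oo, c n * 2 < e.
    have := @cvg_geometric R 1 (2^-1); rewrite ger0_norm// invf_lt1// ltr1n => /(_ isT).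
    move=> /cvgr0Pnorm_lt /(_ e e0); apply: filterS => n; apply: le_lt_trans.
    rewrite /geometric/= mul1r ger0_norm ?exprn_ge0// /c div1r natrX exprS invfM.
    by rewrite exprVn mulrAC mulVf ?pnatr_eq0// mul1r.
  move=> [i0 _ Hi]; exists (maxn m i0); first exact: leq_maxl.
  by apply: Hi => /=; exact: leq_maxr.
move=> [i mi ci]; exists (X (s i) x).
exists i => // j /= ij; rewrite -ball_normE /ball_/= -normrN opprB.
exact: le_lt_trans (cau _ _ mi ij) ci.
Qed.

End measure_toolkit.

(** * Sobolev, decay and continuity estimates for test functions *)

Section continuity_complements.
Context {R : realType}.
Implicit Types (p q s t x y : R).

Lemma continuous_hpq_norm p q : 0 < p -> 0 < q ->
  continuous (fun t : R => hpq p q `|t|).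
Proof.
move=> p0 q0; have h1 := continuous_normpow p0; have h2 := continuous_normpow q0.
by move=> t; exact: (continuous_min (h1 t) (h2 t)).
Qed.

Lemma continuous_normpow_sg s : 0 < s -> continuous (fun y : R => `|y| `^ s * Num.sg y).
Proof.
move=> s0 x; have [x0|x0|<-] := ltgtP 0 x.
- have E : \forall y \near x, `|y| `^ s * Num.sg y = `|y| `^ s.
    by near=> y; rewrite gtr0_sg ?mulr1//; near: y; exact: lt_nbhsr.
  rewrite /continuous_at gtr0_sg// mulr1.
  have cc : continuous (fun y : R => `|y| `^ s) := continuous_normpow s0.
  have := cc x; apply: cvg_trans; apply: near_eq_cvg.
  by apply: filterS E => y ->.
- have E : \forall y \near x, `|y| `^ s * Num.sg y = - `|y| `^ s.
    by near=> y; rewrite ltr0_sg ?mulrN1//; near: y; exact: lt_nbhsl.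
  rewrite /continuous_at ltr0_sg// mulrN1.
  have cc : continuous (fun y : R => `|y| `^ s) := continuous_normpow s0.
  have /cvgN h := cc x.
  move: h; apply: cvg_trans; apply: near_eq_cvg.
  by apply: filterS E => y ->.
- rewrite /continuous_at sgr0 mulr0; apply/cvgr0Pnorm_le => e e0.
  have /cvgrPdist_le /(_ e e0) := @continuous_normpow R s s0 0.
  apply: filterS => y; rewrite normr0 powR0 ?gt_eqF// sub0r normrN => H.
  rewrite normrM; apply: le_trans H; rewrite ler_piMr//.
  by rewrite normr_sg; case: (_ == _).
Unshelve. all: by end_near. Qed.

Lemma RintegralZ_itv (c a b : R) (u : R -> R) : continuous u ->
  \int[@lebesgue_measure R]_(x in `[a, b]) (c * u x) =
  c * \int[@lebesgue_measure R]_(x in `[a, b]) u x.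
Proof. by move=> cu; rewrite RintegralZl//; exact: continuous_integrable_itv. Qed.

Lemma RintegralD_itv (a b : R) (u v : R -> R) : continuous u -> continuous v ->
  \int[@lebesgue_measure R]_(x in `[a, b]) (u x + v x) =
  \int[@lebesgue_measure R]_(x in `[a, b]) u x + \int[@lebesgue_measure R]_(x in `[a, b]) v x.
Proof.
by move=> cu cv; rewrite RintegralD//; exact: continuous_integrable_itv.
Qed.

(** Beyond X0 = (C / e)^(1 / (1 - th)) the linear term dominates. *)
Lemma sublinear_powR (C th e : R) : 0 <= C -> 0 < th < 1 -> 0 < e ->
  exists2 K, 0 <= K & forall X, 0 <= X -> C * X `^ th <= e * X + K.
Proof.
move=> C0 /andP[th0 th1] e0.
pose X0 := (C / e) `^ (1 - th)^-1.
exists (C * X0 `^ th) => [|X X0']; first by rewrite mulr_ge0 ?powR_ge0.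
have [XX|XX] := leP X X0.
  apply: ler_wpDl; first by rewrite mulr_ge0// ltW.
  by rewrite ler_wpM2l// ge0_ler_powR ?nnegrE ?powR_ge0// ltW.
apply: ler_wpDr; first by rewrite mulr_ge0 ?powR_ge0.
have Xp : 0 < X by apply: le_lt_trans XX; exact: powR_ge0.
have th10 : 0 < 1 - th by rewrite subr_gt0.
have H : C / e <= X `^ (1 - th).
  have -> : C / e = X0 `^ (1 - th).
    by rewrite -powRrM mulVf ?gt_eqF// powRr1// divr_ge0// ltW.
  by apply: ge0_ler_powR; rewrite ?nnegrE ?powR_ge0// ltW.
rewrite ler_pdivrMr// in H.
have -> : e * X = X `^ (1 - th) * e * X `^ th.
  rewrite mulrAC -powRD; last by rewrite subrK oner_eq0.
  by rewrite subrK powRr1 ?ltW// mulrC.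
by rewrite ler_wpM2r// powR_ge0.
Qed.

End continuity_complements.

Section Drad_estimates.
Context {R : realType} (N : nat) (p q a : R).
Hypotheses (N2 : (2 <= N)%N) (p1 : 1 < p) (pq : p < q) (qN : q < N%:R).
Hypotheses (a1 : 1 < a) (aq : a <= crit_exp N p * conj_exp q / conj_exp p).
Local Notation leb1 := (@lebesgue_measure R).
Local Notation leb := (@lebesgueN R N).
Local Notation P := (crit_exp N p).
Let N0 : (0 < N)%N. Proof. exact: leq_trans N2. Qed.
Let n := N.-1.
Let n0 : (0 < n)%N. Proof. by rewrite /n -ltnS prednK. Qed.
Let nE : n%:R = N%:R - 1 :> R. Proof. by rewrite /n -subn1 natrB. Qed.

(** The power t of the profile to which the one-dimensional inequalities are applied:
t (1 + 1 / (N - 1)) = p* and (t - 1) p / (p - 1) = p*. *)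
Definition sob_exp : R := p * (N%:R - 1) / (N%:R - p).
Local Notation t := sob_exp.
(** The area of the unit sphere. *)
Definition polar_const : R := unit_ball_volume (R := R) (N := N) * N%:R.
Local Notation k := polar_const.

Let pN : p < N%:R. Proof. exact: lt_trans qN. Qed.
Let p0 : 0 < p. Proof. exact: lt_trans ltr01 p1. Qed.
Let q0 : 0 < q. Proof. exact: lt_trans p0 pq. Qed.
Let q1 : 1 < q. Proof. exact: lt_trans p1 pq. Qed.
Let NR0 : 0 < N%:R :> R. Proof. by rewrite ltr0n. Qed.
Let Np : 0 < N%:R - p. Proof. by rewrite subr_gt0. Qed.
Let N1 : 0 < N%:R - 1 :> R. Proof. by rewrite subr_gt0 ltr1n. Qed.

Lemma sob_exp_gt1 : 1 < t.
Proof.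
rewrite /t ltr_pdivlMr// mul1r -subr_gt0.
have -> : p * (N%:R - 1) - (N%:R - p) = N%:R * (p - 1) by ring.
by rewrite mulr_gt0// subr_gt0.
Qed.

Let t1 := sob_exp_gt1.
Let t0 : 0 < t. Proof. exact: lt_trans ltr01 t1. Qed.
Let tm : 0 < t - 1. Proof. by rewrite subr_gt0. Qed.

Lemma crit_exp_gt0 : 0 < P.
Proof. by rewrite /crit_exp divr_gt0// mulr_gt0. Qed.

Let PE1 : t * (1 + n%:R^-1) = P.
Proof. by rewrite /t /crit_exp nE; field; rewrite !gt_eqF. Qed.

Let PE2 : (t - 1) * (p / (p - 1)) = P.
Proof. by rewrite /t /crit_exp; field; rewrite !gt_eqF// subr_gt0. Qed.

Let s := (t - 1) * (q / (q - 1)).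

Let as_ : a <= s.
Proof.
apply: le_trans aq _; rewrite /s /conj_exp -PE2 le_eqVlt; apply/orP; left.
by apply/eqP; field; rewrite !gt_eqF// subr_gt0.
Qed.

Let sP : s <= P.
Proof.
rewrite -PE2 /s ler_wpM2l ?(ltW tm)//.
rewrite ler_pdivrMr ?subr_gt0// mulrAC ler_pdivlMr ?subr_gt0//.
have -> : q * (p - 1) = p * (q - 1) + (p - q) by ring.
by rewrite gerDl subr_le0 ltW.
Qed.

Lemma exp_lt_crit : a < P.
Proof.
apply: le_lt_trans as_ _; rewrite -PE2 /s ltr_pM2l//.
rewrite ltr_pdivrMr ?subr_gt0// mulrAC ltr_pdivlMr ?subr_gt0//.
have -> : q * (p - 1) = p * (q - 1) + (p - q) by ring.
by rewrite gtrDl subr_lt0.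
Qed.

Let a0 : 0 < a. Proof. exact: lt_trans ltr01 a1. Qed.

Lemma polar_const_gt0 : 0 < k.
Proof. by rewrite mulr_gt0// unit_ball_volume_gt0. Qed.

Section one_function.
Variables (f : 'rV[R]_N -> R) (Df : Drad f) (b : R) (b0 : 0 < b).
Local Notation F := (profile N0 f).
Local Notation F' := (dprofile N0 f).
Hypothesis Fb : forall r, b <= r -> F r = 0 /\ F' r = 0.
Let sf : smooth f. Proof. by case: Df. Qed.
Let rf : radial f. Proof. by case: Df. Qed.
Let cF := continuous_profile (N0 := N0) sf.
Let cF' := continuous_dprofile (N0 := N0) sf.

Let comp (u v : R -> R) : continuous u -> continuous v -> continuous (v \o u).
Proof. by move=> cu cv x; apply: continuous_comp; [exact: cu|exact: cv]. Qed.

(** Up to polar_const, the integral of |f|^e (int_mom). *)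
Definition mom e : R := \int[leb1]_(r in `[0, b]) (`|F r| `^ e * r ^+ n).
(** Up to polar_const, the modular of grad f (int_gmod). *)
Definition gmod : R := \int[leb1]_(r in `[0, b]) (hpq p q `|F' r| * r ^+ n).

Lemma int_mom e : 0 < e -> (\int[leb]_x (`|f x| `^ e)%:E = (k * mom e)%:E)%E.
Proof.
move=> e0; transitivity (\int[leb]_x ((fun r => `|F r| `^ e) (enorm x))%:E)%E.
  by apply: eq_integral => x _ /=; rewrite -(radial_profile N0).
have c1 := comp cF (continuous_normpow e0).
have z r : b <= r -> `|F r| `^ e = 0 by move=> /Fb[-> _]; rewrite normr0 powR0// gt_eqF.
exact: (ge0_integral_polar N0 (ltW b0) c1 (fun r => powR_ge0 _ _) z).
Qed.

Lemma int_gmod : (\int[leb]_x (hpq p q (enorm (grad f x)))%:E = (k * gmod)%:E)%E.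
Proof.
transitivity (\int[leb]_x ((fun r => hpq p q `|F' r|) (enorm x))%:E)%E.
  by apply: eq_integral => x _ /=; rewrite (enorm_grad N0).
have c1 := comp cF' (continuous_hpq_norm p0 q0).
have z r : b <= r -> hpq p q `|F' r| = 0 by move=> /Fb[_ ->]; rewrite normr0 hpq0.
exact: (ge0_integral_polar N0 (ltW b0) c1 (fun r => hpq_ge0 _ _ _) z).
Qed.

Lemma mom_ge0 e : 0 <= mom e.
Proof.
apply: Rintegral_ge0 => r /=; rewrite in_itv/= => /andP[r0 _].
by rewrite mulr_ge0 ?powR_ge0 ?exprn_ge0.
Qed.

Lemma gmod_ge0 : 0 <= gmod.
Proof.
apply: Rintegral_ge0 => r /=; rewrite in_itv/= => /andP[r0 _].
by rewrite mulr_ge0 ?hpq_ge0 ?exprn_ge0.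
Qed.

Let G r := `|F r| `^ t.
Let g r := t * `|F r| `^ (t - 1) * Num.sg (F r) * F' r.
Let I := \int[leb1]_(r in `[0, b]) (`|g r| * `|r| ^+ n).

Let dG (r : R) : is_derive r (1 : R) G (g r).
Proof.
have h1 := is_derive_normpow (F r) t1.
have h2 := is_derive_profile N0 r sf.
exact: is_derive1_comp h1 h2.
Qed.

Let cM (u v : R -> R) : continuous u -> continuous v -> continuous (fun x => u x * v x).
Proof. by move=> cu cv x; apply: cvgM; [exact: cu|exact: cv]. Qed.

Let cX m : continuous (fun x : R => x ^+ m).
Proof. exact: exprn_continuous. Qed.

Let cg : continuous g.
Proof.
apply: cM; last exact: cF'.
have -> : (fun r => t * `|F r| `^ (t - 1) * Num.sg (F r)) =
    (fun r => t * (`|F r| `^ (t - 1) * Num.sg (F r))).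
  by apply/funext => r; rewrite mulrA.
apply: cM; first exact: cst_continuous.
exact: (comp cF (continuous_normpow_sg tm)).
Qed.

Let normg r : `|g r| = t * (`|F r| `^ (t - 1) * `|F' r|).
Proof.
have -> : g r = t * (`|F r| `^ (t - 1) * (Num.sg (F r) * F' r)) by rewrite /g !mulrA.
rewrite normrM (gtr0_norm t0) normrM (ger0_norm (powR_ge0 _ _)) normrM normr_sg.
have [->|_] := eqVneq (F r) 0; last by rewrite mul1r.
by rewrite normr0 powR0 ?gt_eqF// !mul0r.
Qed.

(** Young inequality for |F|^(t-1) |F'|.  The powers of |F| it produces are p* and
s = p* q'/p', and a <= s <= p*: this is where the upper bound on a enters. *)
Lemma mom_young e : 0 < e <= 1 ->
  I <= t * (e * (2 * mom P + mom a) + e `^ (1 - q) * gmod).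
Proof.
move=> e01; have e0 : 0 < e by case/andP: e01.
have cm c : 0 < c -> continuous (fun r => `|F r| `^ c * r ^+ n).
  by move=> c0; apply: cM; [exact: (comp cF (continuous_normpow c0))|exact: cX].
have cgm : continuous (fun r => hpq p q `|F' r| * r ^+ n).
  by apply: cM; [exact: (comp cF' (continuous_hpq_norm p0 q0))|exact: cX].
have cMl c (u : R -> R) : continuous u -> continuous (fun r => c * u r).
  by move=> cu; apply: cM => //; exact: cst_continuous.
have cD (u v : R -> R) : continuous u -> continuous v -> continuous (fun r => u r + v r).
  by move=> cu cv x; apply: cvgD; [exact: cu|exact: cv].
have P0 := crit_exp_gt0.
have j1 := cMl 2 _ (cm _ P0).
have j2 := cD _ _ j1 (cm _ a0).
have j3 := cMl e _ j2.
have j4 := cMl (e `^ (1 - q)) _ cgm.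
have j5 := cD _ _ j3 j4.
have j6 := cMl t _ j5.
have -> : t * (e * (2 * mom P + mom a) + e `^ (1 - q) * gmod) =
   \int[leb1]_(r in `[0, b]) (t * (e * (2 * (`|F r| `^ P * r ^+ n) + `|F r| `^ a * r ^+ n)
     + e `^ (1 - q) * (hpq p q `|F' r| * r ^+ n))).
  by rewrite (RintegralZ_itv _ _ _ j5) (RintegralD_itv _ _ j3 j4) (RintegralZ_itv _ _ _ j2)
    (RintegralD_itv _ _ j1 (cm _ a0)) (RintegralZ_itv _ _ _ (cm _ P0)) (RintegralZ_itv _ _ _ cgm).
apply: le_Rintegral_itv.
- have c1 : continuous (fun x => `|g x|) by move=> x; apply: cvg_norm; exact: cg.
  have c2 : continuous (fun x : R => `|x| ^+ n).
    have c0 : continuous (fun x : R => `|x|) by exact: norm_continuous.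
    exact: (comp c0 (@cX n)).
  exact: cM c1 c2.
- exact: j6.
move=> r /andP[r0 rb]; rewrite normg (ger0_norm r0) -mulrA ler_wpM2l ?(ltW t0)//.
have H := @young_hpq _ p q p1 pq (`|F r| `^ (t - 1)) `|F' r| e (powR_ge0 _ _) (normr_ge0 _) e01.
rewrite -!powRrM PE2 -/s in H.
have H2 : `|F r| `^ s <= `|F r| `^ a + `|F r| `^ P by exact: powR_le_add.
have H3 : `|F r| `^ (t - 1) * `|F' r| <=
    e * (2 * `|F r| `^ P + `|F r| `^ a) + e `^ (1 - q) * hpq p q `|F' r|.
  apply: le_trans H _; rewrite lerD2r; apply: ler_wpM2l; first exact: ltW.
  lra.
have -> : e * (2 * (`|F r| `^ P * r ^+ n) + `|F r| `^ a * r ^+ n) +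
   e `^ (1 - q) * (hpq p q `|F' r| * r ^+ n) =
   (e * (2 * `|F r| `^ P + `|F r| `^ a) + e `^ (1 - q) * hpq p q `|F' r|) * r ^+ n by ring.
by rewrite ler_wpM2r// exprn_ge0.
Qed.

Lemma mom_sobolev : mom P <= I `^ (1 + n%:R^-1) / n%:R.
Proof.
have Gb : G b = 0 by rewrite /G (Fb (lexx b)).1 normr0 powR0// gt_eqF.
have := sobolev1d n0 (ltW b0) cg dG (fun x => powR_ge0 _ _) Gb.
apply: le_trans; rewrite le_eqVlt; apply/orP; left; apply/eqP.
apply: eq_Rintegral => r _.
by rewrite (ger0_norm (powR_ge0 _ _)) /G -powRrM PE1.
Qed.

Lemma profile_decay r : 0 <= r -> `|F r| `^ t * r ^+ n <= I.
Proof.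
move=> r0; have Gb : G b = 0 by rewrite /G (Fb (lexx b)).1 normr0 powR0// gt_eqF.
have [rb|/ltW br] := leP r b.
  have G0 x : 0 <= G x by exact: powR_ge0.
  by apply: (sobolev1d_pointwise n cg dG G0 Gb); rewrite r0.
rewrite (Fb br).1 normr0 powR0 ?gt_eqF// mul0r.
by apply: Rintegral_ge0 => x _; rewrite mulr_ge0.
Qed.

(** Integrate |F'| <= K + K^(1-p) h(|F'|); on [r1, r2] the weight of the modular is at
least r1 ^+ n. *)
Lemma profile_increment r1 r2 K : 1 <= K -> 0 < r1 -> r1 <= r2 ->
  `|F r2 - F r1| <= K * (r2 - r1) + K `^ (1 - p) * (gmod / r1 ^+ n).
Proof.
move=> K1 r10 r12.
have E := Rintegral_FTC2 r12 cF' (fun x => is_derive_profile N0 x sf).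
rewrite -E.
have ch : continuous (fun r => hpq p q `|F' r|).
  exact: (comp cF' (continuous_hpq_norm p0 q0)).
have cn : continuous (fun r => `|F' r|) by move=> x; apply: cvg_norm; exact: cF'.
have H1 : `|\int[leb1]_(x in `[r1, r2]) F' x| <= \int[leb1]_(x in `[r1, r2]) `|F' x|.
  by apply: le_normr_Rintegral => //; exact: continuous_integrable_itv.
apply: le_trans H1 _.
have cc : continuous (fun r => K `^ (1 - p) * hpq p q `|F' r|).
  by apply: cM => //; exact: cst_continuous.
have cc2 : continuous (fun r : R => K) by exact: cst_continuous.
have cc3 : continuous (fun r => K + K `^ (1 - p) * hpq p q `|F' r|).
  by move=> x; apply: cvgD; [exact: cc2|exact: cc].
apply: (@le_trans _ _ (\int[leb1]_(x in `[r1, r2]) (K + K `^ (1 - p) * hpq p q `|F' x|))).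
  by apply: le_Rintegral_itv => // x _; exact: hpq_linear.
rewrite RintegralD//; try exact: continuous_integrable_itv.
rewrite RintegralZl//; last exact: continuous_integrable_itv.
apply: lerD.
  rewrite Rintegral_cst//= lebesgue_measure_itv/= lte_fin.
  by case: ltP => //= H; rewrite ?mulr0 // mulr_ge0// ?subr_ge0// ltW// (lt_le_trans ltr01).
rewrite ler_wpM2l ?powR_ge0// ler_pdivlMr ?exprn_gt0//.
rewrite -RintegralZr//; last exact: continuous_integrable_itv.
have cu : continuous (fun x => hpq p q `|F' x| * `|x| ^+ n).
  apply: cM => // x; apply: (@continuous_comp _ _ _ (fun y : R => `|y|) (fun x => x ^+ n)).
    exact: norm_continuous.
  exact: cX.
have u0 x : 0 <= hpq p q `|F' x| * `|x| ^+ n by rewrite mulr_ge0 ?hpq_ge0 ?exprn_ge0.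
apply: (@le_trans _ _ (\int[leb1]_(x in `[r1, r2]) (hpq p q `|F' x| * `|x| ^+ n))).
  apply: le_Rintegral_itv => //; first by apply: cM => //; exact: cst_continuous.
  move=> x /andP[r1x _]; rewrite ler_wpM2l ?hpq_ge0//.
  by apply: lerXn2r; rewrite ?nnegrE ?(ltW r10)//; exact: le_trans r1x (ler_norm _).
have -> : gmod = \int[leb1]_(x in `[0, b]) (hpq p q `|F' x| * `|x| ^+ n).
  by apply: eq_Rintegral => x; rewrite inE/= in_itv/= => /andP[x0 _]; rewrite (ger0_norm x0).
pose b' := Num.max b r2.
have bb' : 0 <= b <= b' by rewrite (ltW b0) le_max lexx.
apply: (@le_trans _ _ (\int[leb1]_(x in `[r1, b']) (hpq p q `|F' x| * `|x| ^+ n))).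
  apply: fine_le.
  - exact: integrable_fin_num (continuous_integrable_itv _ _ cu).
  - exact: integrable_fin_num (continuous_integrable_itv _ _ cu).
  apply: ge0_subset_integral => //=.
  - exact: measurable_int (continuous_integrable_itv _ _ cu).
  - by move=> x _; rewrite lee_fin.
  - move=> x /=; rewrite !in_itv/= => /andP[-> xr2] /=.
    by rewrite le_max xr2 orbT.
apply: (@le_trans _ _ (\int[leb1]_(x in `[0, b']) (hpq p q `|F' x| * `|x| ^+ n))).
  by apply: le_Rintegral_subitv => //; rewrite (ltW r10)/= le_max r12 orbT.
rewrite le_eqVlt; apply/orP; left; apply/eqP.
rewrite [LHS]Rintegral_mkcond [RHS]Rintegral_mkcond; apply: eq_Rintegral => x _.
rewrite !patchE; have [|] := boolP (x \in `[0, b']%classic).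
  rewrite inE/= in_itv/= => /andP[x0 _].
  have [//|] := boolP (x \in `[0, b]%classic); rewrite notin_setE/= in_itv/= x0/= => /negP.
  by rewrite -ltNge => /ltW /Fb[_ ->]; rewrite normr0 hpq0 ?mul0r.
rewrite notin_setE/= in_itv/= => H; rewrite ifF//; apply/negP; rewrite inE/= in_itv/=.
by move=> /andP[x0 xb]; apply: H; rewrite x0 /= le_max xb.
Qed.

End one_function.

Lemma Drad_finite_mom f e : Drad f -> 0 < e -> (\int[leb]_x (`|f x| `^ e)%:E < +oo)%E.
Proof.
move=> Df e0; have [b b0 Fb] := Drad_support N0 Df.
by rewrite (int_mom Df b0 Fb e0) ltry.
Qed.

Lemma Drad_finite_gmod f : Drad f ->
  (\int[leb]_x (hpq p q (enorm (grad f x)))%:E < +oo)%E.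
Proof.
move=> Df; have [b b0 Fb] := Drad_support N0 Df.
by rewrite (int_gmod Df b0 Fb) ltry.
Qed.

(** The choice e = X^(-1/q), X being the quantity to the power on the right, balances
the two terms of mom_young. *)
Let sobolev_core M : 0 <= M -> exists2 C, 0 <= C & forall f b, Drad f -> 0 < b ->
  (forall r, b <= r -> profile N0 f r = 0 /\ dprofile N0 f r = 0) ->
  k * gmod f b <= M ->
  mom f b P <= C * (mom f b P + mom f b a + 1) `^ ((1 - q^-1) * (1 + n%:R^-1)).
Proof.
move=> M0; have k0 := polar_const_gt0.
pose C0 := t * (2 + M / k).
have C00 : 0 <= C0 by rewrite mulr_ge0 ?(ltW t0)// addr_ge0// divr_ge0// ltW.
have nn : 0 < n%:R :> R by rewrite ltr0n.
exists (C0 `^ (1 + n%:R^-1) / n%:R) => [|f b Df b0 Fb RM].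
  by rewrite divr_ge0 ?powR_ge0// ltW.
apply: le_trans (mom_sobolev Df b0 Fb) _.
rewrite mulrAC ler_wpM2r ?invr_ge0 ?(ltW nn)//.
set I := \int[_]_(r in _) _; set X := mom f b P + _ + 1.
have mP0 := mom_ge0 f b P; have ma0 := mom_ge0 f b a.
have X1 : 1 <= X by rewrite /X lerDr addr_ge0.
have X0 : 0 < X by exact: lt_le_trans X1.
have I0 : 0 <= I by apply: Rintegral_ge0 => x _; rewrite mulr_ge0.
suff H : I <= C0 * X `^ (1 - q^-1).
  rewrite (powRrM X) -powRM ?powR_ge0//.
  apply: ge0_ler_powR; [by rewrite addr_ge0// invr_ge0 ltW|by rewrite nnegrE
    |by rewrite nnegrE mulr_ge0 ?powR_ge0|exact: H].
pose e := X `^ (- q^-1).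
have e01 : 0 < e <= 1.
  rewrite powR_gt0//= /e powRN invf_le1 ?powR_gt0//.
  by rewrite -(powRr0 X) ler_powR// invr_ge0 ltW.
apply: le_trans (mom_young Df b e01) _.
rewrite /C0 -mulrA ler_wpM2l ?(ltW t0)//.
have eX : e * X = X `^ (1 - q^-1).
  by rewrite /e -{2}(powRr1 (ltW X0)) -powRD ?(gt_eqF X0) ?implybT// addrC.
have eq : e `^ (1 - q) = X `^ (1 - q^-1).
  rewrite /e -powRrM; congr (_ `^ _); field; exact: lt0r_neq0.
rewrite eq [leRHS]mulrDl; apply: lerD.
  rewrite -eX mulrCA ler_wpM2l//; first by case/andP: e01 => /ltW.
  rewrite /X; lra.
rewrite mulrC ler_wpM2r ?powR_ge0// ler_pdivlMr//.
by rewrite mulrC.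
Qed.

(** The exponent (1 - 1/q)(1 + 1/(N-1)) of sobolev_core is less than 1 because q < N. *)
Lemma Drad_sobolev M e : 0 <= M -> 0 < e -> exists2 K, 0 <= K &
  forall f, Drad f -> (\int[leb]_x (hpq p q (enorm (grad f x)))%:E <= M%:E)%E ->
  (\int[leb]_x (`|f x| `^ P)%:E <= e%:E * \int[leb]_x (`|f x| `^ a)%:E + K%:E)%E.
Proof.
move=> M0 e0; have [C C0 HC] := sobolev_core M0.
pose th := (1 - q^-1) * (1 + n%:R^-1).
have nn : 0 < n%:R :> R by rewrite ltr0n.
have th01 : 0 < th < 1.
  have h1 : 0 < 1 - q^-1 by rewrite subr_gt0 invf_lt1.
  have h2 : 0 < 1 + n%:R^-1 :> R by rewrite addr_gt0// invr_gt0.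
  rewrite /th (mulr_gt0 h1 h2)/= nE.
  have -> : (1 - q^-1) * (1 + (N%:R - 1)^-1) = 1 - (N%:R - q) / (q * (N%:R - 1)).
    by field; rewrite !gt_eqF.
  by rewrite ltrBlDr ltrDl divr_gt0 ?subr_gt0// mulr_gt0.
have k0 := polar_const_gt0.
pose d := Num.min (e / 2) 2^-1.
have d0 : 0 < d by rewrite lt_min divr_gt0//= invr_gt0.
have de : 2 * d <= e by rewrite mulrC -ler_pdivlMr// ge_min lexx.
have d12 : d <= 2^-1 by rewrite ge_min lexx orbT.
have [K K0 HK] := sublinear_powR C0 th01 d0.
exists (k * (2 * d + 2 * K)) => [|f Df RM].
  by rewrite mulr_ge0 ?(ltW k0)// addr_ge0// mulr_ge0// ltW.
have [b b0 Fb] := Drad_support N0 Df.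
move: RM; rewrite (int_gmod Df b0 Fb) lee_fin => RM.
rewrite (int_mom Df b0 Fb crit_exp_gt0) (int_mom Df b0 Fb a0).
rewrite -EFinM -EFinD lee_fin mulrCA -mulrDr ler_wpM2l ?(ltW k0)//.
have H1 := HC f b Df b0 Fb RM.
have mP0 := mom_ge0 f b P; have ma0 := mom_ge0 f b a.
have X0 : 0 <= mom f b P + mom f b a + 1 by rewrite !addr_ge0.
have H2 := le_trans H1 (HK _ X0).
have H3 : 2 * d * mom f b a <= e * mom f b a by rewrite ler_wpM2r.
have H4 : d * mom f b P <= 2^-1 * mom f b P by rewrite ler_wpM2r.
have H5 : d * (mom f b P + mom f b a + 1) = d * mom f b P + d * mom f b a + d by ring.
rewrite H5 in H2; lra.
Qed.

(** sobolev1d_pointwise for |F|^t, whose right-hand side is bounded by mom_young with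
e = 1 and by Drad_sobolev. *)
Lemma Drad_decay M : 0 <= M -> exists2 K, 0 <= K & forall f, Drad f ->
  (\int[leb]_x (hpq p q (enorm (grad f x)))%:E <= M%:E)%E ->
  (\int[leb]_x (`|f x| `^ a)%:E <= M%:E)%E ->
  forall x, `|f x| `^ t * enorm x ^+ n <= K.
Proof.
move=> M0; have [K K0 HK] := Drad_sobolev M0 ltr01.
have k0 := polar_const_gt0.
have X0 : 0 <= 2 * (M + K) + M + M by rewrite !addr_ge0// mulr_ge0// addr_ge0.
exists (t * ((2 * (M + K) + M + M) / k)) => [|f Df RM BM x].
  by rewrite mulr_ge0 ?(ltW t0)// divr_ge0 ?(ltW k0).
have PM := HK f Df RM.
have [b b0 Fb] := Drad_support N0 Df.
rewrite (radial_profile N0 (f := f) x); last by case: Df.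
apply: le_trans (profile_decay Df Fb (enorm_ge0 x)) _.
have e1 : 0 < (1 : R) <= 1 by rewrite ltr01 lexx.
apply: le_trans (mom_young Df b e1) _.
rewrite ler_wpM2l ?(ltW t0)// powR1 !mul1r ler_pdivlMr//.
move: PM BM RM; rewrite (int_gmod Df b0 Fb) (int_mom Df b0 Fb crit_exp_gt0) (int_mom Df b0 Fb a0).
rewrite mul1e -EFinD !lee_fin => PM BM RM.
have -> : (2 * mom f b P + mom f b a + gmod f b) * k =
  2 * (k * mom f b P) + k * mom f b a + k * gmod f b by ring.
lra.
Qed.

Lemma Drad_equicontinuous M d e : 0 <= M -> 0 < d -> 0 < e -> exists2 eta, 0 < eta &
  forall f, Drad f -> (\int[leb]_x (hpq p q (enorm (grad f x)))%:E <= M%:E)%E ->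
  forall r1 r2, d <= r1 -> d <= r2 -> `|r1 - r2| <= eta ->
  `|profile N0 f r1 - profile N0 f r2| <= e.
Proof.
move=> M0 d0 e0; have k0 := polar_const_gt0.
have dn : 0 < d ^+ n by rewrite exprn_gt0.
pose L := M / k / d ^+ n.
have L0 : 0 <= L by rewrite /L !divr_ge0// ltW.
(* K is chosen so that K^(1-p) L <= e/2 *)
pose K := 1 + (2 * L / e) `^ (p - 1)^-1.
have p10 : 0 < p - 1 by rewrite subr_gt0.
have K1 : 1 <= K by rewrite lerDl powR_ge0.
have K0 : 0 < K by exact: lt_le_trans K1.
have HK : K `^ (1 - p) * L <= e / 2.
  have : 2 * L / e <= K `^ (p - 1).
    have -> : 2 * L / e = ((2 * L / e) `^ (p - 1)^-1) `^ (p - 1).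
      by rewrite -powRrM mulVf ?gt_eqF// powRr1// divr_ge0 ?(ltW e0)// mulr_ge0.
    by apply: ge0_ler_powR; rewrite ?nnegrE ?powR_ge0 ?(ltW K0) ?(ltW p10)// lerDr.
  rewrite (_ : 1 - p = - (p - 1)); last by ring.
  rewrite powRN ler_pdivrMr// => H.
  rewrite mulrC ler_pdivrMr ?powR_gt0// ; move: H; lra.
exists (e / 2 / K) => [|f Df RM]; first by rewrite !divr_gt0.
have [b b0 Fb] := Drad_support N0 Df.
have {}RM : gmod f b <= M / k.
  by move: RM; rewrite (int_gmod Df b0 Fb) lee_fin ler_pdivlMr// mulrC.
move=> r1 r2 dr1 dr2 rr; wlog r12 : r1 r2 dr1 dr2 rr / r1 <= r2.
  move=> H; have [/H|/ltW/H h] := leP r1 r2; first exact.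
  by rewrite distrC h// distrC.
move: rr; rewrite distrC ger0_norm ?subr_ge0// => rr.
have r10 : 0 < r1 by exact: lt_le_trans dr1.
rewrite distrC; apply: le_trans (profile_increment Df b0 Fb K1 r10 r12) _.
rewrite (splitr e); apply: lerD; first by rewrite mulrC -ler_pdivlMr.
apply: le_trans HK; rewrite ler_wpM2l ?powR_ge0// /L.
apply: ler_pM => //; rewrite ?gmod_ge0 ?invr_ge0 ?exprn_ge0 ?(ltW r10)//.
rewrite lef_pV2 ?posrE ?exprn_gt0// lerXn2r ?nnegrE ?(ltW r10) ?(ltW d0)//.
Qed.

End Drad_estimates.

(** * Norms and modulars *)

Lemma cvge0P {R : realType} (x : nat -> \bar R) : (forall n, (0 <= x n)%E) ->
  (x n @[n --> \oo] --> 0%E) <->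
  (forall e : R, 0 < e -> \forall n \near \oo, (x n <= e%:E)%E).
Proof.
move=> x0; split=> [/fine_cvgP[xfin /cvgr0Pnorm_le xc] e e0|H].
  have h := xc e e0; near=> n.
  have xf : x n \is a fin_num by near: n.
  rewrite -(fineK xf) lee_fin; apply: le_trans (ler_norm _) _.
  by near: n.
have xf : \forall n \near \oo, x n \is a fin_num.
  apply: filterS (H 1 ltr01) => n xn.
  by rewrite ge0_fin_numE//; apply: le_lt_trans xn _; rewrite ltry.
apply/fine_cvgP; split => //; apply/cvgr0Pnorm_le => e e0.
have h := H e e0; near=> n.
have xfn : x n \is a fin_num by near: n.
rewrite /= ger0_norm ?fine_ge0// -lee_fin fineK//.
by near: n.
Unshelve. all: by end_near. Qed.

Lemma measurable_normpow {R : realType} d (T : measurableType d) (f : T -> R) e :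
  measurable_fun setT f -> measurable_fun setT (fun x => `|f x| `^ e).
Proof.
move=> mf; apply: (@measurableT_comp _ _ _ _ _ _ (fun y : R => y `^ e)).
  exact: measurable_powR.
exact: measurableT_comp.
Qed.

Lemma le_int {R : realType} d (T : measurableType d) (mu : {measure set T -> \bar R})
  (f g : T -> R) : measurable_fun setT f -> measurable_fun setT g ->
  (forall x, 0 <= f x) -> (forall x, f x <= g x) ->
  (\int[mu]_x (f x)%:E <= \int[mu]_x (g x)%:E)%E.
Proof.
move=> mf mg f0 fg.
have mf' : measurable_fun setT (EFin \o f) by exact/measurable_EFinP.
have mg' : measurable_fun setT (EFin \o g) by exact/measurable_EFinP.
by apply: (ge0_le_integral mu measurableT _ mf' mg') => x _; rewrite lee_fin.
Qed.

Lemma le_int_ae {R : realType} d (T : measurableType d) (mu : {measure set T -> \bar R})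
  (f g : T -> R) : measurable_fun setT f -> measurable_fun setT g ->
  (forall x, 0 <= f x) -> (forall x, 0 <= g x) -> {ae mu, forall x, f x <= g x} ->
  (\int[mu]_x (f x)%:E <= \int[mu]_x (g x)%:E)%E.
Proof.
move=> mf mg f0 g0 fg.
have mf' : measurable_fun setT (EFin \o f) by exact/measurable_EFinP.
have mg' : measurable_fun setT (EFin \o g) by exact/measurable_EFinP.
have f0' : forall x, setT x -> (0 <= (EFin \o f) x)%E by move=> x _; rewrite lee_fin.
have g0' : forall x, setT x -> (0 <= (EFin \o g) x)%E by move=> x _; rewrite lee_fin.
apply: (ae_ge0_le_integral measurableT f0' mf' g0' mg').
by apply: filterS fg => x fgx _; rewrite lee_fin.
Qed.
Lemma intD {R : realType} d (T : measurableType d) (mu : {measure set T -> \bar R})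
  (f g : T -> R) : measurable_fun setT f -> measurable_fun setT g ->
  (forall x, 0 <= f x) -> (forall x, 0 <= g x) ->
  (\int[mu]_x (f x + g x)%:E = \int[mu]_x (f x)%:E + \int[mu]_x (g x)%:E)%E.
Proof.
move=> mf mg f0 g0.
have mf' : measurable_fun setT (EFin \o f) by exact/measurable_EFinP.
have mg' : measurable_fun setT (EFin \o g) by exact/measurable_EFinP.
have f0' : forall x, setT x -> (0 <= (EFin \o f) x)%E by move=> x _; rewrite lee_fin.
have g0' : forall x, setT x -> (0 <= (EFin \o g) x)%E by move=> x _; rewrite lee_fin.
by rewrite -(ge0_integralD mu measurableT f0' mf' g0' mg').
Qed.

Lemma intZ {R : realType} d (T : measurableType d) (mu : {measure set T -> \bar R})
  (c : R) (f : T -> R) : measurable_fun setT f -> 0 <= c -> (forall x, 0 <= f x) ->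
  (\int[mu]_x (c * f x)%:E = c%:E * \int[mu]_x (f x)%:E)%E.
Proof.
move=> mf c0 f0.
have mf' : measurable_fun setT (EFin \o f) by exact/measurable_EFinP.
have f0' : forall x, setT x -> (0 <= (EFin \o f) x)%E by move=> x _; rewrite lee_fin.
rewrite -(ge0_integralZl mu measurableT mf' f0')//.
Qed.

Section modulars.
Context {R : realType} (N : nat) (p q : R).
Hypotheses (p1 : 1 < p) (pq : p < q).
Local Notation leb := (@lebesgueN R N).
Implicit Types (f u v : 'rV[R]_N -> R) (U V : 'rV[R]_N -> 'rV[R]_N).
Let p0 : 0 < p. Proof. exact: lt_trans ltr01 p1. Qed.
Let q0 : 0 < q. Proof. exact: lt_trans p0 pq. Qed.

Lemma measurable_rVD U V : measurable_fun setT U -> measurable_fun setT V ->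
  measurable_fun setT (fun x => U x + V x).
Proof.
move=> mU mV; apply: measurable_fun_rV => i.
have -> : (fun x => (U x + V x) ord0 i) = (fun x => U x ord0 i + V x ord0 i).
  by apply/funext => x; rewrite mxE.
by apply: measurable_funD;
  apply: (@measurableT_comp _ _ _ _ _ _ (fun x : 'rV[R]_N => x ord0 i)) => //;
  exact: measurable_rV_coord.
Qed.

Lemma measurable_rVZ (c : R) U : measurable_fun setT U ->
  measurable_fun setT (fun x => c *: U x).
Proof.
move=> mU; apply: measurable_fun_rV => i.
have -> : (fun x => (c *: U x) ord0 i) = (fun x => c * U x ord0 i).
  by apply/funext => x; rewrite mxE.
apply: measurable_funM => //.
apply: (@measurableT_comp _ _ _ _ _ _ (fun x : 'rV[R]_N => x ord0 i)) => //.
exact: measurable_rV_coord.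
Qed.

Lemma measurable_rVB U V : measurable_fun setT U -> measurable_fun setT V ->
  measurable_fun setT (fun x => U x - V x).
Proof.
move=> mU mV; have -> : (fun x => U x - V x) = (fun x => U x + (-1) *: V x).
  by apply/funext => x; rewrite scaleN1r.
by apply: measurable_rVD => //; exact: measurable_rVZ.
Qed.

Lemma measurable_enorm_comp U : measurable_fun setT U ->
  measurable_fun setT (fun x => enorm (U x)).
Proof. by move=> mU; apply: measurableT_comp => //; exact: measurable_enorm. Qed.

Lemma measurable_hpq_comp U : measurable_fun setT U ->
  measurable_fun setT (fun x => hpq p q (enorm (U x))).
Proof.
move=> mU; apply: measurableT_comp; first exact: measurable_hpq.
exact: measurable_enorm_comp.
Qed.

Definition rho U : \bar R := (\int[leb]_x (hpq p q (enorm (U x)))%:E)%E.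

Lemma rho_ge0 U : (0 <= rho U)%E.
Proof. by apply: integral_ge0 => x _; rewrite lee_fin hpq_ge0. Qed.

Definition powint (e : R) u : \bar R := (\int[leb]_x (`|u x| `^ e)%:E)%E.

Lemma powint_ge0 e u : (0 <= powint e u)%E.
Proof. by apply: integral_ge0 => x _; rewrite lee_fin powR_ge0. Qed.

Lemma norm_LE e u : 0 < e -> norm_L e u = (powint e u `^ e^-1)%E.
Proof.
move=> e0; rewrite /norm_L Lnorm.unlock; congr (_ `^ _)%E.
Qed.

Lemma norm_L_le e u c : 0 < e -> 0 <= c ->
  (norm_L e u <= c%:E)%E = (powint e u <= (c `^ e)%:E)%E.
Proof.
move=> e0 c0; rewrite norm_LE//; have := powint_ge0 e u.
have ei0 : 0 < e^-1 by rewrite invr_gt0.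
case: (powint e u) => [b| |] // b0.
  rewrite poweR_EFin !lee_fin; rewrite lee_fin in b0.
  apply/idP/idP => H.
    have -> : b = (b `^ e^-1) `^ e by rewrite -powRrM mulVf ?gt_eqF// powRr1.
    by apply: ge0_ler_powR; rewrite ?nnegrE ?powR_ge0// ltW.
  have -> : c = (c `^ e) `^ e^-1 by rewrite -powRrM mulfV ?gt_eqF// powRr1.
  by apply: ge0_ler_powR; rewrite ?nnegrE ?powR_ge0// ltW.
by rewrite poweRyr ?gt_eqF// !leye_eq.
Qed.

Lemma norm_L_root e u b : 0 < e -> 0 <= b -> (powint e u <= b%:E)%E ->
  (norm_L e u <= (b `^ e^-1)%:E)%E.
Proof.
move=> e0 b0 H; rewrite norm_L_le ?powR_ge0// -powRrM mulVf ?gt_eqF// powRr1//.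
Qed.

Lemma norm_L_ge0 e u : (0 <= norm_L e u)%E.
Proof. exact: Lnorm_ge0. Qed.

Lemma norm_L_cvg0P e (F : nat -> 'rV[R]_N -> R) : 0 < e ->
  (norm_L e (F n) @[n --> \oo] --> 0%E) <-> int_small leb (fun n x => `|F n x| `^ e).
Proof.
move=> e0; split=> [/cvge0P|] H.
  move=> c c0; have c10 : 0 < c `^ e^-1 by rewrite powR_gt0.
  have := H (fun n => norm_L_ge0 e _) _ c10; apply: filterS => n.
  by rewrite norm_L_le ?powR_ge0// -powRrM mulVf ?gt_eqF// powRr1// ltW.
apply/cvge0P => [n|c c0]; first exact: norm_L_ge0.
have ce0 : 0 < c `^ e by rewrite powR_gt0.
by apply: filterS (H _ ce0) => n; rewrite norm_L_le ?(ltW c0).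
Qed.

Lemma norm_pq_ge0 U : (0 <= norm_pq p q U)%E.
Proof.
by apply: le_ereal_inf_tmp => _ [v [w [_ _ _ ->]]]; rewrite adde_ge0// norm_L_ge0.
Qed.

(** Split U at |U| = 1: h is the power p above and the power q below. *)
Lemma norm_pq_le U r : measurable_fun setT U -> 0 <= r -> (rho U <= r%:E)%E ->
  (norm_pq p q U <= (r `^ p^-1 + r `^ q^-1)%:E)%E.
Proof.
move=> mU r0 Ur.
pose big x := 1 <= enorm (U x).
have mbig : measurable_fun setT big.
  by apply: measurable_fun_ler => //; exact: measurable_enorm_comp.
pose v x : 'rV[R]_N := if big x then U x else 0.
pose w x : 'rV[R]_N := if big x then 0 else U x.
have mv : measurable_fun setT v by apply: measurable_fun_ifT.
have mw : measurable_fun setT w by apply: measurable_fun_ifT.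
have mh := measurable_hpq_comp mU.
have vr : (powint p (enorm \o v) <= r%:E)%E.
  apply: le_trans Ur; apply: le_int => //.
  - by apply: measurable_normpow; exact: measurable_enorm_comp.
  - move=> x /=; rewrite /v ger0_norm ?enorm_ge0//; case: ifPn => [h1|_].
      by rewrite (@hpq_ge1 _ p q).
    by rewrite enorm0 powR0 ?gt_eqF// hpq_ge0.
have wr : (powint q (enorm \o w) <= r%:E)%E.
  apply: le_trans Ur; apply: le_int => //.
  - by apply: measurable_normpow; exact: measurable_enorm_comp.
  - move=> x /=; rewrite /w ger0_norm ?enorm_ge0//; case: ifPn => [_|].
      by rewrite enorm0 powR0 ?gt_eqF// hpq_ge0.
    by rewrite /big -ltNge => /ltW h1; rewrite (@hpq_le1 _ p q)// enorm_ge0.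
have vn := norm_L_root p0 r0 vr; have wn := norm_L_root q0 r0 wr.
apply: (@le_trans _ _ (norm_L p (enorm \o v) + norm_L q (enorm \o w))%E).
  apply: ereal_inf_lbound; exists v, w; split => //.
  - by split => //; apply: le_lt_trans vn (ltry _).
  - by split => //; apply: le_lt_trans wn (ltry _).
  - by apply: aeW => x; rewrite /v /w; case: ifP => _; rewrite ?addr0 ?add0r.
by rewrite EFinD leeD.
Qed.

(** For any decomposition U = v + w, h(|v| + |w|) <= 2^q (|v|^p + |w|^q). *)
Lemma rho_norm_pq U eta : measurable_fun setT U -> 0 < eta ->
  (norm_pq p q U < eta%:E)%E -> (rho U <= (2 `^ q * (eta `^ p + eta `^ q))%:E)%E.
Proof.
move=> mU eta0 /ereal_inf_lt[_ [v [w [[mv vf] [mw wf] Uvw ->]]] vw].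
have vn : (norm_L p (enorm \o v) <= eta%:E)%E.
  by apply: le_trans (ltW vw); rewrite leeDl// norm_L_ge0.
have wn : (norm_L q (enorm \o w) <= eta%:E)%E.
  by apply: le_trans (ltW vw); rewrite leeDr// norm_L_ge0.
rewrite norm_L_le ?(ltW eta0)// in vn; rewrite norm_L_le ?(ltW eta0)// in wn.
have mvp : measurable_fun setT (fun x => `|enorm (v x)| `^ p).
  by apply: measurable_normpow; exact: measurable_enorm_comp.
have mwq : measurable_fun setT (fun x => `|enorm (w x)| `^ q).
  by apply: measurable_normpow; exact: measurable_enorm_comp.
apply: (@le_trans _ _ (\int[leb]_x (2 `^ q * (`|enorm (v x)| `^ p + `|enorm (w x)| `^ q))%:E)%E).
  apply: le_int_ae.
  - exact: measurable_hpq_comp.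
  - by apply: measurable_funM => //; exact: measurable_funD.
  - by move=> x; exact: hpq_ge0.
  - by move=> x; rewrite mulr_ge0 ?addr_ge0 ?powR_ge0.
  apply: filterS Uvw => x ->; rewrite !ger0_norm ?enorm_ge0//.
  apply: le_trans (@hpq_homo _ p q p1 pq _ _ (enorm_ge0 _) (ler_enormD _ _)) _.
  apply: le_trans (@hpq_add _ p q p1 pq _ _ (enorm_ge0 _) (enorm_ge0 _)) _.
  by rewrite ler_wpM2l ?powR_ge0// lerD ?hpq_le_p ?hpq_le_q.
have mD := measurable_funD mvp mwq.
have D0 x : 0 <= `|enorm (v x)| `^ p + `|enorm (w x)| `^ q by rewrite addr_ge0 ?powR_ge0.
rewrite (intZ leb mD (powR_ge0 2 q) D0).
rewrite intD//; try by move=> x; exact: powR_ge0.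
by rewrite EFinM EFinD lee_wpmul2l ?lee_fin ?powR_ge0// leeD.
Qed.

Lemma norm_pq_cvg0P (F : nat -> 'rV[R]_N -> 'rV[R]_N) :
  (forall n, measurable_fun setT (F n)) ->
  (norm_pq p q (F n) @[n --> \oo] --> 0%E) <->
  int_small leb (fun n x => hpq p q (enorm (F n x))).
Proof.
move=> mF; split=> [/cvge0P|] H.
  move=> c c0.
  (* e is chosen so that 2^q (e^p + e^q) <= c *)
  pose e := Num.min 1 (c / 2 `^ q / 2).
  have q20 : 0 < 2 `^ q :> R by rewrite powR_gt0.
  have e0 : 0 < e by rewrite lt_min ltr01 !divr_gt0.
  have e1 : e <= 1 by rewrite ge_min lexx.
  have He : 2 `^ q * (e `^ p + e `^ q) <= c.
    rewrite mulrC -ler_pdivlMr// (splitr (c / _)).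
    have ec : e <= c / 2 `^ q / 2 by rewrite ge_min lexx orbT.
    by apply: lerD; apply: le_trans ec; apply: ge1r_powR; rewrite ?e0 ?e1// ltW// (lt_trans p1).
  have e20 : 0 < e / 2 by rewrite divr_gt0.
  have := H (fun n => norm_pq_ge0 _) _ e20; apply: filterS => n Hn.
  apply: (@le_trans _ _ (2 `^ q * (e `^ p + e `^ q))%:E); last by rewrite lee_fin.
  apply: rho_norm_pq => //; apply: le_lt_trans Hn _; rewrite lte_fin.
  by rewrite ltr_pdivrMr// ltr_pMr// ltr1n.
apply/cvge0P => [n|c c0]; first exact: norm_pq_ge0.
pose e := Num.min 1 ((c / 2) `^ q).
have c20 : 0 < c / 2 by rewrite divr_gt0.
have e0 : 0 < e by rewrite lt_min ltr01 powR_gt0.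
have e1 : e <= 1 by rewrite ge_min lexx.
have eq : e `^ q^-1 <= c / 2.
  have -> : c / 2 = ((c / 2) `^ q) `^ q^-1.
    by rewrite -powRrM mulfV ?gt_eqF// powRr1// ltW.
  apply: ge0_ler_powR; rewrite ?nnegrE ?powR_ge0 ?invr_ge0 ?(ltW e0) ?(ltW q0)//.
  by rewrite ge_min lexx orbT.
have ep : e `^ p^-1 <= c / 2.
  apply: le_trans eq; apply: ger_powR; rewrite ?e0//.
  by rewrite lef_pV2 ?posrE// ltW.
apply: filterS (H _ e0) => n Hn.
apply: le_trans (norm_pq_le (mF n) (ltW e0) Hn) _.
by rewrite lee_fin (splitr c) lerD.
Qed.

Lemma rhoD U V : measurable_fun setT U -> measurable_fun setT V ->
  (rho (fun x => U x + V x)%R <= (2 `^ q)%:E * (rho U + rho V))%E.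
Proof.
move=> mU mV; have hU := measurable_hpq_comp mU; have hV := measurable_hpq_comp mV.
rewrite /rho -intD//; try by move=> x; exact: hpq_ge0.
have mD := measurable_funD hU hV.
have D0 x : 0 <= hpq p q (enorm (U x)) + hpq p q (enorm (V x)) by rewrite addr_ge0 ?hpq_ge0.
rewrite -(intZ leb mD (powR_ge0 2 q) D0).
apply: le_int.
- by apply: measurable_hpq_comp; exact: measurable_rVD.
- by apply: measurable_funM => //; exact: measurable_funD.
- by move=> x; exact: hpq_ge0.
move=> x; apply: le_trans (@hpq_homo _ p q p1 pq _ _ (enorm_ge0 _) (ler_enormD _ _)) _.
exact: (@hpq_add _ p q p1 pq _ _ (enorm_ge0 _) (enorm_ge0 _)).
Qed.

Lemma powintD e u v : 0 < e -> measurable_fun setT u -> measurable_fun setT v ->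
  (powint e (fun x => u x + v x)%R <= (2 `^ e)%:E * (powint e u + powint e v))%E.
Proof.
move=> e0 mu mv.
have hU := measurable_normpow e mu; have hV := measurable_normpow e mv.
rewrite /powint -intD//; try by move=> x; exact: powR_ge0.
have mD := measurable_funD hU hV.
have D0 x : 0 <= `|u x| `^ e + `|v x| `^ e by rewrite addr_ge0 ?powR_ge0.
rewrite -(intZ leb mD (powR_ge0 2 e) D0).
apply: le_int.
- by apply: measurable_normpow; exact: measurable_funD.
- by apply: measurable_funM => //; exact: measurable_funD.
- by move=> x; exact: powR_ge0.
move=> x; apply: le_trans (powR_addl_le e0 (normr_ge0 _) (normr_ge0 _)).
by apply: ge0_ler_powR; rewrite ?nnegrE ?addr_ge0 ?ler_normD// ltW.
Qed.

Lemma powintN e u : powint e (fun x => - u x) = powint e u.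
Proof. by apply: eq_integral => x _; rewrite normrN. Qed.

Lemma rhoN U : rho (fun x => - U x) = rho U.
Proof. by apply: eq_integral => x _; rewrite enormN. Qed.

End modulars.

(** * Completeness with respect to modulars *)

Section ae_limits.
Context d (T : measurableType d) {R : realType} (mu : {measure set T -> \bar R}).

(** The upper limit is measurable even where the sequence does not converge. *)
Definition ae_lim (X : nat -> T -> R) (x : T) : R :=
  fine (limn_esup (fun n => (X n x)%:E)).

Lemma measurable_ae_lim X : (forall n, measurable_fun setT (X n)) ->
  measurable_fun setT (ae_lim X).
Proof.
move=> mX; apply: measurableT_comp => //.
by apply: measurable_fun_limn_esup => n; exact/measurable_EFinP.
Qed.

Lemma cvg_ae_lim X x : cvg (X n x @[n --> \oo]) -> X n x @[n --> \oo] --> ae_lim X x.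
Proof.
move=> /cvg_ex[l Xl]; suff -> : ae_lim X x = l by [].
have /cvg_limn_einf_sup[_ E] : (X n x)%:E @[n --> \oo] --> l%:E.
  by apply/cvg_EFin; [exact: nearW|exact: Xl].
by rewrite /ae_lim E.
Qed.

(** By Markov inequality a Cauchy sequence for the modular is Cauchy in measure. *)
Lemma modular_cauchy_subseq (V : completeNormedModType R) (kap : V -> R)
  (X : nat -> T -> V) : (forall v, 0 <= kap v) ->
  (forall n m, measurable_fun setT (fun x => kap (X n x - X m x))) ->
  (forall e, 0 < e -> exists2 c, 0 < c & forall v, e <= `|v| -> c <= kap v) ->
  (forall e : R, 0 < e -> exists n0, forall n m, (n0 <= n)%N -> (n0 <= m)%N ->
     (\int[mu]_x (kap (X n x - X m x))%:E <= e%:E)%E) ->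
  exists s, extraction s /\
    {ae mu, forall x, cvg (X (s n) x @[n --> \oo])}.
Proof.
move=> k0 mk kc H; apply: (cauchy_in_measure_subseq (mu := mu)) => e e0.
have [c c0 Hc] := kc e e0.
have [n0 Hn0] := H _ (mulr_gt0 c0 e0).
exists n0 => k nk; exists [set x | c <= kap (X k x - X n0 x)].
split.
- rewrite [X in measurable X](_ : _ = (fun x => kap (X k x - X n0 x)) @^-1` `[c, +oo[).
    by rewrite -[X in measurable X]setTI; exact: mk.
  by apply/seteqP; split => x /=; rewrite in_itv/= andbT.
- have := le_trans (markov_measure mu (mk k n0) (fun x => k0 _) c0) (Hn0 k n0 nk (leqnn _)).
  by rewrite EFinM lee_pmul2l// lte_fin.
- by move=> x /=; apply: contra_notT; rewrite -leNgt; exact: Hc.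
Qed.

End ae_limits.

HB.instance Definition _ (R : realType) (m n : nat) :=
  Uniform_isComplete.Build 'M[R]_(m, n) (@mx_complete R m n).

Section completeness.
Context {R : realType} (N : nat) (p q : R).
Hypotheses (p1 : 1 < p) (pq : p < q).
Local Notation leb := (@lebesgueN R N).
Let p0 : 0 < p. Proof. exact: lt_trans ltr01 p1. Qed.
Let q0 : 0 < q. Proof. exact: lt_trans p0 pq. Qed.

Lemma mx_norm_le_enorm (x : 'rV[R]_N) : `|x| <= enorm x.
Proof.
rewrite -[`|x|]/(mx_norm x).
have [->|/mx_norm_neq0[[i j] ->]] := eqVneq (mx_norm x) 0; first exact: enorm_ge0.
by rewrite (ord1 i) coord_le_enorm.
Qed.

Lemma cvg_enorm (X : nat -> 'rV[R]_N) (x : 'rV[R]_N) :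
  (forall i, X n ord0 i @[n --> \oo] --> x ord0 i) ->
  enorm (X n - x) @[n --> \oo] --> 0.
Proof.
move=> Xx.
have h : \sum_i `|(X n - x) ord0 i| @[n --> \oo] --> \sum_(i < N) (0 : R).
  elim: (index_enum _) => [|i r IH].
    by rewrite big_nil; under eq_fun do rewrite big_nil; exact: cvg_cst.
  rewrite big_cons; under eq_fun do rewrite big_cons.
  apply: cvgD; last exact: IH.
  rewrite (_ : (fun n => `|(X n - x) ord0 i|) = (fun n => `|X n ord0 i - x ord0 i|)); last first.
    by apply/funext => n; rewrite !mxE.
  have h0 : X n ord0 i - x ord0 i @[n --> \oo] --> (0 : R).
    by rewrite -(subrr (x ord0 i)); apply: cvgB; [exact: Xx|exact: cvg_cst].
  have h1 := cvg_norm h0; rewrite normr0 in h1; exact: h1.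
rewrite big1// in h.
apply: (@squeeze_cvgr _ _ _ _ (cst 0) (fun n => \sum_i `|(X n - x) ord0 i|)) => //.
  by apply: nearW => n; rewrite enorm_ge0 enorm_le_sum.
exact: cvg_cst.
Qed.

Lemma cvg_hpq0 (x : nat -> R) : (forall n, 0 <= x n) -> x n @[n --> \oo] --> 0 ->
  hpq p q (x n) @[n --> \oo] --> 0.
Proof.
move=> x0 xc; have cp : continuous (fun t : R => hpq p q `|t|).
  exact: continuous_hpq_norm.
have : hpq p q `|x n| @[n --> \oo] --> hpq p q `|0 : R|.
  exact: (cvg_comp _ _ xc (cp 0)).
by rewrite normr0 hpq0//; under eq_fun do rewrite ger0_norm//.
Qed.

Lemma cvg_normpow0 (e : R) (x : nat -> R) : 0 < e -> x n @[n --> \oo] --> 0 ->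
  `|x n| `^ e @[n --> \oo] --> 0.
Proof.
move=> e0 xc; have cp : continuous (fun t : R => `|t| `^ e) by exact: continuous_normpow.
have : `|x n| `^ e @[n --> \oo] --> `|0 : R| `^ e.
  exact: (cvg_comp _ _ xc (cp 0)).
by rewrite normr0 powR0// gt_eqF.
Qed.

(** Riesz-Fischer theorem: Fatou lemma along the almost everywhere convergent
subsequence. *)
Lemma powint_complete (e : R) (F : nat -> 'rV[R]_N -> R) : 0 < e ->
  (forall n, measurable_fun setT (F n)) ->
  (forall c : R, 0 < c -> exists n0, forall n m, (n0 <= n)%N -> (n0 <= m)%N ->
     (powint e (fun x => F n x - F m x)%R <= c%:E)%E) ->
  exists u : 'rV[R]_N -> R,
    measurable_fun setT u /\ int_small leb (fun n x => `|F n x - u x| `^ e).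
Proof.
move=> e0 mF H.
have mFB n m : measurable_fun setT (fun x => `|F n x - F m x| `^ e).
  by apply: measurable_normpow; exact: measurable_funB.
have k0 (v : R) : 0 <= `|v| `^ e by exact: powR_ge0.
have kc c : 0 < c -> exists2 c', 0 < c' & forall v : R, c <= `|v| -> c' <= `|v| `^ e.
  move=> c0; exists (c `^ e); first exact: powR_gt0.
  by move=> v cv; apply: ge0_ler_powR; rewrite ?nnegrE ?(ltW c0) ?(ltW e0).
have [s [si cs]] := modular_cauchy_subseq k0 mFB kc H.
pose u := ae_lim (fun n => F (s n)).
have mu : measurable_fun setT u by exact: measurable_ae_lim.
exists u; split => // c c0; have [n0 Hn0] := H c c0.
exists n0 => // n /= nn0.
apply: (@fatou_le _ _ _ leb (fun m x => `|F n x - F (s m) x| `^ e)) => //.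
- by apply: measurable_normpow; exact: measurable_funB.
- apply: filterS cs => x /(cvg_ae_lim (X := fun n => F (s n))) Fx.
  have cp : continuous (fun t : R => `|t| `^ e) by exact: continuous_normpow.
  have Fx' : F n x - F (s m) x @[m --> \oo] --> F n x - u x.
    by apply: cvgB; [exact: cvg_cst|exact: Fx].
  exact: (cvg_comp _ _ Fx' (cp _)).
- exists n0 => // m /= mn0; apply: Hn0 => //; apply: leq_trans mn0 _.
  exact: extraction_ge.
Qed.

(** As for powint_complete, the limit being taken coordinatewise. *)
Lemma rho_complete (F : nat -> 'rV[R]_N -> 'rV[R]_N) :
  (forall n, measurable_fun setT (F n)) ->
  (forall c : R, 0 < c -> exists n0, forall n m, (n0 <= n)%N -> (n0 <= m)%N ->
     (rho p q (fun x => F n x - F m x)%R <= c%:E)%E) ->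
  exists U : 'rV[R]_N -> 'rV[R]_N,
    measurable_fun setT U /\ int_small leb (fun n x => hpq p q (enorm (F n x - U x))).
Proof.
move=> mF H.
have mFB n m : measurable_fun setT (fun x => hpq p q (enorm (F n x - F m x))).
  by apply: measurable_hpq_comp; exact: measurable_rVB.
have k0 (v : 'rV[R]_N) : 0 <= hpq p q (enorm v) by exact: hpq_ge0.
have kc c : 0 < c -> exists2 c', 0 < c' &
    forall v : 'rV[R]_N, c <= `|v| -> c' <= hpq p q (enorm v).
  move=> c0; exists (hpq p q c); first exact: hpq_gt0.
  move=> v cv; apply: (@hpq_homo _ p q) => //; first exact: ltW.
  exact: le_trans cv (mx_norm_le_enorm _).
have [s [si cs]] := modular_cauchy_subseq k0 mFB kc H.
pose U x : 'rV[R]_N := \row_i ae_lim (fun n x => F (s n) x ord0 i) x.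
have mc n i : measurable_fun setT (fun x => F n x ord0 i).
  apply: (@measurableT_comp _ _ _ _ _ _ (fun x : 'rV[R]_N => x ord0 i)) => //.
  exact: measurable_rV_coord.
have mU : measurable_fun setT U.
  apply: measurable_fun_rV => i; rewrite /U; under eq_fun do rewrite mxE.
  exact: measurable_ae_lim.
exists U; split => // c c0; have [n0 Hn0] := H c c0.
exists n0 => // n /= nn0.
apply: (@fatou_le _ _ _ leb (fun m x => hpq p q (enorm (F n x - F (s m) x)))) => //.
- by apply: measurable_hpq_comp; exact: measurable_rVB.
- apply: filterS cs => x Fx.
  have Fi i : F (s n) x ord0 i @[n --> \oo] --> U x ord0 i.
    rewrite mxE; apply: (cvg_ae_lim (X := fun n x => F (s n) x ord0 i)).
    case/cvg_ex : Fx => l Fl; apply/cvg_ex; exists (l ord0 i).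
    exact: (cvg_comp _ _ Fl (@coord_continuous R 1 N ord0 i l)).
  have h1 : enorm (F n x - F (s m) x) @[m --> \oo] --> enorm (F n x - U x).
    have h0 := cvg_enorm Fi.
    apply/cvgrPdist_le => e e0; move/cvgr0Pnorm_le : h0 => /(_ e e0).
    apply: filterS => m; rewrite ger0_norm ?enorm_ge0// => Hm.
    apply: le_trans Hm; rewrite ler_norml; apply/andP; split.
      rewrite lerNl opprB lerBlDr.
      have -> : F n x - F (s m) x = - (F (s m) x - U x) + (F n x - U x).
        by rewrite opprB [RHS]addrC addrA subrK.
      by apply: le_trans (ler_enormD _ _) _; rewrite enormN.
    rewrite lerBlDr.
    have -> : F n x - U x = (F (s m) x - U x) + (F n x - F (s m) x).
      by rewrite [RHS]addrC addrA subrK.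
    exact: ler_enormD.
  have cp : continuous (fun t : R => hpq p q `|t|) by exact: continuous_hpq_norm.
  have := cvg_comp _ _ h1 (cp _); rewrite /comp/= (ger0_norm (enorm_ge0 _)).
  by under eq_fun do rewrite (ger0_norm (enorm_ge0 _)).
- exists n0 => // m /= mn0; apply: Hn0 => //; apply: leq_trans mn0 _.
  exact: extraction_ge.
Qed.

End completeness.

(** * Points of the completion as pairs of functions *)

Section representatives.
Context {R : realType} (N : nat) (p q a : R).
Hypotheses (N2 : (2 <= N)%N) (p1 : 1 < p) (pq : p < q) (qN : q < N%:R) (a1 : 1 < a).
Local Notation leb := (@lebesgueN R N).
Local Notation E0 := ('rV[R]_N -> R).
Let N0 : (0 < N)%N. Proof. exact: leq_trans N2. Qed.
Let p0 : 0 < p. Proof. exact: lt_trans ltr01 p1. Qed.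
Let q0 : 0 < q. Proof. exact: lt_trans p0 pq. Qed.
Let a0 : 0 < a. Proof. exact: lt_trans ltr01 a1. Qed.

Let mD (f : E0) : Drad f -> measurable_fun setT f.
Proof. by case=> sf _ rf; exact: measurable_radial. Qed.
Let mG (f : E0) : Drad f -> measurable_fun setT (grad f).
Proof. by case=> sf _ rf; exact: measurable_grad. Qed.

(** The part of represents that does not refer to the abstract completion, expressed
with modulars. *)
Definition approximable (uU : E0 * ('rV[R]_N -> 'rV[R]_N)) (f : nat -> E0) :=
  [/\ forall n, Drad (f n), int_small leb (fun n x => `|f n x - uU.1 x| `^ a) &
    int_small leb (fun n x => hpq p q (enorm (grad (f n) x - uU.2 x)))].

Lemma norm_W_le (f : E0) b r : Drad f -> 0 <= b -> 0 <= r ->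
  (powint a f <= b%:E)%E -> (rho p q (grad f) <= r%:E)%E ->
  norm_W a p q f <= b `^ a^-1 + r `^ p^-1 + r `^ q^-1.
Proof.
move=> Df b0 r0 fb fr; have h1 := norm_L_root a0 b0 fb.
have h2 := norm_pq_le p1 pq (mG Df) r0 fr.
rewrite /norm_W /norm_Y -addrA; apply: lerD.
  rewrite -lee_fin fineK// ge0_fin_numE ?norm_L_ge0//.
  exact: le_lt_trans h1 (ltry _).
rewrite -lee_fin fineK// ge0_fin_numE ?norm_pq_ge0//.
exact: le_lt_trans h2 (ltry _).
Qed.

Lemma norm_Y_rho (f : E0) c : Drad f -> norm_Y p q f < c ->
  (rho p q (grad f) <= (2 `^ q * (c `^ p + c `^ q))%:E)%E.
Proof.
move=> Df fc.
have c0 : 0 < c by apply: le_lt_trans fc; rewrite fine_ge0// norm_pq_ge0.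
apply: (rho_norm_pq p1 pq (mG Df) c0).
have fin : norm_pq p q (grad f) \is a fin_num.
  have ff := Drad_finite_gmod N2 p1 pq Df.
  have rf : rho p q (grad f) \is a fin_num by rewrite ge0_fin_numE ?rho_ge0.
  rewrite ge0_fin_numE ?norm_pq_ge0//.
  apply: le_lt_trans (norm_pq_le p1 pq (mG Df) _ _) (ltry _).
  - by move: (rho p q (grad f)) rf => r rf; exact: (fine_ge0 (x := rho p q (grad f)) (rho_ge0 _ _ _)).
  - by rewrite fineK.
by rewrite -(fineK fin) lte_fin.
Qed.

Lemma norm_L_powint (f : E0) c : Drad f -> fine (norm_L a f) <= c -> 0 <= c ->
  (powint a f <= (c `^ a)%:E)%E.
Proof.
move=> Df fc c0; rewrite -norm_L_le//.
have fin : norm_L a f \is a fin_num.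
  rewrite ge0_fin_numE ?norm_L_ge0//.
  have ff := Drad_finite_mom N2 Df a0.
  rewrite norm_LE//; apply: poweR_lty; exact: ff.
by rewrite -(fineK fin) lee_fin.
Qed.

Section completion.
Variables (W : completeNormedModType R) (i : E0 -> W).
Hypothesis HW : is_completion Drad (norm_W a p q) i.

Lemma completionB f g : Drad f -> Drad g -> i f - i g = i (f - g).
Proof.
move=> Df Dg; have -> : f - g = (-1) *: g + f by rewrite scaleN1r addrC.
by rewrite (completion_linear HW _ Dg Df) scaleN1r addrC.
Qed.

Lemma completion_cauchy (f : nat -> E0) (x : W) : (forall n, Drad (f n)) ->
  i (f n) @[n --> \oo] --> x -> forall c : R, 0 < c ->
  exists n0, forall n m, (n0 <= n)%N -> (n0 <= m)%N -> norm_W a p q (f n - f m) < c.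
Proof.
move=> Df fx c c0; have c20 : 0 < c / 2 by rewrite divr_gt0.
move/cvgrPdist_lt : fx => /(_ _ c20) [n0 _ H]; exists n0 => n m n0n n0m.
rewrite -(completion_isometry HW); last exact: DradB.
rewrite -completionB// (splitr c).
have -> : i (f n) - i (f m) = (x - i (f m)) - (x - i (f n)).
  by rewrite opprB [RHS]addrC addrA subrK.
by apply: le_lt_trans (ler_normB _ _) _; apply: ltrD; exact: H.
Qed.
Lemma norm_W_modulars c : 0 < c -> exists2 d, 0 < d & forall f : E0, Drad f ->
  norm_W a p q f < d -> (powint a f <= c%:E)%E /\ (rho p q (grad f) <= c%:E)%E.
Proof.
move=> c0.
have q20 : 0 < 2 `^ q :> R by rewrite powR_gt0.
pose e := Num.min 1 (Num.min c (c / 2 `^ q / 2)).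
have e0 : 0 < e by rewrite !lt_min ltr01 c0 !divr_gt0.
have e1 : e <= 1 by rewrite ge_min lexx.
have ec : e <= c by rewrite !ge_min lexx orbT.
have ec2 : e <= c / 2 `^ q / 2 by rewrite !ge_min lexx !orbT.
exists e => // f Df fe.
have h1 : fine (norm_L a f) <= e.
  by apply: le_trans (ltW fe); rewrite /norm_W lerDl fine_ge0// norm_pq_ge0.
have h2 : norm_Y p q f < e.
  by apply: le_lt_trans fe; rewrite /norm_W lerDr fine_ge0// norm_L_ge0.
split.
  apply: le_trans (norm_L_powint Df h1 (ltW e0)) _; rewrite lee_fin.
  by apply: le_trans ec; apply: ge1r_powR; rewrite ?e0 ?e1// ltW.
apply: le_trans (norm_Y_rho Df h2) _; rewrite lee_fin.
rewrite mulrC -ler_pdivlMr// (splitr (c / _)).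
by apply: lerD; apply: le_trans ec2; apply: ge1r_powR; rewrite ?e0 ?e1// ltW// (lt_trans p1).
Qed.

Lemma representsP x uU : represents a p q i x uU <->
  [/\ measurable_fun setT uU.1, measurable_fun setT uU.2 & exists f : nat -> E0,
     approximable uU f /\ i (f n) @[n --> \oo] --> x].
Proof.
split=> [[m1 m2 [f [Df fx fu fU]]]|[m1 m2 [f [[Df fu fU] fx]]]]; split => //; exists f.
  split => //; split => //.
    exact: (norm_L_cvg0P (fun n => f n \- uU.1) a0).1.
  apply: (norm_pq_cvg0P p1 pq (F := fun n x => grad (f n) x - uU.2 x) _).1 => //.
  by move=> n; apply: measurable_rVB => //; exact: mG.
split => //.
  exact: (norm_L_cvg0P (fun n => f n \- uU.1) a0).2.
apply: (norm_pq_cvg0P p1 pq (F := fun n x => grad (f n) x - uU.2 x) _).2 => //.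
by move=> n; apply: measurable_rVB => //; exact: mG.
Qed.

(** Density of the test functions, then completeness for the two modulars. *)
Lemma represents_ex x : exists uU, represents a p q i x uU.
Proof.
have /choice[f Hf] : forall n : nat, exists f, Drad f /\ `|x - i f| < n.+1%:R^-1.
  move=> n; have ne : ball x n.+1%:R^-1 !=set0.
    by exists x; apply: ballxx; rewrite invr_gt0.
  have [y [By [f Df fy]]] := completion_dense HW ne (ball_open _ _).
  by exists f; split => //; move: By; rewrite -fy -ball_normE.
have Df n : Drad (f n) by have [] := Hf n.
have fx : i (f n) @[n --> \oo] --> x.
  apply/cvgrPdist_lt => e e0; near=> n.
  apply: lt_trans (Hf n).2 _.
  by near: n; exact: near_infty_natSinv_lt (PosNum e0).
have [u [mu fu]] : exists u : E0, measurable_fun setT u /\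
    int_small leb (fun n x => `|f n x - u x| `^ a).
  apply: (powint_complete a0 (fun n => mD (Df n))) => c c0.
  have [d d0 Hd] := norm_W_modulars c0.
  have [n0 H] := completion_cauchy Df fx d0.
  by exists n0 => n m n0n n0m; apply: (Hd _ (DradB (Df n) (Df m)) (H _ _ n0n n0m)).1.
have [U [mU fU]] : exists U : 'rV[R]_N -> 'rV[R]_N, measurable_fun setT U /\
    int_small leb (fun n x => hpq p q (enorm (grad (f n) x - U x))).
  apply: (rho_complete p1 pq (fun n => mG (Df n))) => c c0.
  have [d d0 Hd] := norm_W_modulars c0.
  have [n0 H] := completion_cauchy Df fx d0.
  exists n0 => n m n0n n0m; apply: le_trans (Hd _ (DradB (Df n) (Df m)) (H _ _ n0n n0m)).2.
  rewrite /rho le_eqVlt; apply/orP; left; apply/eqP; apply: eq_integral => y _.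
  by rewrite gradB//; [case: (Df n)|case: (Df m)].
by exists (u, U); apply/representsP; split => //; exists f.
Unshelve. all: by end_near. Qed.

Lemma repP x : represents a p q i x (rep a p q i x).
Proof. by apply: xgetPex; exact: represents_ex. Qed.

End completion.
End representatives.

Section vanishing_integrals.
Context d (T : measurableType d) {R : realType} (mu : {measure set T -> \bar R}).

Lemma int_small_le2 (F G H : nat -> T -> R) (C D : R) : 0 <= C -> 0 <= D ->
  (forall n x, 0 <= F n x) -> (forall n x, 0 <= G n x) ->
  int_small mu F -> int_small mu G ->
  (forall n, (\int[mu]_x (H n x)%:E <=
     C%:E * \int[mu]_x (F n x)%:E + D%:E * \int[mu]_x (G n x)%:E)%E) ->
  int_small mu H.
Proof.
move=> C0 D0 F0 G0 sF sG HFG e e0.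
have e1 : 0 < e / 2 / (C + 1) by rewrite !divr_gt0// ltr_wpDl.
have e2 : 0 < e / 2 / (D + 1) by rewrite !divr_gt0// ltr_wpDl.
have hF := sF _ e1; have hG := sG _ e2; near=> n.
apply: le_trans (HFG n) _.
have aux (c c' : R) : 0 <= c -> 0 < c' -> c * (c' / (c + 1)) <= c'.
  move=> c0 c'0; have c10 : 0 < c + 1 by rewrite ltr_wpDl.
  have h : c / (c + 1) <= 1 by rewrite ler_pdivrMr// mul1r lerDl.
  have -> : c * (c' / (c + 1)) = c' * (c / (c + 1)) by ring.
  by rewrite ler_piMr// ltW.
rewrite (splitr e) EFinD; apply: leeD.
  apply: (@le_trans _ _ (C%:E * (e / 2 / (C + 1))%:E)%E).
    by apply: lee_wpmul2l => //; near: n.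
  by rewrite -EFinM lee_fin aux// divr_gt0.
apply: (@le_trans _ _ (D%:E * (e / 2 / (D + 1))%:E)%E).
  by apply: lee_wpmul2l => //; near: n.
by rewrite -EFinM lee_fin aux// divr_gt0.
Unshelve. all: by end_near. Qed.

Lemma int0_ae (f : T -> R) : measurable_fun setT f -> (forall x, 0 <= f x) ->
  (forall e : R, 0 < e -> (\int[mu]_x (f x)%:E <= e%:E)%E) ->
  {ae mu, forall x, f x = 0}.
Proof.
move=> mf f0 H.
have E : (\int[mu]_x (f x)%:E = 0)%E.
  apply/eqP; rewrite eq_le; apply/andP; split.
    by apply/lee_addgt0Pr => e e0; rewrite add0e; exact: H.
  by apply: integral_ge0 => x _; rewrite lee_fin.
have mf' : measurable_fun setT (EFin \o f) by exact/measurable_EFinP.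
have [h _] := ae_eq_integral_abs mu measurableT mf'.
have E2 : (\int[mu]_x `|(EFin \o f) x| = 0)%E.
  by rewrite -E; apply: eq_integral => x _ /=; rewrite ger0_norm.
by apply: filterS (h E2) => x /(_ I) /= [].
Qed.

End vanishing_integrals.

Section pair_algebra.
Context {R : realType} (N : nat) (p q a : R).
Hypotheses (N2 : (2 <= N)%N) (p1 : 1 < p) (pq : p < q) (qN : q < N%:R) (a1 : 1 < a).
Local Notation leb := (@lebesgueN R N).
Local Notation E0 := ('rV[R]_N -> R).
Local Notation EV := ('rV[R]_N -> 'rV[R]_N).
Let N0 : (0 < N)%N. Proof. exact: leq_trans N2. Qed.
Let p0 : 0 < p. Proof. exact: lt_trans ltr01 p1. Qed.
Let q0 : 0 < q. Proof. exact: lt_trans p0 pq. Qed.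
Let a0 : 0 < a. Proof. exact: lt_trans ltr01 a1. Qed.

Let mD (f : E0) : Drad f -> measurable_fun setT f.
Proof. by case=> sf _ rf; exact: measurable_radial. Qed.
Let mG (f : E0) : Drad f -> measurable_fun setT (grad f).
Proof. by case=> sf _ rf; exact: measurable_grad. Qed.

Lemma powintZ (c : R) (u : E0) : measurable_fun setT u ->
  (powint a (fun x => c * u x)%R = (`|c| `^ a)%:E * powint a u)%E.
Proof.
move=> mu; rewrite /powint -intZ ?powR_ge0//.
- by apply: eq_integral => x _; rewrite normrM powRM.
- exact: measurable_normpow.
Qed.

Lemma rhoZ_le (c : R) (U : EV) : measurable_fun setT U ->
  (rho p q (fun x => c *: U x)%R <= (Num.max 1 `|c| `^ q)%:E * rho p q U)%E.
Proof.
move=> mU; have mh := measurable_hpq_comp p q mU.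
rewrite /rho -intZ ?powR_ge0//; last by move=> x; exact: hpq_ge0.
apply: le_int.
- by apply: measurable_hpq_comp; exact: measurable_rVZ.
- exact: measurable_funM.
- by move=> x; exact: hpq_ge0.
move=> x; rewrite enormZ.
apply: (@le_trans _ _ (hpq p q (Num.max 1 `|c| * enorm (U x)))).
  apply: (@hpq_homo _ p q) => //; first by rewrite mulr_ge0 ?enorm_ge0.
  by rewrite ler_wpM2r ?enorm_ge0// le_max lexx orbT.
by apply: (@hpq_scale_ge1 _ p q) => //; rewrite ?enorm_ge0// le_max lexx.
Qed.

Lemma grad_lin (c : R) (f g : E0) x : Drad f -> Drad g ->
  grad (c *: f + g) x = c *: grad f x + grad g x.
Proof.
move=> [sf _ _] [sg _ _]; apply/rowP => i; rewrite !mxE.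
by have /= -> := foldr_partial_lin c [:: i] sf sg.
Qed.

(** The pairs (u, grad u) coming from points of the completion (represents_wpair),
which can be studied without it. *)
Definition wpair (uU : E0 * EV) := [/\ measurable_fun setT uU.1,
  measurable_fun setT uU.2 & exists f, approximable p q a uU f].

Lemma approximable_lin c (uU vV : E0 * EV) f g : measurable_fun setT uU.1 -> measurable_fun setT uU.2 ->
  measurable_fun setT vV.1 -> measurable_fun setT vV.2 ->
  approximable p q a uU f -> approximable p q a vV g ->
  approximable p q a ((fun x => c * uU.1 x + vV.1 x, fun x => c *: uU.2 x + vV.2 x) : E0 * EV)
    (fun n => c *: f n + g n).
Proof.
move=> m1 m2 m3 m4 [Df fu fU] [Dg gv gV]; split.
- by move=> n; exact: Drad_lin.
- apply: (@int_small_le2 _ _ _ leb _ _ _ (2 `^ a * `|c| `^ a) (2 `^ a) _ _ _ _ fu gv).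
  + by rewrite mulr_ge0 ?powR_ge0.
  + exact: powR_ge0.
  + by move=> n x; exact: powR_ge0.
  + by move=> n x; exact: powR_ge0.
  move=> n; have mu' := measurable_funB (mD (Df n)) m1.
  have mv' := measurable_funB (mD (Dg n)) m3.
  have mcu : measurable_fun setT (fun x => c * (f n x - uU.1 x)) by exact: measurable_funM.
  have := powintD a0 mcu mv'; rewrite powintZ// => H.
  rewrite (EFinM (2 `^ a)) -muleA -[leRHS]ge0_muleDr; last 2 first.
    by rewrite mule_ge0// ?lee_fin ?powR_ge0//; exact: powint_ge0.
    exact: powint_ge0.
  apply: (le_trans _ H); rewrite le_eqVlt; apply/orP; left; apply/eqP.
  apply: eq_integral => x _ /=; congr (`|_| `^ _)%:E.
  by rewrite -[(_ + _) x]/(c * f n x + g n x); ring.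
- apply: (@int_small_le2 _ _ _ leb _ _ _ (2 `^ q * Num.max 1 `|c| `^ q) (2 `^ q) _ _ _ _ fU gV).
  + by rewrite mulr_ge0 ?powR_ge0.
  + exact: powR_ge0.
  + by move=> n x; exact: hpq_ge0.
  + by move=> n x; exact: hpq_ge0.
  move=> n; have mu' := measurable_rVB (mG (Df n)) m2.
  have mv' := measurable_rVB (mG (Dg n)) m4.
  have mcu := measurable_rVZ c mu'.
  have H := rhoD p1 pq mcu mv'.
  rewrite (EFinM (2 `^ q)) -muleA -[leRHS]ge0_muleDr; last 2 first.
    by rewrite mule_ge0// ?lee_fin ?powR_ge0//; exact: rho_ge0.
    exact: rho_ge0.
  apply: (@le_trans _ _ (rho p q (fun x => c *: (grad (f n) x - uU.2 x) +
    (grad (g n) x - vV.2 x))%R)).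
    rewrite le_eqVlt; apply/orP; left; apply/eqP.
    apply: eq_integral => x _ /=; congr (hpq p q (enorm _))%:E.
    by rewrite grad_lin// scalerBr opprD addrACA.
  apply: (le_trans H).
  apply: lee_wpmul2l; first by rewrite lee_fin powR_ge0.
  by apply: leeD; [exact: (rhoZ_le c mu')|exact: lexx].
Qed.

Lemma wpair_lin c uU vV : wpair uU -> wpair vV ->
  wpair (fun x => c * uU.1 x + vV.1 x, fun x => c *: uU.2 x + vV.2 x).
Proof.
move=> [m1 m2 [f Hf]] [m3 m4 [g Hg]]; split => /=.
- by apply: measurable_funD => //; exact: measurable_funM.
- by apply: measurable_rVD => //; exact: measurable_rVZ.
- by exists (fun n => c *: f n + g n); exact: approximable_lin.
Qed.

Lemma powint_triangle (u v : E0) b c : measurable_fun setT u -> measurable_fun setT v ->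
  (powint a (fun x => v x - u x)%R <= c%:E)%E -> (powint a v <= b%:E)%E ->
  (powint a u <= (2 `^ a * (b + c))%:E)%E.
Proof.
move=> mu mv H1 H2; have mvu := measurable_funB mu mv.
have H3 : (powint a (fun x => u x - v x)%R <= c%:E)%E.
  by rewrite -powintN; under eq_fun do rewrite opprB; exact: H1.
have := powintD a0 mv mvu.
have -> : (fun x => v x + (u x - v x)) = u by apply/funext => x; rewrite addrC subrK.
move=> H4; apply: (le_trans H4); rewrite (EFinM (2 `^ a)) (EFinD b).
by apply: lee_wpmul2l; [rewrite lee_fin powR_ge0|exact: (leeD H2 H3)].
Qed.

Lemma rho_triangle (U V : EV) b c : measurable_fun setT U -> measurable_fun setT V ->
  (rho p q (fun x => V x - U x)%R <= c%:E)%E -> (rho p q V <= b%:E)%E ->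
  (rho p q U <= (2 `^ q * (b + c))%:E)%E.
Proof.
move=> mU mV H1 H2; have mVU := measurable_rVB mU mV.
have H3 : (rho p q (fun x => U x - V x)%R <= c%:E)%E.
  by rewrite -rhoN; under eq_fun do rewrite opprB; exact: H1.
have := rhoD p1 pq mV mVU.
have -> : (fun x => V x + (U x - V x)) = U by apply/funext => x; rewrite addrC subrK.
move=> H4; apply: (le_trans H4); rewrite (EFinM (2 `^ q)) (EFinD b).
by apply: lee_wpmul2l; [rewrite lee_fin powR_ge0|exact: (leeD H2 H3)].
Qed.
Lemma approximable_bounds (uU : E0 * EV) f b r : measurable_fun setT uU.1 ->
  measurable_fun setT uU.2 -> approximable p q a uU f -> 0 < b -> 0 < r ->
  (powint a uU.1 <= b%:E)%E -> (rho p q uU.2 <= r%:E)%E ->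
  \forall n \near \oo, (powint a (f n) <= (2 `^ a * (b + b))%:E)%E /\
    (rho p q (grad (f n)) <= (2 `^ q * (r + r))%:E)%E.
Proof.
move=> m1 m2 [Df fu fU] b0 r0 ub Ur.
have h1 := fu b b0; have h2 := fU r r0; near=> n.
have h1n : (powint a (fun x => f n x - uU.1 x)%R <= b%:E)%E by near: n.
have h2n : (rho p q (fun x => grad (f n) x - uU.2 x)%R <= r%:E)%E by near: n.
split.
  apply: (powint_triangle (mD (Df n)) m1 _ ub); rewrite -powintN.
  by under eq_fun do rewrite opprB.
apply: (rho_triangle (mG (Df n)) m2 _ Ur); rewrite -rhoN.
by under eq_fun do rewrite opprB.
Unshelve. all: by end_near. Qed.

Lemma wpair_finite uU : wpair uU -> (powint a uU.1 < +oo)%E /\ (rho p q uU.2 < +oo)%E.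
Proof.
move=> [m1 m2 [f [Df fu fU]]]; split.
  have [n _ Hn] := fu 1 ltr01.
  have H : (powint a (fun x => f n x - uU.1 x)%R <= 1%:E)%E by exact: (Hn n (leqnn n)).
  have ff : (powint a (f n) < +oo)%E by exact: (Drad_finite_mom N2 (Df n) a0).
  have fin : powint a (f n) \is a fin_num.
    by rewrite ge0_fin_numE; [exact: ff|exact: powint_ge0].
  have E : (powint a (f n) <= (fine (powint a (f n)))%:E)%E.
    by rewrite (fineK fin) lexx.
  exact: (le_lt_trans (powint_triangle m1 (mD (Df n)) H E) (ltry _)).
have [n _ Hn] := fU 1 ltr01.
have H : (rho p q (fun x => grad (f n) x - uU.2 x)%R <= 1%:E)%E by exact: (Hn n (leqnn n)).
have ff : (rho p q (grad (f n)) < +oo)%E by exact: (Drad_finite_gmod N2 p1 pq (Df n)).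
have fin : rho p q (grad (f n)) \is a fin_num.
  by rewrite ge0_fin_numE; [exact: ff|exact: rho_ge0].
have E : (rho p q (grad (f n)) <= (fine (rho p q (grad (f n))))%:E)%E.
  by rewrite (fineK fin) lexx.
exact: (le_lt_trans (rho_triangle m2 (mG (Df n)) H E) (ltry _)).
Qed.

Section completion.
Variables (W : completeNormedModType R) (i : E0 -> W).
Hypothesis HW : is_completion Drad (norm_W a p q) i.

Lemma represents_wpair x uU : represents a p q i x uU -> wpair uU.
Proof.
move=> /(representsP N2 p1 pq a1 i)[m1 m2 [f [Hf _]]]; split => //.
by exists f.
Qed.

Lemma represents_lin c x y uU vV : represents a p q i x uU -> represents a p q i y vV ->
  represents a p q i (c *: x + y)
    (fun t => c * uU.1 t + vV.1 t, fun t => c *: uU.2 t + vV.2 t).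
Proof.
move=> rx ry; have wu := represents_wpair rx; have wv := represents_wpair ry.
have [n1 n2 _] := wpair_lin c wu wv.
move: rx ry => /(representsP N2 p1 pq a1 i)[m1 m2 [f [Hf fx]]].
move=> /(representsP N2 p1 pq a1 i)[m3 m4 [g [Hg gy]]].
apply/(representsP N2 p1 pq a1 i); split => //.
exists (fun n => c *: f n + g n); split; first exact: approximable_lin.
have [Df _ _] := Hf; have [Dg _ _] := Hg.
under eq_fun do rewrite (completion_linear HW)//.
apply: cvgD => //; apply: cvgZl_tmp; exact: fx.
Qed.

(** The norm of x is the limit of the norms of the approximating test functions. *)
Lemma represents_norm x uU b r : represents a p q i x uU -> 0 < b -> 0 < r ->
  (powint a uU.1 <= b%:E)%E -> (rho p q uU.2 <= r%:E)%E ->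
  `|x| <= (2 `^ a * (b + b)) `^ a^-1 + (2 `^ q * (r + r)) `^ p^-1
     + (2 `^ q * (r + r)) `^ q^-1.
Proof.
move=> /(representsP N2 p1 pq a1 i)[m1 m2 [f [Hf fx]]] b0 r0 ub Ur.
have [Df _ _] := Hf.
have H := approximable_bounds m1 m2 Hf b0 r0 ub Ur.
have nfx : `|i (f n)| @[n --> \oo] --> `|x| by apply: cvg_norm; exact: fx.
rewrite leNgt; apply/negP => Bx.
have [n _ /(_ n (leqnn n)) [[h1 h2]]] := filterI H (cvgr_gt _ nfx _ Bx).
rewrite (completion_isometry HW (Df n)) ltNge => /negP; apply.
have b2 : 0 <= 2 `^ a * (b + b) by rewrite mulr_ge0 ?powR_ge0// addr_ge0// ltW.
have r2 : 0 <= 2 `^ q * (r + r) by rewrite mulr_ge0 ?powR_ge0// addr_ge0// ltW.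
exact: (norm_W_le N2 p1 pq a1 (Df n) b2 r2 h1 h2).
Qed.

(** The approximating test functions tend both to (0, 0) and to the pair. *)
Lemma represents0 uU : represents a p q i 0 uU ->
  {ae leb, forall x, uU.1 x = 0} /\ {ae leb, forall x, uU.2 x = 0}.
Proof.
move=> /(representsP N2 p1 pq a1 i)[m1 m2 [f [Hf fx]]].
have [Df fu fU] := Hf.
have sm c : 0 < c -> exists n, [/\ (powint a (f n) <= c%:E)%E, (rho p q (grad (f n)) <= c%:E)%E,
   (powint a (fun x => f n x - uU.1 x)%R <= c%:E)%E &
   (rho p q (fun x => grad (f n) x - uU.2 x)%R <= c%:E)%E].
  move=> c0; have [d d0 Hd] := norm_W_modulars N2 p1 pq a1 c0.
  move/cvgr0Pnorm_lt : fx => /(_ d d0) H.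
  have h1 := fu c c0; have h2 := fU c c0.
  have [n _ /(_ n (leqnn _)) [[h3 h4] h5]] := filterI (filterI h1 h2) H.
  have nf : norm_W a p q (f n) < d by rewrite -(completion_isometry HW (Df n)).
  have [h6 h7] := Hd _ (Df n) nf.
  by exists n; split; [exact: h6|exact: h7|exact: h3|exact: h4].
split.
- have : {ae leb, forall x, `|uU.1 x| `^ a = 0}.
    apply: int0_ae; first exact: measurable_normpow.
      by move=> x; exact: powR_ge0.
    move=> e e0; have c0 : 0 < e / 2 `^ a / 2 by rewrite !divr_gt0// powR_gt0.
    have [n [h1 _ h2 _]] := sm _ c0.
    apply: le_trans (powint_triangle m1 (mD (Df n)) h2 h1) _.
    by rewrite lee_fin -splitr mulrC divfK// gt_eqF// powR_gt0.
  apply: filterS => x /powR_eq0_eq0 /eqP; rewrite normr_eq0 => /eqP; exact.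
- have : {ae leb, forall x, hpq p q (enorm (uU.2 x)) = 0}.
    apply: int0_ae; first exact: measurable_hpq_comp.
      by move=> x; exact: hpq_ge0.
    move=> e e0; have c0 : 0 < e / 2 `^ q / 2 by rewrite !divr_gt0// powR_gt0.
    have [n [_ h1 _ h2]] := sm _ c0.
    apply: le_trans (rho_triangle m2 (mG (Df n)) h2 h1) _.
    by rewrite lee_fin -splitr mulrC divfK// gt_eqF// powR_gt0.
  apply: filterS => x hx; apply: enorm_eq0; apply/eqP; rewrite eq_le enorm_ge0 andbT leNgt.
  by apply/negP => /(hpq_gt0 p q); rewrite hx ltxx.
Qed.

Lemma represents_unique x uU vV : represents a p q i x uU -> represents a p q i x vV ->
  {ae leb, forall t, uU.1 t = vV.1 t} /\ {ae leb, forall t, uU.2 t = vV.2 t}.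
Proof.
move=> ru rv; have := represents_lin (-1) rv ru; rewrite scaleN1r addNr.
move=> /represents0[/= h1 h2]; split.
  by apply: filterS h1 => t; rewrite mulN1r addrC => /eqP; rewrite subr_eq0 => /eqP.
by apply: filterS h2 => t; rewrite scaleN1r addrC => /eqP; rewrite subr_eq0 => /eqP.
Qed.

(** The norm of j x is the limit of the gradient norms of the approximating test
functions, which bound their modulars. *)
Lemma represents_Y (Y : completeNormedModType R) (iY : E0 -> Y) (j : {linear W -> Y}) M :
  is_completion Drad (norm_Y p q) iY -> continuous j ->
  (forall f, Drad f -> j (i f) = iY f) -> 0 <= M ->
  exists2 C, 0 <= C & forall x uU, represents a p q i x uU -> `|j x| <= M ->
    (rho p q uU.2 <= C%:E)%E.
Proof.
move=> HY cj jE M0.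
pose C := 2 `^ q * ((M + 1) `^ p + (M + 1) `^ q).
have C0 : 0 <= C by rewrite mulr_ge0 ?powR_ge0// addr_ge0 ?powR_ge0.
exists (2 `^ q * (C + 1)); first by rewrite mulr_ge0 ?powR_ge0// addr_ge0.
move=> x uU /(representsP N2 p1 pq a1 i)[m1 m2 [f [[Df fu fU] fx]]] jx.
have jf : `|j (i (f n))| @[n --> \oo] --> `|j x|.
  by apply: cvg_norm; exact: (cvg_comp _ _ fx (cj x)).
have h1 : \forall n \near \oo, `|j (i (f n))| < M + 1.
  by apply: (cvgr_lt _ jf); apply: le_lt_trans jx _; rewrite ltrDl.
have h2 := fU 1 ltr01.
have [n _ /(_ n (leqnn _)) [h3 h4]] := filterI h1 h2.
apply: (rho_triangle m2 (mG (Df n)) h4).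
apply: (norm_Y_rho N2 p1 pq (Df n)).
by rewrite -(completion_isometry HY (Df n)) -(jE _ (Df n)).
Qed.

End completion.
End pair_algebra.

(** * Estimates and compactness in the completion *)

Section wpair_facts.
Context {R : realType} (N : nat) (p q a : R).
Hypotheses (N2 : (2 <= N)%N) (p1 : 1 < p) (pq : p < q) (qN : q < N%:R) (a1 : 1 < a).
Hypothesis aq : a <= crit_exp N p * conj_exp q / conj_exp p.
Local Notation leb := (@lebesgueN R N).
Local Notation E0 := ('rV[R]_N -> R).
Local Notation EV := ('rV[R]_N -> 'rV[R]_N).
Local Notation P := (crit_exp N p).
Local Notation t := (sob_exp N p).
Let N0 : (0 < N)%N. Proof. exact: leq_trans N2. Qed.
Let p0 : 0 < p. Proof. exact: lt_trans ltr01 p1. Qed.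
Let q0 : 0 < q. Proof. exact: lt_trans p0 pq. Qed.
Let a0 : 0 < a. Proof. exact: lt_trans ltr01 a1. Qed.
Let P0 : 0 < P. Proof. exact: crit_exp_gt0 N2 p1 pq qN. Qed.
Let t1 : 1 < t. Proof. exact: sob_exp_gt1 N2 p1 pq qN. Qed.

Let mD (f : E0) : Drad f -> measurable_fun setT f.
Proof. by case=> sf _ rf; exact: measurable_radial. Qed.

Lemma approximable_ae uU f : wpair p q a uU -> approximable p q a uU f ->
  exists s, extraction s /\ {ae leb, forall x, f (s n) x @[n --> \oo] --> uU.1 x}.
Proof.
move=> [m1 _ _] [Df fu _].
have [|n x|s [si sP]] := int_small_ae_subseq _ _ fu.
- by move=> n; apply: measurable_normpow; apply: measurable_funB => //; exact: mD.
- exact: powR_ge0.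
exists s; split => //; apply: filterS sP => x Hx.
have := cvg_comp _ _ Hx (@continuous_normpow R a^-1 _ 0).
rewrite invr_gt0 => /(_ a0) H.
apply/cvgrPdist_lt => e e0.
have {}H : `| `|f (s n) x - uU.1 x| `^ a | `^ a^-1 @[n --> \oo] --> 0.
  by move: H; rewrite normr0 powR0 ?invr_eq0 ?gt_eqF.
move/cvgr0Pnorm_lt : H => /(_ e e0); apply: filterS => n.
rewrite ger0_norm ?powR_ge0// ger0_norm ?powR_ge0// -powRrM mulfV ?gt_eqF// powRr1//.
by rewrite distrC.
Qed.

(** Fatou lemma, from Drad_sobolev along an almost everywhere convergent subsequence. *)
Lemma wpair_sobolev M e : 0 <= M -> 0 < e -> exists2 K, 0 <= K & forall uU : E0 * EV,
  wpair p q a uU -> (rho p q uU.2 <= M%:E)%E ->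
  (powint P uU.1 <= e%:E * powint a uU.1 + K%:E)%E.
Proof.
move=> M0 e0.
pose M' := 2 `^ q * ((M + 1) + (M + 1)).
have M'0 : 0 <= M' by rewrite mulr_ge0 ?powR_ge0// !addr_ge0.
have e'0 : 0 < e / 2 `^ a / 2 by rewrite !divr_gt0// powR_gt0.
have [K K0 HK] := Drad_sobolev N2 p1 pq qN a1 aq M'0 e'0.
exists (e + K) => [|uU wu UM]; first by rewrite addr_ge0// ltW.
have [m1 m2 [f Hf]] := wu; have [Df _ _] := Hf.
have [s [si sae]] := approximable_ae wu Hf.
have [uf _] := wpair_finite N2 p1 pq a1 wu.
pose B := fine (powint a uU.1).
have BE : powint a uU.1 = B%:E.
  by rewrite /B fineK// ge0_fin_numE; [exact: uf|exact: powint_ge0].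
have B0 : 0 <= B by rewrite -lee_fin -BE; exact: powint_ge0.
have UM1 : (rho p q uU.2 <= (M + 1)%:E)%E.
  by apply: (le_trans UM); rewrite lee_fin lerDl.
have uB1 : (powint a uU.1 <= (B + 1)%:E)%E by rewrite BE lee_fin lerDl.
have M10 : 0 < M + 1 by rewrite ltr_wpDl.
have B10 : 0 < B + 1 by rewrite ltr_wpDl.
have H := approximable_bounds N2 p1 pq a1 m1 m2 Hf B10 M10 uB1 UM1.
rewrite BE -EFinM -EFinD.
apply: (@fatou_le _ _ _ leb (fun n x => `|f (s n) x| `^ P)).
- by move=> n; apply: measurable_normpow; exact: mD.
- exact: measurable_normpow.
- by move=> n x; exact: powR_ge0.
- by move=> x; exact: powR_ge0.
- apply: filterS sae => x fx.
  have cp : continuous (fun y : R => `|y| `^ P) by exact: continuous_normpow.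
  exact: (cvg_comp _ _ fx (cp _)).
have Hs : \forall n \near \oo, (powint a (f (s n)) <= (2 `^ a * (B + 1 + (B + 1)))%:E)%E /\
    (rho p q (grad (f (s n))) <= M'%:E)%E.
  case: H => m _ Hm; exists m => [|n /= mn]; first exact: I.
  exact: (Hm (s n) (leq_trans mn (extraction_ge n si))).
apply: filterS Hs => n [h1 h2].
apply: (le_trans (HK _ (Df (s n)) h2)).
apply: (@le_trans _ _ ((e / 2 `^ a / 2)%:E * (2 `^ a * (B + 1 + (B + 1)))%:E + K%:E)%E).
  apply: leeD; last exact: lexx.
  by apply: lee_wpmul2l; [rewrite lee_fin ltW|exact: h1].
rewrite -EFinM -EFinD lee_fin.
have -> : e / 2 `^ a / 2 * (2 `^ a * (B + 1 + (B + 1))) = e * B + e.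
  by field; rewrite gt_eqF// powR_gt0.
by rewrite addrA.
Qed.

Lemma wpair_decay M : 0 <= M -> exists2 K, 0 <= K & forall uU : E0 * EV,
  wpair p q a uU -> (rho p q uU.2 <= M%:E)%E -> (powint a uU.1 <= M%:E)%E ->
  {ae leb, forall x, `|uU.1 x| `^ t * enorm x ^+ N.-1 <= K}.
Proof.
move=> M0.
pose M1 := 2 `^ q * ((M + 1) + (M + 1)); pose M2 := 2 `^ a * ((M + 1) + (M + 1)).
have M10 : 0 < M + 1 by rewrite ltr_wpDl.
have M1p : 0 <= M1 by rewrite mulr_ge0 ?powR_ge0// addr_ge0// ltW.
have M'0 : 0 <= Num.max M1 M2 by rewrite le_max M1p.
have [K K0 HK] := Drad_decay N2 p1 pq qN a1 aq M'0.
exists K => // uU wu UM uM.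
have [m1 m2 [f Hf]] := wu; have [Df _ _] := Hf.
have [s [si sae]] := approximable_ae wu Hf.
have UM1 : (rho p q uU.2 <= (M + 1)%:E)%E.
  by apply: (le_trans UM); rewrite lee_fin lerDl.
have uM1 : (powint a uU.1 <= (M + 1)%:E)%E by apply: (le_trans uM); rewrite lee_fin lerDl.
have H := approximable_bounds N2 p1 pq a1 m1 m2 Hf M10 M10 uM1 UM1.
have Hs : \forall n \near \oo, (powint a (f (s n)) <= M2%:E)%E /\
    (rho p q (grad (f (s n))) <= M1%:E)%E.
  case: H => m _ Hm; exists m => [|n /= mn]; first exact: I.
  exact: (Hm (s n) (leq_trans mn (extraction_ge n si))).
apply: filterS sae => x fx.
have cp : continuous (fun y : R => `|y| `^ t).
  by apply: continuous_normpow; exact: lt_trans t1.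
have c1 := cvg_comp _ _ fx (cp _).
have c2 : `|f (s n) x| `^ t * enorm x ^+ N.-1 @[n --> \oo] --> `|uU.1 x| `^ t * enorm x ^+ N.-1.
  by apply: cvgM; [exact: c1|exact: cvg_cst].
rewrite leNgt; apply/negP => Bx.
have [n _ /(_ n (leqnn n)) [[h1 h2]]] := filterI Hs (cvgr_gt _ c2 _ Bx).
rewrite ltNge => /negP; apply.
apply: (HK _ (Df (s n))).
- by apply: (le_trans h2); rewrite lee_fin le_max lexx.
- by apply: (le_trans h1); rewrite lee_fin le_max lexx orbT.
Qed.

(** Arzela-Ascoli on ]0, +oo[: by decay a diagonal subsequence of the profiles converges
at all positive rationals, and by equicontinuity at all positive radii. *)
Lemma Drad_compact (f : nat -> E0) M : 0 <= M -> (forall n, Drad (f n)) ->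
  (forall n, (rho p q (grad (f n)) <= M%:E)%E) ->
  (forall n, (powint a (f n) <= M%:E)%E) ->
  exists s, extraction s /\ forall x, x != 0 -> cvg (f (s n) x @[n --> \oo]).
Proof.
move=> M0 Df fR fB.
have rf n : radial (f n) by case: (Df n).
pose F n := profile N0 (f n).
have [K K0 HK] := Drad_decay N2 p1 pq qN a1 aq M0.
(* rr enumerates the positive rationals, with the junk value 1 *)
pose rr i : R := if unpickle i is Some r then (if 0 < (ratr r : R) then ratr r else 1) else 1.
have rr0 i : 0 < rr i by rewrite /rr; case: unpickle => // r; case: ifP.
have [i|s [si sP]] := @diagonal_subseq R (fun i n => F n (rr i)).
  exists ((K / rr i ^+ N.-1) `^ t^-1) => n.
  have t0 : 0 < t by exact: lt_trans t1.
  pose e0 : 'rV[R]_N := rr i *: delta_mx ord0 (Ordinal N0).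
  have e0n : enorm e0 = rr i.
    rewrite enormZ gtr0_norm// /enorm (bigD1 (Ordinal N0))//= big1 ?addr0 ?mxE ?eqxx ?expr1n ?sqrtr1 ?mulr1// => j ji.
    by rewrite mxE eqxx (negbTE ji) expr0n.
  have := HK _ (Df n) (fR n) (fB n) e0; rewrite e0n -ler_pdivlMr ?exprn_gt0// => H.
  have -> : `|F n (rr i)| = (`|F n (rr i)| `^ t) `^ t^-1.
    by rewrite -powRrM mulfV ?gt_eqF// powRr1.
  apply: ge0_ler_powR; rewrite ?nnegrE ?powR_ge0 ?invr_ge0 ?(ltW t0)//.
  by rewrite divr_ge0// exprn_ge0// ltW.
exists s; split => // x x0.
have r0 : 0 < enorm x.
  by rewrite lt0r enorm_ge0 andbT; apply: contra_neq x0; exact: enorm_eq0.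
under eq_fun do rewrite (radial_profile N0 (f := f (s _)) x (rf _)).
apply/cauchy_cvgP/cauchy_exP => e e0.
have d0 : 0 < enorm x / 2 by rewrite divr_gt0.
have e30 : 0 < e / 4 by rewrite divr_gt0.
have [eta eta0 Heta] := Drad_equicontinuous N2 p1 pq M0 d0 e30.
have [r] : exists r : rat, ratr r \in `](Num.max (enorm x / 2) (enorm x - eta)), (enorm x)[.
  apply: rat_in_itvoo; rewrite gt_max; apply/andP; split; last by rewrite ltrBlDr ltrDl.
  by rewrite ltr_pdivrMr// ltr_pMr// ltr1n.
rewrite in_itv/= gt_max => /andP[/andP[r1 r2] r3].
have rrE : rr (pickle r) = ratr r by rewrite /rr pickleK ifT// (lt_trans d0).
have Hc n : `|F n (enorm x) - F n (ratr r)| <= e / 4.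
  apply: (Heta _ (Df n) (fR n)).
  - by rewrite ler_pdivrMr// ler_pMr// ler1n.
  - exact: ltW.
  - by rewrite ger0_norm ?subr_ge0 ?(ltW r3)// lerBlDr -lerBlDl ltW.
case/cvg_ex : (sP (pickle r)) => l; rewrite rrE => /cvgrPdist_lt /(_ _ e30) Hl.
exists l; near=> n; rewrite -ball_normE /ball_/=.
have h1 : `|l - F (s n) (ratr r)| < e / 4 by near: n.
have h2 := Hc (s n); rewrite distrC in h2.
have -> : l - profile N0 (f (s n)) (enorm x) =
  (l - F (s n) (ratr r)) + (F (s n) (ratr r) - F (s n) (enorm x)) by rewrite addrA subrK.
apply: le_lt_trans (ler_normD _ _) _; lra.
Unshelve. all: by end_near. Qed.

Lemma leb_ae_neq0 : {ae leb, forall x : 'rV[R]_N, x != 0}.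
Proof.
exists [set x | enorm x <= 0]; split.
- exact: (@measurable_enorm_ball R N 0).
- exact: leb_enorm_le0.
- move=> x /= /negP; rewrite negbK => /eqP ->; by rewrite enorm0.
Qed.

(** Replace each u_n by a test function 1/n-close to it in L^a, for which Drad_compact
applies; along a further subsequence the errors tend to 0 almost everywhere. *)
Lemma wpair_compact (uU : nat -> E0 * EV) M : 0 <= M -> (forall n, wpair p q a (uU n)) ->
  (forall n, (rho p q (uU n).2 <= M%:E)%E) ->
  (forall n, (powint a (uU n).1 <= M%:E)%E) ->
  exists s, extraction s /\ exists u : E0, measurable_fun setT u /\
    {ae leb, forall x, (uU (s n)).1 x @[n --> \oo] --> u x}.
Proof.
move=> M0 wu UM uM.
pose M1 := 2 `^ q * ((M + 1) + (M + 1)); pose M2 := 2 `^ a * ((M + 1) + (M + 1)).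
have M10 : 0 < M + 1 by rewrite ltr_wpDl.
have M1p : 0 <= M1 by rewrite mulr_ge0 ?powR_ge0// addr_ge0// ltW.
have M'0 : 0 <= Num.max M1 M2 by rewrite le_max M1p.
have /choice[f Hf] : forall n : nat, exists f, [/\ Drad f, (powint a f <= M2%:E)%E,
    (rho p q (grad f) <= M1%:E)%E &
    (powint a (fun x => f x - (uU n).1 x)%R <= (n.+1%:R^-1)%:E)%E].
  move=> n; have [m1 m2 [f Hf]] := wu n; have [Df fu _] := Hf.
  have UM1 : (rho p q (uU n).2 <= (M + 1)%:E)%E.
    by apply: (le_trans (UM n)); rewrite lee_fin lerDl.
  have uM1 : (powint a (uU n).1 <= (M + 1)%:E)%E.
    by apply: (le_trans (uM n)); rewrite lee_fin lerDl.
  have H := approximable_bounds N2 p1 pq a1 m1 m2 Hf M10 M10 uM1 UM1.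
  have n0 : 0 < n.+1%:R^-1 :> R by rewrite invr_gt0.
  have [k _ /(_ k (leqnn k)) [[h1 h2] h3]] := filterI H (fu _ n0).
  by exists (f k); split; [exact: Df|exact: h1|exact: h2|exact: h3].
have Df n : Drad (f n) by have [] := Hf n.
have [||s [si sc]] := Drad_compact M'0 Df.
- move=> n; have [_ _ h _] := Hf n; apply: (le_trans h).
  by rewrite lee_fin le_max lexx.
- move=> n; have [_ h _ _] := Hf n; apply: (le_trans h).
  by rewrite lee_fin le_max lexx orbT.
have m1 n : measurable_fun setT (uU n).1 by have [] := wu n.
have sm : int_small leb (fun n x => `|f (s n) x - (uU (s n)).1 x| `^ a).
  move=> e e0; near=> n; have [_ _ _ h] := Hf (s n).
  apply: (le_trans h); rewrite lee_fin.
  apply: (@le_trans _ _ n.+1%:R^-1).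
    by rewrite lef_pV2 ?posrE ?ltr0n// ler_nat ltnS extraction_ge.
  by apply: ltW; near: n; exact: near_infty_natSinv_lt (PosNum e0).
have [|n x|s' [si' sP']] := int_small_ae_subseq _ _ sm.
- by move=> n; apply: measurable_normpow; apply: measurable_funB => //; exact: mD.
- exact: powR_ge0.
exists (s \o s'); split; first exact: extraction_comp.
pose v n := (uU (s (s' n))).1.
exists (ae_lim v); split; first by apply: measurable_ae_lim => n; exact: m1.
apply: filterS2 leb_ae_neq0 sP' => x x0 Hx.
apply: cvg_ae_lim.
case/cvg_ex : (sc x x0) => l fl.
have fl' : f (s (s' n)) x @[n --> \oo] --> l.
  exact: (cvg_comp _ _ (extraction_cvg si') fl).
have d0 : f (s (s' n)) x - v n x @[n --> \oo] --> 0.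
  apply/cvgr0Pnorm_lt => e e0.
  move/cvgr0Pnorm_lt : Hx => /(_ (e `^ a) (powR_gt0 _ e0)).
  apply: filterS => n; rewrite ger0_norm ?powR_ge0// => H.
  rewrite ltNge; apply/negP => He; move: H; rewrite ltNge => /negP; apply.
  by apply: ge0_ler_powR; rewrite ?nnegrE ?(ltW a0) ?(ltW e0).
apply/cvg_ex; exists l.
have -> : (fun n => v n x) = (fun n => f (s (s' n)) x - (f (s (s' n)) x - v n x)).
  by apply/funext => n; rewrite opprB addrC subrK.
by rewrite -[X in _ --> X]subr0; apply: cvgB.
Unshelve. all: by end_near. Qed.

End wpair_facts.

(** * The convex function of the gradient *)

Section convex_modular.
Context {R : realType} (p q : R) (phi : R -> R).
Hypotheses (p1 : 1 < p) (pq : p < q).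
Hypotheses (C1 : C1_Rplus phi) (F1 : Phi1 phi) (F2 : Phi2 p q phi) (F3 : Phi3 p q phi)
  (F4 : Phi4 phi).
Let p0 : 0 < p. Proof. exact: lt_trans ltr01 p1. Qed.
Let q0 : 0 < q. Proof. exact: lt_trans p0 pq. Qed.

Definition phisq (s : R) : R := phi (s ^+ 2).
Local Notation psi := phisq.

Lemma phisq_ge0 s : 0 <= psi s.
Proof. by case: C1 => H _; apply: H; rewrite sqr_ge0. Qed.

Lemma phisq0 : psi 0 = 0.
Proof. by rewrite /psi expr0n/= F1. Qed.

Lemma phisqN s : psi (- s) = psi s.
Proof. by rewrite /psi sqrrN. Qed.

Let sqr_powR (s r : R) : 0 <= s -> (s ^+ 2) `^ (r / 2) = s `^ r.
Proof.
by move=> s0; rewrite -powR_mulrn// -powRrM mulrCA mulfV ?mulr1// pnatr_eq0.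
Qed.

Lemma phisq_lower : exists2 c, 0 < c & forall s, 0 <= s -> c * hpq p q s <= psi s.
Proof.
have [c c0 H] := F2; exists c => // s s0; have [H1 H2] := H (s ^+ 2).
have [s1|/ltW s1] := leP 1 s.
  by rewrite hpq_ge1// -(@sqr_powR _ p)//; apply: H1; rewrite exprn_ege1.
rewrite (@hpq_le1 R p q) ?s0// -(@sqr_powR _ q)//; apply: H2.
by rewrite sqr_ge0/= exprn_ile1.
Qed.

Lemma phisq_upper : exists2 C, 0 < C & forall s, 0 <= s -> psi s <= C * hpq p q s.
Proof.
have [c c0 H] := F3; exists c => // s s0; have [H1 H2] := H (s ^+ 2).
have [s1|/ltW s1] := leP 1 s.
  by rewrite hpq_ge1// -(@sqr_powR _ p)//; apply: H1; rewrite exprn_ege1.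
rewrite (@hpq_le1 R p q) ?s0// -(@sqr_powR _ q)//; apply: H2.
by rewrite sqr_ge0/= exprn_ile1.
Qed.

Lemma continuous_phisq : continuous psi.
Proof.
move=> s; have [->|s0] := eqVneq s 0.
  have [C C0 HC] := phisq_upper.
  have H0 : C * hpq p q `|t| @[t --> (0 : R)] --> C * hpq p q `|0 : R|.
    by apply: cvgM; [exact: cvg_cst|exact: (continuous_hpq_norm p0 q0)].
  rewrite normr0 hpq0// mulr0 in H0.
  rewrite /continuous_at phisq0; apply: (squeeze_cvgr _ (cvg_cst (0 : R)) H0).
  near=> t; rewrite phisq_ge0/=.
  have -> : psi t = psi `|t| by rewrite /psi real_normK// num_real.
  exact: HC.
have [_ [dphi [_ H _]]] := C1.
have s20 : 0 < s ^+ 2 by rewrite exprn_even_gt0.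
have d := H _ s20.
have c1 : {for s ^+ 2, continuous phi}.
  by apply: differentiable_continuous; apply/derivable1_diffP; exact: ex_derive.
apply: (@continuous_comp _ _ _ (fun s : R => s ^+ 2) phi s); last exact: c1.
exact: exprn_continuous.
Unshelve. all: by end_near. Qed.

(** r is a proper convex combination of s and - s, where phisq takes the same value. *)
Lemma phisq_lt r s : 0 <= r -> r < s -> psi r < psi s.
Proof.
move=> r0 rs; have s0 : 0 < s by exact: le_lt_trans rs.
(* r = t s + (1 - t) (- s) *)
pose t := (r + s) / (2 * s).
have t01 : 0 < t < 1.
  rewrite /t divr_gt0 ?mulr_gt0//=; last lra.
  by rewrite ltr_pdivrMr ?mulr_gt0//; lra.
have sN : s != - s by rewrite -subr_eq0 opprK gt_eqF//; lra.
have := F4 sN t01; have -> : t * s + (1 - t) * - s = r.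
  by rewrite /t; field; rewrite gt_eqF.
by rewrite -!/(psi _) phisqN => H; apply: (lt_le_trans H); rewrite -mulrDl addrC subrK mul1r.
Qed.

Lemma phisq_le r s : 0 <= r -> r <= s -> psi r <= psi s.
Proof. by move=> r0; rewrite le_eqVlt => /predU1P[->//|/(phisq_lt r0)/ltW]. Qed.

Section euclidean.
Variable N : nat.
Local Notation V := 'rV[R]_N.
Implicit Types (x y : V) (l : R).

Lemma sqr_enorm_conv l x y : enorm ((1 - l) *: x + l *: y) ^+ 2 =
  (1 - l) * enorm x ^+ 2 + l * enorm y ^+ 2 - l * (1 - l) * enorm (x - y) ^+ 2.
Proof.
rewrite !sqr_enorm !mulr_sumr -sumrN -!big_split/=; apply: eq_bigr => i _.
by rewrite !mxE; ring.
Qed.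

Lemma ler_dist_enorm x y : `|enorm x - enorm y| <= enorm (x - y).
Proof.
have t1 := ler_enormD (x - y) y; have t2 := ler_enormD (y - x) x.
rewrite !subrK in t1 t2; rewrite -(enormN (y - x)) opprB in t2.
by rewrite ler_norml lerBlDr t1 andbT lerNl opprB lerBlDr.
Qed.

Lemma enorm_conv_le l x y : 0 < l < 1 ->
  enorm ((1 - l) *: x + l *: y) <= (1 - l) * enorm x + l * enorm y.
Proof.
move=> /andP[l0 l1]; apply: (le_trans (ler_enormD _ _)).
by rewrite !enormZ (ger0_norm (ltW l0)) ger0_norm// subr_ge0 ltW.
Qed.

(** Convexity defect of x |-> phi(|x|^2) between x and y. *)
Definition convdef l x y := (1 - l) * psi (enorm x) + l * psi (enorm y)
  - psi (enorm ((1 - l) *: x + l *: y)).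

(** Strict convexity applies to the norms b and c when they differ; when they agree,
the combination is shorter than both and strict monotonicity applies. *)
Let convdef_aux l (b c w : R) : 0 < l < 1 -> 0 <= w ->
  w <= (1 - l) * b + l * c -> (b = c -> w < b) ->
  psi w < (1 - l) * psi b + l * psi c.
Proof.
move=> /andP[l0 l1] w0 wle wlt.
have [bc|bc] := eqVneq b c.
  by rewrite -bc -mulrDl subrK mul1r; apply: phisq_lt => //; exact: wlt.
apply: (le_lt_trans (phisq_le w0 wle)).
have t01 : 0 < 1 - l < 1 by rewrite subr_gt0 l1/= ltrBlDr ltrDl.
by have := F4 bc t01; rewrite opprB addrCA subrr addr0.
Qed.

Lemma convdef_ge0 l x y : 0 < l < 1 -> 0 <= convdef l x y.
Proof.
move=> l01; have /andP[l0 l1] := l01; rewrite subr_ge0.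
apply: (le_trans (phisq_le (enorm_ge0 _) (enorm_conv_le _ _ l01))).
have [->|bc] := eqVneq (enorm x) (enorm y); first by rewrite -!mulrDl subrK !mul1r.
have t01 : 0 < 1 - l < 1 by rewrite subr_gt0 l1/= ltrBlDr ltrDl.
by have /ltW := F4 bc t01; rewrite opprB addrCA subrr addr0.
Qed.
(** The defect is a continuous function of the three numbers |x|, |y| and |x - y|, which
range in a compact set where it is positive. *)
Lemma convdef_gap l (M eta : R) : 0 < l < 1 -> 0 < eta -> exists2 c, 0 < c &
  forall x y, enorm x <= M -> enorm y <= M -> eta <= enorm (x - y) -> c <= convdef l x y.
Proof.
move=> l01 eta0; have /andP[l0 l1] := l01.
have ll : 0 < l * (1 - l) by rewrite mulr_gt0// subr_gt0.
apply: contrapT => Hno.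
have /choice[z Hz] : forall n : nat, exists z : V * V, [/\ enorm z.1 <= M, enorm z.2 <= M,
    eta <= enorm (z.1 - z.2) & convdef l z.1 z.2 < n.+1%:R^-1].
  move=> n; apply: contrapT => Hn; apply: Hno; exists n.+1%:R^-1; first by rewrite invr_gt0.
  move=> x y xM yM xy; rewrite leNgt; apply/negP => H; apply: Hn; by exists (x, y).
pose X (i n : nat) := match i with 0 => enorm (z n).1 | 1 => enorm (z n).2
  | _ => enorm ((z n).1 - (z n).2) end.
have [i|s [si sc]] := @diagonal_subseq R X.
  exists (M + M) => n; have [h1 h2 h3 _] := Hz n.
  have M0 := le_trans (enorm_ge0 _) h1.
  case: i => [|[|i]] /=; rewrite ger0_norm ?enorm_ge0//.
  - by apply: (le_trans h1); rewrite lerDl.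
  - by apply: (le_trans h2); rewrite lerDl.
  - by apply: (le_trans (ler_enormD _ _)); rewrite enormN lerD.
have [b Hb] : exists b : R, enorm (z (s n)).1 @[n --> \oo] --> b by case/cvg_ex : (sc 0%N) => z0; exists z0.
have [c Hc] : exists b : R, enorm (z (s n)).2 @[n --> \oo] --> b by case/cvg_ex : (sc 1%N) => z0; exists z0.
have [d Hd] : exists b : R, enorm ((z (s n)).1 - (z (s n)).2) @[n --> \oo] --> b
  by case/cvg_ex : (sc 2%N) => z0; exists z0.
have b0 : 0 <= b.
  by rewrite -(cvg_lim _ Hb)//; apply: limr_ge; [apply/cvg_ex; exists b|near=> n; exact: enorm_ge0].
have c0 : 0 <= c.
  by rewrite -(cvg_lim _ Hc)//; apply: limr_ge; [apply/cvg_ex; exists c|near=> n; exact: enorm_ge0].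
have d0 : eta <= d.
  rewrite -(cvg_lim _ Hd)//; apply: limr_ge; first by apply/cvg_ex; exists d.
  by near=> n; have [] := Hz (s n).
have c2 (u : nat -> R) (v : R) : u n @[n --> \oo] --> v -> u n ^+ 2 @[n --> \oo] --> v ^+ 2.
  by move=> H; rewrite expr2; under eq_fun do rewrite expr2; exact: cvgM.
have dbc : (b - c) ^+ 2 <= d ^+ 2.
  apply: (ler_cvg_to (c2 _ _ (cvgB Hb Hc)) (c2 _ _ Hd)); near=> n.
  rewrite -[X in X <= _]real_normK ?num_real// lerXn2r ?nnegrE ?enorm_ge0//.
  exact: ler_dist_enorm.
pose E := (1 - l) * b ^+ 2 + l * c ^+ 2 - l * (1 - l) * d ^+ 2.
have HE : enorm ((1 - l) *: (z (s n)).1 + l *: (z (s n)).2) ^+ 2 @[n --> \oo] --> E.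
  under eq_fun do rewrite sqr_enorm_conv.
  by apply: cvgB; [apply: cvgD|]; (apply: cvgM; [exact: cvg_cst|exact: c2]).
have E0 : 0 <= E.
  rewrite -(cvg_lim _ HE)//; apply: limr_ge; first by apply/cvg_ex; exists E.
  by near=> n; exact: sqr_ge0.
have Hw : enorm ((1 - l) *: (z (s n)).1 + l *: (z (s n)).2) @[n --> \oo] --> Num.sqrt E.
  have sE n : Num.sqrt (enorm ((1 - l) *: (z (s n)).1 + l *: (z (s n)).2) ^+ 2) =
      enorm ((1 - l) *: (z (s n)).1 + l *: (z (s n)).2).
    by rewrite sqrtr_sqr ger0_norm// enorm_ge0.
  rewrite -(funext sE); exact: (cvg_comp _ _ HE (@sqrt_continuous R E)).
have : psi (Num.sqrt E) < (1 - l) * psi b + l * psi c.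
  apply: convdef_aux => //.
  - rewrite -(@ler_pXn2r _ 2)// ?nnegrE ?sqr_sqrtr//; last first.
      by rewrite addr_ge0// mulr_ge0// ?ltW// subr_gt0.
    have -> : E = ((1 - l) * b + l * c) ^+ 2 - l * (1 - l) * (d ^+ 2 - (b - c) ^+ 2).
      by rewrite /E; ring.
    by rewrite lerBlDr lerDl mulr_ge0 ?(ltW ll)// subr_ge0.
  - move=> bc; rewrite -(@ltr_pXn2r _ 2)// ?nnegrE ?sqr_sqrtr//.
    have -> : E = b ^+ 2 - l * (1 - l) * d ^+ 2 by rewrite /E -bc; ring.
    by rewrite ltrBlDr ltrDl mulr_gt0// exprn_gt0// (lt_le_trans eta0).
rewrite ltNge => /negP; apply; rewrite -subr_le0.
have HL : convdef l (z (s n)).1 (z (s n)).2 @[n --> \oo] -->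
    (1 - l) * psi b + l * psi c - psi (Num.sqrt E).
  have cpsi (u : nat -> R) (v : R) : u n @[n --> \oo] --> v -> psi (u n) @[n --> \oo] --> psi v.
    by move=> H; apply: (cvg_comp _ _ H); exact: continuous_phisq.
  by apply: cvgB; [apply: cvgD; (apply: cvgM; [exact: cvg_cst|exact: cpsi])|exact: cpsi].
apply: (ler_cvg_to HL (cvg_comp _ _ (extraction_cvg si) (@cvg_harmonic R))).
by near=> n; have [_ _ _ /ltW] := Hz (s n).
Unshelve. all: by end_near. Qed.

(** The term l psi(|y|) is at least l c h(|y|), while the term subtracted contains h(|y|)
only with the factor l^p, negligible with respect to l since p > 1. *)
Lemma convdef_coercive : exists2 l, 0 < l < 1 & exists2 C, 0 < C & forall x y,
  hpq p q (enorm y) <= C * (convdef l x y + hpq p q (enorm x)).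
Proof.
have [c c0 Hc] := phisq_lower; have [C C0 HC] := phisq_upper.
pose C' := C * 2 `^ q.
have C'0 : 0 < C' by rewrite mulr_gt0// powR_gt0.
(* l is chosen so that C' l^(p-1) <= c/2 *)
pose l := Num.min 2^-1 ((c / 2 / C') `^ (p - 1)^-1).
have pm : 0 < p - 1 by rewrite subr_gt0.
have l0 : 0 < l by rewrite lt_min invr_gt0 ltr0n/= powR_gt0// !divr_gt0.
have l2 : l <= 2^-1 by rewrite ge_min lexx.
have l1 : l < 1 by apply: (le_lt_trans l2); rewrite invf_lt1// ltr1n.
have l01 : 0 < l < 1 by rewrite l0.
have lp : C' * l `^ p <= l * c / 2.
  have -> : l `^ p = l * l `^ (p - 1).
    rewrite -{2}(@powRr1 _ l) ?(ltW l0)// -powRD; last by apply/implyP => _; rewrite gt_eqF.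
    by rewrite addrCA subrr addr0.
  have h : l `^ (p - 1) <= c / 2 / C'.
    have -> : c / 2 / C' = ((c / 2 / C') `^ (p - 1)^-1) `^ (p - 1).
      by rewrite -powRrM mulVf ?gt_eqF// powRr1// !divr_ge0// ltW.
    by apply: ge0_ler_powR; rewrite ?nnegrE ?powR_ge0 ?(ltW l0) ?(ltW pm)// ge_min lexx orbT.
  rewrite mulrCA -mulrA ler_pM2l// mulrC -ler_pdivlMr//.
exists l => //; exists (2 / (l * c) * (1 + C')).
  by rewrite mulr_gt0 ?divr_gt0 ?mulr_gt0// addr_gt0.
move=> x y; set hx := hpq p q (enorm x); set hy := hpq p q (enorm y).
have hx0 : 0 <= hx := hpq_ge0 _ _ _.
have hy0 : 0 <= hy := hpq_ge0 _ _ _.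
have d0 := convdef_ge0 x y l01.
have H1 : l * c * hy <= l * psi (enorm y).
  by rewrite -mulrA ler_pM2l//; apply: Hc; exact: enorm_ge0.
have H2 : psi (enorm ((1 - l) *: x + l *: y)) <= C' * (hx + l `^ p * hy).
  apply: (le_trans (phisq_le (enorm_ge0 _) (enorm_conv_le _ _ l01))).
  have t1 : 0 <= (1 - l) * enorm x by rewrite mulr_ge0 ?enorm_ge0// subr_ge0 ltW.
  have t2 : 0 <= l * enorm y by rewrite mulr_ge0 ?enorm_ge0// ltW.
  apply: (le_trans (HC _ (addr_ge0 t1 t2))); rewrite /C' -mulrA ler_pM2l//.
  apply: (le_trans (hpq_add p1 pq t1 t2)); rewrite ler_pM2l ?powR_gt0//; apply: lerD.
    apply: (hpq_homo p1 pq t1); rewrite ler_piMl ?enorm_ge0// lerBlDr lerDl; exact: ltW.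
  by apply: hpq_scale_le1 => //; rewrite ?enorm_ge0// !ltW.
have H3 : 0 <= (1 - l) * psi (enorm x) by rewrite mulr_ge0 ?phisq_ge0// subr_ge0 ltW.
have H4 : l * c * hy - C' * (hx + l `^ p * hy) <= convdef l x y.
  by rewrite /convdef; lra.
have H5 : C' * l `^ p * hy <= l * c / 2 * hy by rewrite ler_wpM2r.
have H6 : l * c / 2 * hy <= convdef l x y + C' * hx by lra.
have lc : 0 < l * c by rewrite mulr_gt0.
apply: (@le_trans _ _ (2 / (l * c) * (convdef l x y + C' * hx))).
  by rewrite -invf_div ler_pdivlMl ?divr_gt0.
rewrite -[leRHS]mulrA; apply: ler_wpM2l; first by rewrite divr_ge0// ltW.
have : 0 <= C' * convdef l x y by rewrite mulr_ge0// ltW.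
by lra.
Qed.

End euclidean.
End convex_modular.

(** * The nonlinearity and its primitive *)

Section primitives.
Context {R : realType} (g : R -> R).
Hypothesis cg : continuous g.
Local Notation leb1 := (@lebesgue_measure R).

Let itvB (A u v : R) : A <= u -> u <= v ->
  \int[leb1]_(x in `[A, v]) g x - \int[leb1]_(x in `[A, u]) g x =
  \int[leb1]_(x in `[u, v]) g x.
Proof.
move=> Au uv; rewrite Rintegral_itvB.
- rewrite Rintegral_itv_obnd_cbnd//.
  apply: (integrableS _ _ _ (continuous_integrable_itv u v cg)) => //.
  by apply: subset_itvr; rewrite bnd_simp.
- exact: continuous_integrable_itv.
- by rewrite bnd_simp.
- by rewrite bnd_simp.
Qed.

(** Near z, the primitive is up to a constant the integral from a point A on the left of
z and 0, so that both sign conventions are covered at once. *)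
Lemma is_derive_primitive z : is_derive z (1 : R) (primitive g) (g z).
Proof.
(* A lies to the left of z and of 0 *)
pose A := Num.min z 0 - 1.
have Az : A < z by rewrite /A ltrBlDr; apply: (@le_lt_trans _ _ z); rewrite ?ltrDl// ge_min lexx.
have A0 : A <= 0 by rewrite /A lerBlDr; apply: (@le_trans _ _ 0); rewrite ?ler01 ?add0r// ge_min lexx orbT.
pose I y := \int[leb1]_(x in `[A, y]) g x.
have [dI IE] : derivable I z 1 /\ derive1 I z = g z.
  apply: (@continuous_FTC1_closed _ g A z (z + 1)) => //; first by rewrite ltrDl.
  - exact: continuous_integrable_itv.
  - exact: cg.
have hI : is_derive z (1 : R) I (g z).
  by rewrite -IE derive1E; exact: (derivableP dI).
have hB : is_derive z (1 : R) (fun y => I y - I 0) (g z).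
  by rewrite -[g z]subr0; apply: is_deriveB.
have hE : \forall y \near z, I y - I 0 = primitive g y.
  near=> y.
  have Ay : A <= y by apply: ltW; near: y; exact: lt_nbhsr.
  rewrite /primitive /I; case: leP => y0; first by rewrite itvB.
  by rewrite -opprB itvB// ltW.
exact: (near_eq_is_derive hE hB).
Unshelve. all: by end_near. Qed.

Lemma continuous_primitive : continuous (primitive g).
Proof.
move=> z; apply: differentiable_continuous; apply/derivable1_diffP.
by have [] := is_derive_primitive z.
Qed.

Lemma primitive0 : primitive g 0 = 0.
Proof. by rewrite /primitive lexx set_itv1 Rintegral_set1. Qed.

Lemma primitive_mvt u v : exists2 c, `|c| <= Num.max `|u| `|v| /\ `|c - u| <= `|v - u| &
  primitive g v - primitive g u = g c * (v - u).
Proof.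
have H x y : x <= y -> exists2 c, x <= c <= y & primitive g y - primitive g x = g c * (y - x).
  move=> xy; have [c cI cE] := @MVT_segment R (primitive g) g x y xy
    (fun x _ => is_derive_primitive x) (continuous_subspaceT continuous_primitive).
  by exists c => //; move: cI; rewrite in_itv.
have [uv|/ltW vu] := leP u v.
  have [c /andP[c1 c2] cE] := H _ _ uv; exists c => //; split.
    rewrite ler_norml lerNl !le_max; apply/andP; split; apply/orP.
      by left; apply: (@le_trans _ _ (- u)); rewrite ?lerN2// -normrN ler_norm.
    by right; apply: (le_trans c2); exact: ler_norm.
  by rewrite !ger0_norm ?subr_ge0// lerB.
have [c /andP[c1 c2] cE] := H _ _ vu; exists c => //; last first.
  by rewrite -opprB cE -mulrN opprB.
split.
  rewrite ler_norml lerNl !le_max; apply/andP; split; apply/orP.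
    by right; apply: (@le_trans _ _ (- v)); rewrite ?lerN2// -normrN ler_norm.
  by left; apply: (le_trans c2); exact: ler_norm.
by rewrite !ler0_norm ?subr_le0// !opprB lerB.
Qed.

End primitives.

Lemma limf_esup_near {R : realType} (f : R -> \bar R) (F : set_system R) (e : \bar R) :
  (limf_esup f F < e)%E -> exists2 V, F V & forall x, V x -> (f x < e)%E.
Proof.
rewrite limf_esupE => /ereal_inf_lt[_ [V FV <-] Ve]; exists V => // x Vx.
by apply: le_lt_trans Ve; apply: ereal_sup_ubound; exists x.
Qed.

Section nonlinearity.
Context {R : realType} (N : nat) (p a m : R) (g : R -> R).
Local Notation P := (crit_exp N p).
Hypotheses (a1 : 1 < a) (aP : a < P).
Hypotheses (cg : continuous g) (G2 : g2_hyp N p a m g) (GC : g_convention N p a m g).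
Let a0 : 0 < a. Proof. exact: lt_trans ltr01 a1. Qed.
Let P1 : 1 < P. Proof. exact: lt_trans aP. Qed.
Let P0 : 0 < P. Proof. exact: lt_trans ltr01 P1. Qed.
Let m0 : 0 < m. Proof. by case: G2. Qed.

(** On the negative axis the convention on g yields g s >= m |s|^(a-1), the same
coercivity of - g(s) s as for small positive s. *)
Lemma nonlin_neg s : s < 0 -> g s = Num.max (m * `|s| `^ (a - 1)) (- g `|s|).
Proof.
move=> s0; have [_ _ ->] := GC.
rewrite /g1_part /g2_part leNgt s0/= sub0r opprK /g1_part.
have -> : (0 <= - s) by rewrite oppr_ge0 ltW.
rewrite ltr0_norm//; set A := g (- s); set B := m * _.
by rewrite -[X in _ = Num.max X _](addrK A B) -[X in _ = Num.max _ X](add0r (- A)) -addr_maxl [B + A]addrC.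
Qed.
Lemma nonlin_near0 : exists2 s0, 0 < s0 & exists2 C, 0 < C & forall s, 0 < s < s0 ->
  - C * s `^ (a - 1) <= g s <= - (m / 2) * s `^ (a - 1).
Proof.
have [_ _ H1 _ H2] := G2.
have [V1 /= FV1 HV1] : exists2 V, (0 : R)^'+ V & forall s, V s ->
    ((g s / s `^ (a - 1))%:E < (- (m / 2))%:E)%E.
  by apply: limf_esup_near; rewrite H2 lte_fin ltrN2 ltr_pdivrMr// ltr_pMr// ltr1n.
have [C' HC'] : exists C' : R, (limf_esup (\- (fun s : R => (g s / s `^ (a - 1))%:E)) 0^'+ < C'%:E)%E.
  rewrite limf_esupN; move: H1; case: (limf_einf _ _) => [r||] //= _.
    by exists (- r + 1); rewrite lte_fin ltrDl.
  by exists 0; rewrite ltNyr.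
have [V2 /= FV2 HV2] := limf_esup_near HC'.
have [s0 /= s00 Hs] := filterI FV1 FV2.
exists s0 => //; exists (Num.max C' 1); first by rewrite lt_max ltr01 orbT.
move=> s /andP[s1 s2].
have [h1 h2] : V1 s /\ V2 s.
  by apply: Hs => //=; rewrite sub0r normrN gtr0_norm.
have sa : 0 < s `^ (a - 1) by exact: powR_gt0.
have := HV1 _ h1; rewrite lte_fin ltr_pdivrMr// => /ltW ->; rewrite andbT.
have := HV2 _ h2; rewrite lte_fin ltrNl ltr_pdivlMr// => /ltW H.
apply: le_trans H; rewrite ler_pM2r// lerN2 le_max lexx //.
Qed.

Lemma nonlin_growth_infty e : 0 < e -> exists2 S, 0 < S & forall s, S <= s ->
  `|g s| <= e * s `^ (P - 1).
Proof.
move=> e0; have [/cvgr0Pnorm_lt/(_ e e0) [S [_ HS]] _ _] := GC.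
exists (Num.max 1 (S + 1)); first by rewrite lt_max ltr01.
move=> s; rewrite ge_max => /andP[s1 Ss].
have s0 : 0 < s by exact: lt_le_trans s1.
have := HS s; rewrite (lt_le_trans _ Ss) ?ltrDl// => /(_ isT).
rewrite ger0_norm; last by rewrite divr_ge0// powR_ge0.
by rewrite (gtr0_norm s0) ltr_pdivrMr ?powR_gt0// => /ltW.
Qed.

Lemma nonlin_bounded_itv b c : exists2 K, 0 <= K & forall s, b <= s <= c -> `|g s| <= K.
Proof.
have [bc|cb] := leP b c; last first.
  by exists 0 => // s /andP[h1 h2]; move: (le_trans h1 h2); rewrite leNgt cb.
have cN : {within `[b, c], continuous (fun s => `|g s|)}.
  apply: continuous_subspaceT => s; apply: continuous_comp; first exact: cg.
  exact: norm_continuous.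
have [x _ Hx] := EVT_max bc cN.
by exists `|g x| => // s sI; apply: Hx; rewrite in_itv.
Qed.

Lemma nonlin0 : g 0 = 0.
Proof.
have [s0 s00 [C C0 H]] := nonlin_near0.
have h : `|g s| @[s --> 0^'+] --> `|g 0|.
  apply: cvg_norm; apply: cvg_at_right_filter; exact: cg.
apply/normr0_eq0/eqP; rewrite eq_le normr_ge0 andbT.
have cc : continuous (fun s : R => (C + m / 2) * `|s| `^ (a - 1)).
  move=> s; apply: cvgM; first exact: cvg_cst.
  by apply: continuous_normpow; rewrite subr_gt0.
have h2 := cvg_at_right_filter (cc 0).
rewrite normr0 powR0 ?mulr0 in h2; last by rewrite gt_eqF// subr_gt0.
apply: (ler_cvg_to h h2); near=> s.
have s1 : 0 < s by near: s; exact: nbhs_right_gt.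
have s2 : s < s0 by near: s; exact: nbhs_right_lt.
have /andP[h3 h4] : - C * s `^ (a - 1) <= g s <= - (m / 2) * s `^ (a - 1) by apply: H; rewrite s1.
have sa : 0 <= s `^ (a - 1) by exact: powR_ge0.
rewrite (gtr0_norm s1) ler_norml mulrDl.
have h5 : 0 <= C * s `^ (a - 1) by rewrite mulr_ge0// ltW.
have h6 : 0 <= m / 2 * s `^ (a - 1) by rewrite mulr_ge0// divr_ge0// ltW.
apply/andP; split; lra.
Unshelve. all: by end_near. Qed.

Lemma nonlin_growth : exists2 C, 0 < C & forall s,
  `|g s| <= C * (`|s| `^ (a - 1) + `|s| `^ (P - 1)).
Proof.
have [s0 s00 [C C0 H]] := nonlin_near0.
have [S S0 HS] := nonlin_growth_infty ltr01.
have [K K0 HK] := nonlin_bounded_itv s0 S.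
pose C' := C + m + 1 + K / s0 `^ (a - 1).
have sa0 : 0 < s0 `^ (a - 1) by exact: powR_gt0.
have K1 : 0 <= K / s0 `^ (a - 1) by rewrite divr_ge0// ltW.
have Hp s : 0 < s -> `|g s| <= C' * (`|s| `^ (a - 1) + `|s| `^ (P - 1)).
  move=> s1; rewrite (gtr0_norm s1).
  have sa : 0 < s `^ (a - 1) by exact: powR_gt0.
  have sP : 0 <= s `^ (P - 1) by exact: powR_ge0.
  have Cge c : 0 <= c -> c <= C' -> c * s `^ (a - 1) <= C' * (s `^ (a - 1) + s `^ (P - 1)).
    move=> c0 cC; apply: ler_pM => //; [exact: ltW|by rewrite lerDl].
  have [ss|ss] := ltP s s0.
    have /andP[h3 h4] : - C * s `^ (a - 1) <= g s <= - (m / 2) * s `^ (a - 1) by apply: H; rewrite s1.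
    have c1 : 0 <= C + m by rewrite addr_ge0// ltW.
    have c2 : C + m <= C' by rewrite /C'; lra.
    apply: (le_trans _ (Cge _ c1 c2)).
    have h5 : 0 <= C * s `^ (a - 1) by rewrite mulr_ge0// ltW.
    have h6 : 0 <= m * s `^ (a - 1) by rewrite mulr_ge0// ltW.
    by rewrite ler_norml; apply/andP; split; lra.
  have [sS|sS] := leP s S.
    apply: (le_trans (HK s _)); first by rewrite ss.
    have c2 : K / s0 `^ (a - 1) <= C'.
      by rewrite /C' lerDr; have := ltW C0; have := ltW m0; lra.
    apply: (le_trans _ (Cge _ K1 c2)).
    rewrite mulrAC ler_pdivlMr// ler_wpM2l//.
    by apply: ge0_ler_powR; rewrite ?nnegrE ?(ltW s00) ?(ltW s1)// subr_ge0 ltW.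
  apply: (le_trans (HS s (ltW sS))).
  apply: ler_pM => //.
    by rewrite /C'; have := ltW C0; have := ltW m0; lra.
  by rewrite lerDr ltW.
have C'0 : 0 < C' by rewrite /C'; have := m0; lra.
exists C' => //.
move=> s; have [s1|s1|->] := ltgtP s 0; [|exact: Hp|].
  rewrite nonlin_neg//; have s2 : 0 < `|s| by rewrite normr_gt0 lt_eqF.
  have := Hp _ s2; rewrite normr_id => H1.
  have h : m * `|s| `^ (a - 1) <= C' * (`|s| `^ (a - 1) + `|s| `^ (P - 1)).
    apply: ler_pM => //; rewrite ?powR_ge0 ?(ltW m0)//.
      by rewrite /C'; have := ltW C0; have := ltW m0; lra.
    by rewrite lerDl powR_ge0.
  have h6 : 0 <= m * `|s| `^ (a - 1) by rewrite mulr_ge0 ?powR_ge0// ltW.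
  rewrite ger0_norm; last by rewrite le_max h6.
  by rewrite ge_max h/=; apply: le_trans H1; rewrite -(normrN (g _)) ler_norm.
rewrite nonlin0 normr0; apply: mulr_ge0; first exact: ltW.
by rewrite addr_ge0 ?powR_ge0.
Qed.
(** For s < 0 this is nonlin_neg, for 0 < s < s0 the value of the upper limit of g at 0.
For s >= s0 both sides are negligible with respect to e s^p* + C, g being subcritical
at infinity and a < p*. *)
Lemma nonlin_coercive : exists2 s0, 0 < s0 & forall e, 0 < e -> exists2 C, 0 <= C &
  forall s, m / 2 * `|s| `^ a <= - (g s * s) + e * `|s| `^ P + C * (if s0 <= `|s| then 1 else 0).
Proof.
have [s0 s00 [C1 C10 H]] := nonlin_near0.
exists s0 => // e e0.
have powS (b s : R) : 0 < s -> s `^ b = s `^ (b - 1) * s.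
  move=> s1; rewrite -[X in _ * X]powRr1 ?(ltW s1)// -powRD ?subrK//.
  by apply/implyP => _; rewrite gt_eqF.
have e20 : 0 < e / 2 by rewrite divr_gt0.
have [S S0 HS] := nonlin_growth_infty e20.
have [K K0 HK] := nonlin_bounded_itv s0 S.
have th : 0 < a / P < 1 by rewrite divr_gt0//= ltr_pdivrMr// mul1r.
have m20 : 0 <= m / 2 by rewrite divr_ge0// ltW.
have [L L0 HL] := sublinear_powR m20 th e20.
exists (K * S + L) => [|s]; first by rewrite addr_ge0// mulr_ge0// ltW.
have Le : m / 2 * `|s| `^ a <= e / 2 * `|s| `^ P + L.
  have := HL _ (powR_ge0 `|s| P); rewrite -powRrM mulrCA divff ?mulr1//; exact: lt0r_neq0.
have eP0 : 0 <= e / 2 * `|s| `^ P by rewrite mulr_ge0 ?powR_ge0// ltW.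
have KS : 0 <= K * S by rewrite mulr_ge0// ltW.
have chi : 0 <= (K * S + L) * (if s0 <= `|s| then 1 else 0).
  by rewrite mulr_ge0 ?addr_ge0//; case: ifP.
have [s1|s1|<-] := ltgtP 0 s; last 1 first.
- by rewrite normr0 mulr0 oppr0 !powR0 ?gt_eqF// [s0 <= 0]leNgt s00/= !mulr0 !addr0.
- rewrite (gtr0_norm s1) in Le eP0 chi *.
  case: (leP s0 s) => [ss|ss]; last first.
    rewrite mulr0 addr0.
    have /andP[_ h4] : - C1 * s `^ (a - 1) <= g s <= - (m / 2) * s `^ (a - 1) by apply: H; rewrite s1.
    have : g s * s <= - (m / 2) * s `^ (a - 1) * s by rewrite ler_pM2r.
    by rewrite (powS a)//; lra.
  rewrite mulr1.
  have Hg : `|g s * s| <= K * S + e / 2 * s `^ P.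
    have [sS|sS] := leP s S.
      rewrite normrM (gtr0_norm s1); apply: (@le_trans _ _ (K * S)); last by rewrite lerDl.
      by apply: ler_pM => //; [exact: ltW|apply: HK; rewrite ss].
    rewrite normrM (gtr0_norm s1); apply: (@le_trans _ _ (e / 2 * s `^ P)); last by rewrite lerDr.
    by rewrite (powS P)// mulrA ler_pM2r//; apply: HS; exact: ltW.
  have := le_trans (ler_norm _) Hg; lra.
- have s2 : 0 < `|s| by rewrite normr_gt0 lt_eqF.
  have h : m * `|s| `^ (a - 1) <= g s by rewrite nonlin_neg// le_max lexx.
  have : m * `|s| `^ (a - 1) * `|s| <= g s * `|s| by rewrite ler_pM2r.
  rewrite -mulrA -powS// [X in _ <= _ * X -> _](ltr0_norm s1) mulrN => h2.
  have h3 : 0 <= m / 2 * `|s| `^ a by rewrite mulr_ge0// powR_ge0.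
  by lra.
Qed.

End nonlinearity.

(** * Finite integrals *)

Section real_integrals.
Context d (T : measurableType d) {R : realType} (mu : {measure set T -> \bar R}).
Implicit Types (f g h : T -> R) (F G : nat -> T -> R).

Definition rint f := mu.-integrable setT (EFin \o f).

Lemma rint_measurable f : rint f -> measurable_fun setT f.
Proof. by move=> /(measurable_int mu)/measurable_EFinP. Qed.

Lemma rintP f : rint f <->
  measurable_fun setT f /\ (\int[mu]_x (`|f x|)%:E < +oo)%E.
Proof.
split=> [fi|[mf fi]].
  split; first exact: rint_measurable.
  by case/integrableP : fi.
by apply/integrableP; split; [exact/measurable_EFinP|exact: fi].
Qed.

Lemma rint_ge0 f : measurable_fun setT f -> (forall x, 0 <= f x) ->
  (\int[mu]_x (f x)%:E < +oo)%E -> rint f.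
Proof.
move=> mf f0 fi; apply/rintP; split => //.
by under eq_integral do rewrite (ger0_norm (f0 _)).
Qed.

Lemma rint_le f g : measurable_fun setT f -> (forall x, `|f x| <= g x) -> rint g -> rint f.
Proof.
move=> mf fg gi; apply: (le_integrable measurableT _ _ gi).
- exact/measurable_EFinP.
- by move=> x _; rewrite /= lee_fin; apply: (le_trans (fg x)); exact: ler_norm.
Qed.

Lemma rintD f g : rint f -> rint g -> rint (fun x => f x + g x).
Proof. by move=> fi gi; exact: (integrableD measurableT fi gi). Qed.

Lemma rintB f g : rint f -> rint g -> rint (fun x => f x - g x).
Proof. by move=> fi gi; exact: (integrableB measurableT fi gi). Qed.

Lemma rintZ c f : rint f -> rint (fun x => c * f x).
Proof. by move=> fi; exact: (integrableZl measurableT c fi). Qed.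

Lemma rint_norm f : rint f -> rint (fun x => `|f x|).
Proof.
move=> fi; apply/rintP; split; first by apply: measurableT_comp => //; exact: rint_measurable.
by under eq_integral do rewrite normr_id; case/rintP: fi.
Qed.

Lemma RintE f : rint f -> (\int[mu]_x (f x)%:E = (\int[mu]_x f x)%:E)%E.
Proof. by move=> fi; rewrite fineK//; exact: integrable_fin_num. Qed.

Lemma eq_Rint_ae f g : measurable_fun setT f -> measurable_fun setT g ->
  {ae mu, forall x, f x = g x} -> \int[mu]_x f x = \int[mu]_x g x.
Proof.
move=> mf mg fg; rewrite /Rintegral; congr fine.
apply: (@ae_eq_integral _ _ _ mu setT (EFin \o g) (EFin \o f)) => //; try exact/measurable_EFinP.
by apply: filterS fg => x /= -> _.
Qed.

(** Dominated convergence in which a part G_n of the bound depends on n but has small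
integral; in the applications it comes from a Young inequality with small constant. *)
Lemma Rint_cvg_dom (F : nat -> T -> R) f : (forall n, rint (F n)) -> rint f ->
  {ae mu, forall x, F n x @[n --> \oo] --> f x} ->
  (forall e : R, 0 < e -> exists G h, [/\ forall n, rint (G n), rint h,
     forall n x, 0 <= G n x, forall x, 0 <= h x &
     (forall n x, `|F n x - f x| <= G n x + h x) /\ (forall n, \int[mu]_x G n x <= e)]) ->
  \int[mu]_x F n x @[n --> \oo] --> \int[mu]_x f x.
Proof.
move=> Fi fi Ff H; apply/cvgrPdist_le => e e0.
have e2 : 0 < e / 2 by rewrite divr_gt0.
have [G [h [Gi hi G0 h0 [FG Ge]]]] := H _ e2.
have di n : rint (fun x => F n x - f x) by exact: rintB.
have : \forall n \near \oo, (\int[mu]_x (`|F n x - f x|)%:E <= (e / 2 + e / 2)%:E)%E.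
  apply: (@int_small_dominated _ _ _ mu (fun n x => `|F n x - f x|) G h) => //.
  - by move=> n; exact: rint_measurable (rint_norm (di n)).
  - by move=> n; exact: rint_measurable.
  - exact: rint_measurable.
  - by rewrite RintE// ltry.
  - apply: filterS Ff => x Fx; apply/norm_cvg0P; rewrite -(subrr (f x)).
    by apply: cvgB => //; exact: cvg_cst.
  - by apply: aeW => x n; exact: FG.
  - by apply: nearW => n; rewrite RintE// lee_fin.
apply: filterS => n; rewrite -splitr RintE ?lee_fin; last exact: rint_norm.
apply: le_trans; rewrite distrC -(RintegralB measurableT (Fi n) fi).
exact: (le_normr_Rintegral measurableT (di n)).
Qed.

(** Otherwise Fatou lemma would fail along a subsequence. *)
Lemma fatou_eventually F f : (forall n, rint (F n)) -> rint f ->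
  (forall n, {ae mu, forall x, 0 <= F n x}) ->
  {ae mu, forall x, F n x @[n --> \oo] --> f x} ->
  forall e : R, 0 < e -> \forall n \near \oo, \int[mu]_x f x <= \int[mu]_x F n x + e.
Proof.
move=> Fi fi F0 Ff e e0; apply: contrapT => Hn.
have [s [si sP]] : exists s, extraction s /\ forall i,
    \int[mu]_x F (s i) x <= \int[mu]_x f x - e.
  apply: (subseq_frequently (P := fun i n => \int[mu]_x F n x <= \int[mu]_x f x - e)) => i k.
  apply: contrapT => Hk; apply: Hn; exists k => // n /= kn.
  rewrite leNgt; apply/negP => Hlt; apply: Hk; exists n => //.
  by rewrite lerBrDr ltW.
have F0' : {ae mu, forall x, forall n, 0 <= F n x}.
  by apply: ae_foralln => n; exact: F0.
have f0 : {ae mu, forall x, 0 <= f x}.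
  apply: filterS2 F0' Ff => x Fx fx.
  by rewrite -(cvg_lim _ fx)//; apply: limr_ge; [apply/cvg_ex; exists (f x)|exact: nearW].
have nE g : rint g -> {ae mu, forall x, 0 <= g x} -> \int[mu]_x `|g x| = \int[mu]_x g x.
  move=> gi g0; apply: eq_Rint_ae.
  - by apply: rint_measurable; exact: rint_norm.
  - exact: rint_measurable.
  - by apply: filterS g0 => x; exact: ger0_norm.
have : (\int[mu]_x (`|f x|)%:E <= (\int[mu]_x f x - e)%:E)%E.
  apply: (@fatou_le _ _ _ mu (fun n x => `|F (s n) x|)) => //.
  - by move=> n; apply: rint_measurable; exact: rint_norm.
  - by apply: rint_measurable; exact: rint_norm.
  - apply: filterS Ff => x Fx; apply: cvg_norm.
    exact: (cvg_comp _ _ (extraction_cvg si) Fx).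
  - apply: nearW => n; rewrite RintE; last exact: rint_norm.
    by rewrite nE// lee_fin.
rewrite RintE; last exact: rint_norm.
by rewrite nE// lee_fin leNgt ltrBlDr ltrDl e0.
Qed.

Lemma rint_lin (c : R) f g : rint f -> rint g -> rint (fun x => c * f x + g x).
Proof. by move=> fi gi; apply: rintD => //; exact: rintZ. Qed.

Lemma Rint_lin (c : R) f g : rint f -> rint g ->
  \int[mu]_x (c * f x + g x) = c * \int[mu]_x f x + \int[mu]_x g x.
Proof.
by move=> fi gi; rewrite (RintegralD measurableT (rintZ c fi) gi) (RintegralZl _ measurableT fi).
Qed.

Lemma markov_le f (c e : R) : measurable_fun setT f -> (forall x, 0 <= f x) -> 0 < e ->
  (\int[mu]_x (f x)%:E <= c%:E)%E -> (mu [set x | (e <= f x)%R] <= (c / e)%:E)%E.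
Proof.
move=> mf f0 e0 fc; have := le_trans (markov_measure mu mf f0 e0) fc.
have -> : (c / e)%:E = (e^-1%:E * c%:E)%E by rewrite -EFinM mulrC.
by rewrite lee_pdivlMl.
Qed.

End real_integrals.

(** * The nonlinear term of the functional *)

Section powers_products.
Context {R : realType}.
Implicit Types (x y e s : R).

Lemma powR_prod_le s e : 1 < s -> 0 < e -> exists2 C, 0 <= C & forall x y, 0 <= x -> 0 <= y ->
  x `^ (s - 1) * y <= e * x `^ s + C * y `^ s.
Proof.
move=> s1 e0; exists (e `^ (1 - s)); first exact: powR_ge0.
move=> x y x0 y0; have := young_powR (powR_ge0 x (s - 1)) y0 s1 e0.
rewrite -powRrM mulrCA mulfV ?mulr1//.
by rewrite gt_eqF// subr_gt0.
Qed.

Lemma powR_prod_le' s e : 1 < s -> 0 < e -> exists2 C, 0 <= C & forall x y, 0 <= x -> 0 <= y ->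
  x `^ (s - 1) * y <= C * x `^ s + e * y `^ s.
Proof.
move=> s1 e0; have sm : 0 < s - 1 by rewrite subr_gt0.
have c1 : 1 < s / (s - 1) by rewrite ltr_pdivlMr// mul1r ltrBlDr ltrDl.
exists (e `^ (1 - s / (s - 1))); first exact: powR_ge0.
move=> x y x0 y0; have := young_powR y0 (powR_ge0 x (s - 1)) c1 e0.
have -> : s / (s - 1) / (s / (s - 1) - 1) = s by field; rewrite !gt_eqF//; lra.
rewrite -powRrM mulrCA mulfV ?mulr1 ?gt_eqF// => H.
by rewrite [_ `^ _ * y]mulrC [leRHS]addrC.
Qed.

End powers_products.

Section nonlinear_part.
Context {R : realType} (N : nat) (p a m : R) (g : R -> R).
Local Notation P := (crit_exp N p).
Local Notation leb := (@lebesgueN R N).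
Local Notation E0 := ('rV[R]_N -> R).
Hypotheses (a1 : 1 < a) (aP : a < P).
Hypotheses (cg : continuous g) (G2 : g2_hyp N p a m g) (GC : g_convention N p a m g).
Let a0 : 0 < a. Proof. exact: lt_trans ltr01 a1. Qed.
Let P1 : 1 < P. Proof. exact: lt_trans aP. Qed.
Let P0 : 0 < P. Proof. exact: lt_trans ltr01 P1. Qed.

(** The growth of g(s) s and of the primitive of g. *)
Definition bipow (s : R) : R := `|s| `^ a + `|s| `^ P.

Lemma bipow_ge0 s : 0 <= bipow s.
Proof. by rewrite addr_ge0// powR_ge0. Qed.

Lemma nonlin_prod e : 0 < e -> exists2 C, 0 <= C & forall x y,
  `|g x * y| <= e * bipow x + C * bipow y.
Proof.
move=> e0; have [C C0 HC] := nonlin_growth a1 cg G2 GC.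
have eC : 0 < e / C by rewrite divr_gt0.
have [C1 C10 H1] := powR_prod_le a1 eC; have [C2 C20 H2] := powR_prod_le P1 eC.
exists (C * (C1 + C2)); first by rewrite mulr_ge0 ?addr_ge0// ltW.
move=> x y; rewrite normrM /bipow.
apply: (@le_trans _ _ (C * (`|x| `^ (a - 1) + `|x| `^ (P - 1)) * `|y|)).
  by apply: ler_wpM2r.
have h1 := H1 _ _ (normr_ge0 x) (normr_ge0 y).
have h2 := H2 _ _ (normr_ge0 x) (normr_ge0 y).
have k1 : 0 <= `|y| `^ a by exact: powR_ge0.
have k2 : 0 <= `|y| `^ P by exact: powR_ge0.
apply: (@le_trans _ _ (C * (e / C * (`|x| `^ a + `|x| `^ P) + (C1 + C2) * (`|y| `^ a + `|y| `^ P)))).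
  rewrite -mulrA ler_pM2l//.
  have : 0 <= C1 * `|y| `^ P by rewrite mulr_ge0.
  have : 0 <= C2 * `|y| `^ a by rewrite mulr_ge0.
  by lra.
rewrite mulrDr !mulrA lerD2r le_eqVlt; apply/orP; left; apply/eqP.
by field; rewrite gt_eqF.
Qed.

Lemma nonlin_prod' e : 0 < e -> exists2 C, 0 <= C & forall x y,
  `|g x * y| <= C * bipow x + e * bipow y.
Proof.
move=> e0; have [C C0 HC] := nonlin_growth a1 cg G2 GC.
have eC : 0 < e / C by rewrite divr_gt0.
have [C1 C10 H1] := powR_prod_le' a1 eC; have [C2 C20 H2] := powR_prod_le' P1 eC.
exists (C * (C1 + C2)); first by rewrite mulr_ge0 ?addr_ge0// ltW.
move=> x y; rewrite normrM /bipow.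
apply: (@le_trans _ _ (C * (`|x| `^ (a - 1) + `|x| `^ (P - 1)) * `|y|)).
  by apply: ler_wpM2r.
have h1 := H1 _ _ (normr_ge0 x) (normr_ge0 y).
have h2 := H2 _ _ (normr_ge0 x) (normr_ge0 y).
have k1 : 0 <= `|x| `^ a by exact: powR_ge0.
have k2 : 0 <= `|x| `^ P by exact: powR_ge0.
apply: (@le_trans _ _ (C * ((C1 + C2) * (`|x| `^ a + `|x| `^ P) + e / C * (`|y| `^ a + `|y| `^ P)))).
  rewrite -mulrA ler_pM2l//.
  have : 0 <= C1 * `|x| `^ P by rewrite mulr_ge0.
  have : 0 <= C2 * `|x| `^ a by rewrite mulr_ge0.
  by lra.
rewrite mulrDr !mulrA lerD2l le_eqVlt; apply/orP; left; apply/eqP.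
by field; rewrite gt_eqF.
Qed.

Lemma bipow_le x y : `|x| <= `|y| -> bipow x <= bipow y.
Proof.
by move=> xy; apply: lerD; apply: ge0_ler_powR; rewrite ?nnegrE// ltW.
Qed.

Lemma bipow_scale c x : bipow (c * x) <= bipow c * bipow x.
Proof.
rewrite /bipow normrM !powRM// mulrDl !mulrDr.
have := powR_ge0 `|c| a; have := powR_ge0 `|c| P.
have := powR_ge0 `|x| a; have := powR_ge0 `|x| P.
set A := `|c| `^ a; set B := `|c| `^ P; set C := `|x| `^ a; set D := `|x| `^ P.
move=> D0 C0 B0 A0; have := mulr_ge0 A0 D0; have := mulr_ge0 B0 C0; lra.
Qed.

Lemma bipow_add x y : bipow (x + y) <= (2 `^ a + 2 `^ P) * (bipow x + bipow y).
Proof.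
have H s : 0 < s -> `|x + y| `^ s <= 2 `^ s * (`|x| `^ s + `|y| `^ s).
  move=> s0; apply: (le_trans _ (powR_addl_le s0 (normr_ge0 x) (normr_ge0 y))).
  by apply: ge0_ler_powR; rewrite ?nnegrE ?addr_ge0// ?ler_normD// ltW.
have h1 := H _ a0; have h2 := H _ P0; rewrite /bipow; move: h1 h2.
have := powR_ge0 `|y| a; have := powR_ge0 `|y| P.
have := powR_ge0 `|x| a; have := powR_ge0 `|x| P.
have := powR_ge0 2 a; have := powR_ge0 2 P.
set A := `|x| `^ a; set B := `|x| `^ P; set C := `|y| `^ a; set D := `|y| `^ P.
set E := 2 `^ a; set F := 2 `^ P.
move=> F0 E0 B0 A0 D0 C0.
have := mulr_ge0 F0 A0; have := mulr_ge0 F0 C0.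
have := mulr_ge0 E0 B0; have := mulr_ge0 E0 D0; lra.
Qed.

Definition bipow_int (u : E0) := measurable_fun setT u /\ rint leb (fun x => bipow (u x)).

Lemma measurable_bipow (u : E0) : measurable_fun setT u -> measurable_fun setT (fun x => bipow (u x)).
Proof. by move=> mu; apply: measurable_funD; exact: measurable_normpow. Qed.

Lemma bipow_int_lin c (u v : E0) : bipow_int u -> bipow_int v -> bipow_int (fun x => c * u x + v x).
Proof.
move=> [mu iu] [mv iv].
have m1 : measurable_fun setT (fun x => c * u x + v x).
  by apply: measurable_funD => //; exact: measurable_funM.
split => //.
apply: (@rint_le _ _ _ leb _ (fun x => (2 `^ a + 2 `^ P) * (bipow c * bipow (u x) + bipow (v x)))).
- exact: measurable_bipow.
- move=> x; rewrite ger0_norm ?bipow_ge0//; apply: (le_trans (bipow_add _ _)).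
  by rewrite ler_wpM2l ?addr_ge0 ?powR_ge0// lerD2r; exact: bipow_scale.
- by apply: rintZ; apply: rintD => //; exact: rintZ.
Qed.

Let mg (u : E0) : measurable_fun setT u -> measurable_fun setT (fun x => g (u x)).
Proof.
by move=> mu; apply: (@measurableT_comp _ _ _ _ _ _ g) => //; exact: continuous_measurable_fun.
Qed.

Lemma rint_nonlin (u v : E0) : bipow_int u -> bipow_int v -> rint leb (fun x => g (u x) * v x).
Proof.
move=> [mu iu] [mv iv]; have [C C0 H] := nonlin_prod ltr01.
apply: (@rint_le _ _ _ leb _ (fun x => 1 * bipow (u x) + C * bipow (v x))).
- by apply: measurable_funM => //; exact: mg.
- by move=> x; exact: H.
- by apply: rintD; exact: rintZ.
Qed.

Lemma nonlin_self : exists2 C, 0 <= C & forall c s, `|c| <= s -> `|g c| * s <= C * bipow s.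
Proof.
have [C C0 H] := nonlin_prod ltr01; exists (1 + C); first by rewrite addr_ge0.
move=> c s cs; have s0 : 0 <= s := le_trans (normr_ge0 _) cs.
have := H c s; rewrite normrM (ger0_norm s0) => h; apply: (le_trans h).
rewrite mul1r mulrDl mul1r lerD2r; apply: bipow_le; by rewrite (ger0_norm s0).
Qed.

Lemma primitive_bound : exists2 C, 0 <= C & forall s, `|primitive g s| <= C * bipow s.
Proof.
have [C C0 H] := nonlin_self; exists C => // s.
have [c [c1 _]] := primitive_mvt cg 0 s.
rewrite primitive0 !subr0 => ->; rewrite normrM.
have c2 : `|c| <= `|s| by apply: (le_trans c1); rewrite ge_max normr0 normr_ge0 lexx.
have := H _ _ c2; rewrite /bipow normr_id //.
Qed.

Lemma measurable_primitive (u : E0) : measurable_fun setT u ->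
  measurable_fun setT (fun x => primitive g (u x)).
Proof.
move=> mu; apply: (@measurableT_comp _ _ _ _ _ _ (primitive g)) => //.
by apply: continuous_measurable_fun; exact: continuous_primitive.
Qed.

Lemma rint_primitive (u : E0) : bipow_int u -> rint leb (fun x => primitive g (u x)).
Proof.
move=> [mu iu]; have [C C0 H] := primitive_bound.
apply: (rint_le (measurable_primitive mu) (fun x => H (u x))); exact: rintZ.
Qed.
(** The nonlinear term is differentiable in all directions: mean value theorem and
dominated convergence. *)
Lemma primitive_dquot (u v : E0) (t : nat -> R) : bipow_int u -> bipow_int v ->
  (forall n, 0 < t n <= 1) -> t n @[n --> \oo] --> 0 ->
  (t n)^-1 * (\int[leb]_x primitive g (t n * v x + u x) - \int[leb]_x primitive g (u x))
    @[n --> \oo] --> \int[leb]_x (g (u x) * v x).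
Proof.
move=> bu bv t01 t0.
have bt n := bipow_int_lin (t n) bv bu.
pose D n x := (t n)^-1 * (primitive g (t n * v x + u x) - primitive g (u x)).
have Di n : rint leb (D n).
  by apply: rintZ; apply: rintB; [exact: (rint_primitive (bt n))|exact: rint_primitive].
have DE n : (t n)^-1 * (\int[leb]_x primitive g (t n * v x + u x) - \int[leb]_x primitive g (u x))
    = \int[leb]_x D n x.
  rewrite -RintegralB//; [|exact: (rint_primitive (bt n))|exact: rint_primitive].
  rewrite -RintegralZl//; apply: rintB; [exact: (rint_primitive (bt n))|exact: rint_primitive].
rewrite (funext DE).
have Dc n x : exists2 c, (`|c| <= `|u x| + `|v x|) /\ `|c - u x| <= `|t n * v x| & D n x = g c * v x.
  have [c [c1 c2] cE] := primitive_mvt cg (u x) (t n * v x + u x).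
  have /andP[tn0 tn1] := t01 n.
  have tv : `|t n * v x| <= `|v x|.
    by rewrite normrM gtr0_norm// ler_piMl.
  exists c; first split.
  - apply: (le_trans c1); rewrite ge_max lerDl normr_ge0/=.
    by apply: (le_trans (ler_normD _ _)); rewrite addrC lerD2l.
  - by move: c2; rewrite addrK.
  - by rewrite /D cE addrK mulrCA mulrA mulrA -(mulrA (g c)) mulVf ?mulr1 ?gt_eqF// mulrC mulrA.
have [C C0 HC] := nonlin_self.
have bs : bipow_int (fun x => `|u x| + `|v x|).
  have [mu iu] := bu; have [mv iv] := bv.
  have bn (w : E0) : bipow_int w -> bipow_int (fun x => `|w x|).
    move=> [mw iw]; split; first exact: measurableT_comp.
    by rewrite /bipow; under eq_fun do rewrite normr_id.
  have := bipow_int_lin 1 (bn _ bu) (bn _ bv).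
  by under eq_fun do rewrite mul1r.
apply: (@Rint_cvg_dom _ _ _ leb) => //.
- exact: rint_nonlin.
- apply: aeW => x.
  have /choice[c Hc] : forall n, exists c, (`|c| <= `|u x| + `|v x|) /\
     `|c - u x| <= `|t n * v x| /\ D n x = g c * v x.
    by move=> n; have [c [h1 h2] h3] := Dc n x; exists c.
  have cu : c n @[n --> \oo] --> u x.
    apply/subr_cvg0; apply: (@squeeze_cvgr _ _ _ _ (fun n => - `|t n * v x|) (fun n => `|t n * v x|)).
    + by apply: nearW => n; rewrite -ler_norml; have [_ []] := Hc n.
    + rewrite -oppr0; apply: cvgN; rewrite -(normr0 R) -(mul0r (v x)); apply: cvg_norm.
      by apply: cvgM => //; exact: cvg_cst.
    + rewrite -(normr0 R) -(mul0r (v x)); apply: cvg_norm.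
      by apply: cvgM => //; exact: cvg_cst.
  have -> : (fun n => D n x) = (fun n => g (c n) * v x).
    by apply/funext => n; have [_ []] := Hc n.
  apply: cvgM; last exact: cvg_cst.
  exact: (cvg_comp _ _ cu (@cg (u x))).
- move=> e e0; exists (fun _ _ => 0), (fun x => (C + C) * bipow (`|u x| + `|v x|)); split => //.
  + by move=> _; apply: rint_ge0 => //; rewrite integral0 ltry.
  + by apply: rintZ; have [] := bs.
  + by move=> x; rewrite mulr_ge0 ?bipow_ge0// addr_ge0.
  + split; last by move=> n; rewrite /Rintegral integral0 ltW.
    move=> n x; rewrite add0r mulrDl.
    have [c [c1 _] ->] := Dc n x.
    have H b : `|b| <= `|u x| + `|v x| -> `|g b * v x| <= C * bipow (`|u x| + `|v x|).
      move=> hb; rewrite normrM; apply: (le_trans _ (HC _ _ hb)).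
      by apply: ler_wpM2l => //; rewrite lerDr.
    apply: (le_trans (ler_normB _ _)); apply: lerD; first exact: H.
    by apply: H; rewrite lerDl.
Qed.

End nonlinear_part.

(** * The convexity inequality satisfied by the derivative *)

Lemma ler_dual_norm {R : realType} {E : normedModType R} (f : E -> R) (x h : E) :
  differentiable f x -> `|'d f x h| <= dual_norm ('d f x) * `|h|.
Proof.
move=> dfx; have [->|h0] := eqVneq h 0; first by rewrite linear0 !normr0 mulr0.
have : \forall r \near +oo, forall y : E, `|'d f x y| <= r * `|y|.
  by apply/linear_boundedP; apply/linear_bounded_continuous; exact: diff_continuous.
move=> [r0 [_ Hr]]; have {}Hr := Hr (r0 + 1); rewrite ltrDl in Hr; have {}Hr := Hr ltr01.
have hn : 0 < `|h| by rewrite normr_gt0.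
have hE : h = `|h| *: (`|h|^-1 *: h) by rewrite scalerA mulfV ?scale1r// gt_eqF.
rewrite {1}hE linearZ/= normrM normr_id mulrC ler_pM2r//.
apply: sup_upper_bound.
  split; first by exists `|'d f x 0|; exists 0 => //=; rewrite normr0 ler01.
  exists (Num.max 0 (r0 + 1)) => _ [y /= y1 <-]; apply: (le_trans (Hr y)).
  apply: (@le_trans _ _ (Num.max 0 (r0 + 1) * `|y|)).
    by rewrite ler_wpM2r// le_max lexx orbT.
  by rewrite ler_piMr// le_max lexx.
by exists (`|h|^-1 *: h) => //=; rewrite normrZ normfV normr_id mulVf ?gt_eqF.
Qed.

Lemma diff_sequence {R : realType} {E : normedModType R} (f : E -> R) (x h : E) (t : nat -> R) :
  differentiable f x -> (forall n, t n != 0) -> t n @[n --> \oo] --> 0 ->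
  (t n)^-1 * (f (t n *: h + x) - f x) @[n --> \oo] --> ('d f x h : R).
Proof.
move=> dfx tn0 t0.
have d : derivable f x h by exact: diff_derivable.
rewrite -deriveE//.
have tt : t n @[n --> \oo] --> (0 : R)^'.
  move=> A [e e0 HA]; have /cvgr0Pnorm_lt/(_ e e0) := t0.
  apply: filterS => n tne; apply: HA => /=; last exact: tn0.
  by rewrite sub0r normrN.
exact: (cvg_comp _ _ tt d).
Qed.

Section functional.
Context {R : realType} (N : nat) (p q a m : R) (phi g : R -> R).
Local Notation P := (crit_exp N p).
Local Notation leb := (@lebesgueN R N).
Local Notation E0 := ('rV[R]_N -> R).
Local Notation EV := ('rV[R]_N -> 'rV[R]_N).
Hypotheses (N2 : (2 <= N)%N) (p1 : 1 < p) (pq : p < q) (qN : q < N%:R) (a1 : 1 < a).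
Hypothesis aq : a <= crit_exp N p * conj_exp q / conj_exp p.
Hypotheses (C1 : C1_Rplus phi) (F1 : Phi1 phi) (F2 : Phi2 p q phi) (F3 : Phi3 p q phi)
  (F4 : Phi4 phi).
Hypotheses (cg : continuous g) (G2 : g2_hyp N p a m g) (GC : g_convention N p a m g).
Let aP : a < P := exp_lt_crit N2 p1 pq qN aq.
Let P0 : 0 < P := crit_exp_gt0 N2 p1 pq qN.
Local Notation psi := (phisq phi).

(** Twice the first term of J. *)
Definition kinetic (U : EV) : R := \int[leb]_x psi (enorm (U x)).

Lemma measurable_kinetic (U : EV) : measurable_fun setT U ->
  measurable_fun setT (fun x => psi (enorm (U x))).
Proof.
move=> mU; apply: (@measurableT_comp _ _ _ _ _ _ psi); last exact: measurable_enorm_comp.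
by apply: continuous_measurable_fun; exact: (continuous_phisq p1 pq C1 F1 F3).
Qed.

Lemma rint_hpq (U : EV) : measurable_fun setT U -> (rho p q U < +oo)%E ->
  rint leb (fun x => hpq p q (enorm (U x))).
Proof.
move=> mU Uf; apply: rint_ge0; [exact: measurable_hpq_comp| |exact: Uf].
by move=> x; exact: hpq_ge0.
Qed.

Lemma rint_kinetic (U : EV) : measurable_fun setT U -> (rho p q U < +oo)%E ->
  rint leb (fun x => psi (enorm (U x))).
Proof.
move=> mU Uf; have [C C0 HC] := phisq_upper p1 pq F3.
apply: (rint_le (measurable_kinetic mU) _ (rintZ C (rint_hpq mU Uf))) => x.
by rewrite ger0_norm ?phisq_ge0//; exact: HC (enorm_ge0 _).
Qed.

Lemma wpair_bipow (uU : E0 * EV) : wpair p q a uU -> bipow_int p a uU.1.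
Proof.
move=> wu; have [m1 m2 _] := wu; have [uf Uf] := wpair_finite N2 p1 pq a1 wu.
have rE : rho p q uU.2 = (fine (rho p q uU.2))%:E by rewrite fineK// ge0_fin_numE// rho_ge0.
have r0 : 0 <= fine (rho p q uU.2) by rewrite fine_ge0// rho_ge0.
have [K K0 HK] := wpair_sobolev N2 p1 pq qN a1 aq r0 ltr01.
have Pf : (powint P uU.1 < +oo)%E.
  have UM : (rho p q uU.2 <= (fine (rho p q uU.2))%:E)%E by rewrite -rE.
  apply: (le_lt_trans (HK _ wu UM)).
  by rewrite mul1e lte_add_pinfty// ltry.
split; first exact: m1.
have i1 : rint leb (fun x => `|uU.1 x| `^ a).
  by apply: rint_ge0; [exact: measurable_normpow|move=> x; exact: powR_ge0|exact: uf].
have i2 : rint leb (fun x => `|uU.1 x| `^ P).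
  by apply: rint_ge0; [exact: measurable_normpow|move=> x; exact: powR_ge0|exact: Pf].
exact: (rintD i1 i2).
Qed.

Lemma measurable_convdef l (U V : EV) : measurable_fun setT U -> measurable_fun setT V ->
  measurable_fun setT (fun x => convdef phi l (U x) (V x)).
Proof.
move=> mU mV; apply: measurable_funB.
  by apply: measurable_funD; apply: measurable_funM => //; exact: measurable_kinetic.
by apply: measurable_kinetic; apply: measurable_rVD; exact: measurable_rVZ.
Qed.

Lemma rho_conv_finite (c e : R) (U V : EV) : measurable_fun setT U -> measurable_fun setT V ->
  (rho p q U < +oo)%E -> (rho p q V < +oo)%E ->
  (rho p q (fun x => c *: U x + e *: V x)%R < +oo)%E.
Proof.
move=> mU mV Uf Vf; have mcU := measurable_rVZ c mU; have meV := measurable_rVZ e mV.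
have h (b : R) (Z : EV) : measurable_fun setT Z -> (rho p q Z < +oo)%E ->
    (rho p q (fun x => b *: Z x)%R < +oo)%E.
  move=> mZ Zf; apply: (le_lt_trans (rhoZ_le p1 pq b mZ)).
  by rewrite lte_mul_pinfty// lee_fin powR_ge0.
apply: (le_lt_trans (rhoD p1 pq mcU meV)).
rewrite lte_mul_pinfty ?lee_fin ?powR_ge0//; apply: lte_add_pinfty; exact: h.
Qed.

Lemma kinetic_conv l (U V : EV) : 0 < l < 1 -> measurable_fun setT U -> measurable_fun setT V ->
  (rho p q U < +oo)%E -> (rho p q V < +oo)%E ->
  rint leb (fun x => convdef phi l (U x) (V x)) /\
  kinetic (fun x => (1 - l) *: U x + l *: V x) =
  (1 - l) * kinetic U + l * kinetic V - \int[leb]_x convdef phi l (U x) (V x).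
Proof.
move=> l01 mU mV Uf Vf.
have mZ : measurable_fun setT (fun x => (1 - l) *: U x + l *: V x).
  by apply: measurable_rVD; exact: measurable_rVZ.
have iU := rint_kinetic mU Uf; have iV := rint_kinetic mV Vf.
have iZ := rint_kinetic mZ (rho_conv_finite (1 - l) l mU mV Uf Vf).
have iUV := rintD (rintZ (1 - l) iU) (rintZ l iV).
split; first exact: (rintB iUV iZ).
rewrite /convdef /kinetic (RintegralB measurableT iUV iZ).
rewrite (RintegralD measurableT (rintZ (1 - l) iU) (rintZ l iV)).
rewrite (RintegralZl _ measurableT iU) (RintegralZl _ measurableT iV).
by rewrite subKr.
Qed.

Section completion.
Variables (W : completeNormedModType R) (i : E0 -> W).
Hypothesis HW : is_completion Drad (norm_W a p q) i.
Local Notation J := (J a p q phi g i).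

Lemma J_represents x uU : represents a p q i x uU ->
  J x = 2^-1 * kinetic uU.2 - \int[leb]_x primitive g (uU.1 x).
Proof.
move=> ru; have rr := repP N2 p1 pq a1 HW x.
have [m1 m2 _] := represents_wpair N2 p1 pq a1 ru.
have [n1 n2 _] := represents_wpair N2 p1 pq a1 rr.
have [e1 e2] := represents_unique N2 p1 pq a1 HW rr ru.
have k1 : kinetic (rep a p q i x).2 = kinetic uU.2.
  apply: eq_Rint_ae; [exact: (measurable_kinetic n2)|exact: measurable_kinetic|].
  by apply: filterS e2 => t ->.
have k2 : \int[leb]_t primitive g ((rep a p q i x).1 t) = \int[leb]_t primitive g (uU.1 t).
  apply: eq_Rint_ae; [exact: measurable_primitive|exact: measurable_primitive|].
  by apply: filterS e1 => t ->.
by rewrite -k1 -k2.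
Qed.

Lemma represents_zero : represents a p q i 0 (fun=> 0, fun=> 0).
Proof.
have rr := repP N2 p1 pq a1 HW 0.
have := represents_lin N2 p1 pq a1 HW (-1) rr rr.
rewrite scaleN1r addNr; congr (represents _ _ _ _ _ (_, _)); apply/funext => t.
  by rewrite mulN1r addNr.
by rewrite scaleN1r addNr.
Qed.

Let lcvg (l : R) : l / n.+1%:R @[n --> \oo] --> (0 : R).
Proof.
by rewrite -[X in _ --> X](mulr0 l); apply: cvgM; [exact: cvg_cst|exact: cvg_harmonic].
Qed.

(** In the direction y - x the difference quotients of the convex kinetic term increase
with the step, so the quotient for the step l bounds the derivative from above; the
defect is what convexity loses at that step.  The derivative of the nonlinear term is
given by primitive_dquot. *)
Lemma functional_convex_ineq l x y uU vV : 0 < l < 1 -> differentiable J x ->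
  represents a p q i x uU -> represents a p q i y vV ->
  (\int[leb]_t convdef phi l (uU.2 t) (vV.2 t)) / (2 * l) <=
  kinetic vV.2 / 2 - kinetic uU.2 / 2 - \int[leb]_t (g (uU.1 t) * vV.1 t)
  + \int[leb]_t (g (uU.1 t) * uU.1 t) - 'd J x (y - x).
Proof.
have arith (A B E F G H : R) : H <= 2^-1 * (A - B - E) - (F - G) ->
    2^-1 * E <= A / 2 - B / 2 - F + G - H by lra.
have arith' (A B E th : R) : 0 <= E ->
    (1 - th) * B + th * A - E - B <= th * A - th * B by lra.
move=> l01 dJ ru rv; have /andP[l0 l1] := l01.
have wu := represents_wpair N2 p1 pq a1 ru; have wv := represents_wpair N2 p1 pq a1 rv.
have [mu mU _] := wu; have [mv mV _] := wv.
have [_ Uf] := wpair_finite N2 p1 pq a1 wu; have [_ Vf] := wpair_finite N2 p1 pq a1 wv.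
have bu := wpair_bipow wu; have bv := wpair_bipow wv.
pose w t := - 1 * uU.1 t + vV.1 t.
pose Z t := - 1 *: uU.2 t + vV.2 t.
have rw : represents a p q i (y - x) (w, Z).
  by have := represents_lin N2 p1 pq a1 HW (-1) ru rv; rewrite scaleN1r addrC.
have bw : bipow_int p a w by exact: (bipow_int_lin a1 aP).
pose t n : R := l / n.+1%:R.
have t0 n : 0 < t n by rewrite divr_gt0.
have tl n : t n <= l by rewrite ler_pdivrMr// ler_peMr ?(ltW l0)// ler1n.
have t1 n : 0 < t n <= 1 by rewrite t0 (le_trans (tl n))// ltW.
have Jt n : J (t n *: (y - x) + x) = 2^-1 * kinetic (fun s => t n *: Z s + uU.2 s) -
    \int[leb]_s primitive g (t n * w s + uU.1 s).
  exact: (J_represents (represents_lin N2 p1 pq a1 HW (t n) rw ru)).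
have c1 : (t n)^-1 * (J (t n *: (y - x) + x) - J x) @[n --> \oo] --> ('d J x (y - x) : R).
  by apply: diff_sequence; [exact: dJ|move=> n; rewrite gt_eqF|exact: lcvg].
have c2 := primitive_dquot a1 aP cg G2 GC bu bw t1 (lcvg l).
pose D := \int[leb]_s convdef phi l (uU.2 s) (vV.2 s).
have [iD kE] := kinetic_conv l01 mU mV Uf Vf.
have kin n : (t n)^-1 * (kinetic (fun s => t n *: Z s + uU.2 s) - kinetic uU.2) <=
    kinetic vV.2 - kinetic uU.2 - D / l.
  pose Y s := (1 - l) *: uU.2 s + l *: vV.2 s.
  have mY : measurable_fun setT Y by apply: measurable_rVD; exact: measurable_rVZ.
  have Yf : (rho p q Y < +oo)%E by exact: rho_conv_finite.
  have -> : kinetic vV.2 - kinetic uU.2 - D / l = (kinetic Y - kinetic uU.2) / l.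
    by rewrite kE -/D; field; rewrite gt_eqF.
  have [nl|nl] := eqVneq (t n) l.
    have -> : (fun s => t n *: Z s + uU.2 s) = Y.
      by apply/funext => s; apply/rowP => j; rewrite !mxE nl; ring.
    by rewrite nl mulrC.
  (* t n <= l is a fraction of the step l, so the point lies between U and Y *)
  pose th := t n / l.
  have th01 : 0 < th < 1.
    by rewrite /th divr_gt0//= ltr_pdivrMr// mul1r lt_neqAle nl tl.
  have [iE kE'] := kinetic_conv th01 mU mY Uf Yf.
  have -> : (fun s => t n *: Z s + uU.2 s) = (fun s => (1 - th) *: uU.2 s + th *: Y s).
    apply/funext => s; apply/rowP => j; rewrite !mxE /th; field; exact: lt0r_neq0.
  rewrite kE' ler_pdivrMl//.
  have -> : t n * ((kinetic Y - kinetic uU.2) / l) = th * kinetic Y - th * kinetic uU.2.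
    by rewrite /th; field; rewrite gt_eqF.
  by apply: arith'; apply: Rintegral_ge0 => s _; exact: convdef_ge0.
have L : 'd J x (y - x) <= 2^-1 * (kinetic vV.2 - kinetic uU.2 - D / l) -
    \int[leb]_s (g (uU.1 s) * w s).
  have c3 : 2^-1 * (kinetic vV.2 - kinetic uU.2 - D / l) - (t n)^-1 *
      (\int[leb]_s primitive g (t n * w s + uU.1 s) - \int[leb]_s primitive g (uU.1 s))
      @[n --> \oo] --> 2^-1 * (kinetic vV.2 - kinetic uU.2 - D / l) -
    \int[leb]_s (g (uU.1 s) * w s).
    by apply: cvgB; [exact: cvg_cst|exact: c2].
  apply: (ler_cvg_to c1 c3); apply: nearW => n.
  rewrite Jt (J_represents ru).
  have := kin n; set A := kinetic _; set B := kinetic _; set E := kinetic _.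
  set F := \int[leb]_s _; set G := \int[leb]_s _; set T := (t n)^-1.
  have -> : T * (2^-1 * A - F - (2^-1 * B - G)) = 2^-1 * (T * (A - B)) - T * (F - G) by ring.
  by move=> h; rewrite lerD2r ler_pM2l// invr_gt0.
have wE : \int[leb]_s (g (uU.1 s) * w s) =
    \int[leb]_s (g (uU.1 s) * vV.1 s) - \int[leb]_s (g (uU.1 s) * uU.1 s).
  rewrite -RintegralB//; [|exact: (rint_nonlin a1 aP cg G2 GC bu bv)
    |exact: (rint_nonlin a1 aP cg G2 GC bu bu)].
  by apply: eq_Rintegral => s _; rewrite /w; ring.
have -> : D / (2 * l) = 2^-1 * (D / l) by field; rewrite gt_eqF.
by apply: arith; rewrite -wE.
Qed.

End completion.
End functional.

(** * Compactness of sequences satisfying the convexity inequality *)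

Section compactness.
Context {R : realType} (N : nat) (p q a m : R) (phi g : R -> R).
Local Notation P := (crit_exp N p).
Local Notation leb := (@lebesgueN R N).
Local Notation E0 := ('rV[R]_N -> R).
Local Notation EV := ('rV[R]_N -> 'rV[R]_N).
Hypotheses (N2 : (2 <= N)%N) (p1 : 1 < p) (pq : p < q) (qN : q < N%:R) (a1 : 1 < a).
Hypothesis aq : a <= crit_exp N p * conj_exp q / conj_exp p.
Hypotheses (C1 : C1_Rplus phi) (F1 : Phi1 phi) (F2 : Phi2 p q phi) (F3 : Phi3 p q phi)
  (F4 : Phi4 phi).
Hypotheses (cg : continuous g) (G2 : g2_hyp N p a m g) (GC : g_convention N p a m g).
Let aP : a < P := exp_lt_crit N2 p1 pq qN aq.
Let P0 : 0 < P := crit_exp_gt0 N2 p1 pq qN.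
Let p0 : 0 < p. Proof. exact: lt_trans ltr01 p1. Qed.
Let q0 : 0 < q. Proof. exact: lt_trans p0 pq. Qed.
Let a0 : 0 < a. Proof. exact: lt_trans ltr01 a1. Qed.
Let m0 : 0 < m. Proof. by case: G2. Qed.
Let N0 : (0 < N)%N. Proof. exact: leq_trans N2. Qed.
Let kinetic := (@kinetic R N phi).
Local Notation bipow := (@bipow R N p a).

Variables (l : R) (Cc : R).
Hypothesis l01 : 0 < l < 1.
Hypothesis Cc0 : 0 < Cc.
Hypothesis coer : forall x y : 'rV[R]_N,
  hpq p q (enorm y) <= Cc * (convdef phi l x y + hpq p q (enorm x)).

Variables (u : nat -> E0) (U : nat -> EV) (v : E0) (M ell : R) (e : nat -> R).
Hypotheses (M0 : 0 <= M) (wu : forall n, wpair p q a (u n, U n)).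
Hypotheses (UM : forall n, (rho p q (U n) <= M%:E)%E) (uM : forall n, (powint a (u n) <= M%:E)%E).
Hypotheses (mv : measurable_fun setT v) (uv : {ae leb, forall x, u n x @[n --> \oo] --> v x}).
Hypotheses (kl : kinetic (U n) @[n --> \oo] --> ell) (e0 : e n @[n --> \oo] --> 0).
Local Notation D n k := (\int[leb]_x convdef phi l (U n x) (U k x)).
Hypothesis main : forall n k, D n k / (2 * l) <=
  kinetic (U k) / 2 - kinetic (U n) / 2 - \int[leb]_x (g (u n x) * u k x)
  + \int[leb]_x (g (u n x) * u n x) + e n.

Let mu_ n : measurable_fun setT (u n). Proof. by case: (wu n). Qed.
Let mU n : measurable_fun setT (U n). Proof. by case: (wu n). Qed.
Let bu n : bipow_int p a (u n).
Proof. exact: (wpair_bipow N2 p1 pq qN a1 aq (wu n)). Qed.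
Let Ufin n : (rho p q (U n) < +oo)%E.
Proof. by apply: (le_lt_trans (UM n)); rewrite ltry. Qed.

Let bipow_bound : exists2 K, 0 <= K & (forall n, \int[leb]_x bipow (u n x) <= K) /\
  bipow_int p a v /\ \int[leb]_x bipow (v x) <= K.
Proof.
have [K K0 HK] := wpair_sobolev N2 p1 pq qN a1 aq M0 ltr01.
have H n : (\int[leb]_x (bipow (u n x))%:E <= (M + (M + K))%:E)%E.
  rewrite /bipow intD; [|exact: measurable_normpow|exact: measurable_normpow
    |by move=> x; exact: powR_ge0|by move=> x; exact: powR_ge0].
  rewrite EFinD; apply: leeD; first exact: uM.
  have h := HK _ (wu n) (UM n); apply: (le_trans h).
  by rewrite mul1e EFinD; apply: leeD; [exact: uM|exact: lexx].
have Hv : (\int[leb]_x (bipow (v x))%:E <= (M + (M + K))%:E)%E.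
  apply: (@fatou_le _ _ _ leb (fun n x => bipow (u n x))).
  - by move=> n; exact: measurable_bipow.
  - exact: measurable_bipow.
  - by move=> n x; exact: bipow_ge0.
  - by move=> x; exact: bipow_ge0.
  - apply: filterS uv => x ux.
    have ca : continuous (fun y : R => `|y| `^ a) by exact: continuous_normpow.
    have cP : continuous (fun y : R => `|y| `^ P) by exact: continuous_normpow.
    by apply: cvgD; [exact: (cvg_comp _ _ ux (ca _))|exact: (cvg_comp _ _ ux (cP _))].
  - by apply: nearW => n; exact: H.
have bv : bipow_int p a v.
  split=> //; apply: rint_ge0; [exact: measurable_bipow|by move=> x; exact: bipow_ge0|].
  by apply: (le_lt_trans Hv); rewrite ltry.
exists (M + (M + K)); first by rewrite !addr_ge0.
split; last by split => //; have [_ iv] := bv; rewrite -lee_fin -(RintE iv); exact: Hv.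
by move=> n; have [_ iu] := bu n; rewrite -lee_fin -(RintE iu); exact: H.
Qed.

Let bv : bipow_int p a v.
Proof. by have [K _ [_ []]] := bipow_bound. Qed.

(** u_k - v is only bounded in the powers a and p*: the Young inequality is used with a
small constant in front of it. *)
Let cvg_cross n : \int[leb]_x (g (u n x) * u k x) @[k --> \oo] --> \int[leb]_x (g (u n x) * v x).
Proof.
have [K K0 [Ku [_ Kv]]] := bipow_bound.
apply: (@Rint_cvg_dom _ _ _ leb).
- by move=> k; exact: (rint_nonlin a1 aP cg G2 GC (bu n) (bu k)).
- exact: (rint_nonlin a1 aP cg G2 GC (bu n) bv).
- by apply: filterS uv => x ux; apply: cvgM; [exact: cvg_cst|exact: ux].
move=> c c0; pose Q := 2 `^ a + 2 `^ P.
have Q0 : 0 <= Q by rewrite addr_ge0 ?powR_ge0.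
pose Z := Q * (bipow (- 1) * K + K).
have Z0 : 0 <= Z by rewrite mulr_ge0// addr_ge0// mulr_ge0// bipow_ge0.
have c'0 : 0 < c / (Z + 1) by rewrite divr_gt0// ltr_wpDl.
have [C C0 HC] := nonlin_prod' a1 aP cg G2 GC c'0.
have bd k : bipow_int p a (fun x => - 1 * v x + u k x) by exact: (bipow_int_lin a1 aP).
have bdi k : \int[leb]_x bipow (- 1 * v x + u k x) <= Z.
  have i1 : rint leb (fun x => bipow (v x)) by case: bv.
  have i2 : rint leb (fun x => bipow (u k x)) by case: (bu k).
  have i3 : rint leb (fun x => bipow (- 1) * bipow (v x) + bipow (u k x)) by exact: rint_lin.
  apply: (@le_trans _ _ (\int[leb]_x (Q * (bipow (- 1) * bipow (v x) + bipow (u k x))))).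
    apply: le_Rintegral => //; [by case: (bd k)|exact: rintZ|].
    move=> x _; apply: (le_trans (bipow_add a1 aP _ _)).
    by rewrite ler_wpM2l// lerD2r; exact: bipow_scale.
  rewrite (RintegralZl _ measurableT i3) (Rint_lin _ i1 i2).
  apply: (ler_wpM2l Q0); apply: lerD; last exact: Ku.
  by apply: ler_wpM2l; [exact: bipow_ge0|exact: Kv].
exists (fun k x => c / (Z + 1) * bipow (- 1 * v x + u k x)), (fun x => C * bipow (u n x)); split.
- by move=> k; apply: rintZ; case: (bd k).
- by apply: rintZ; case: (bu n).
- by move=> k x; rewrite mulr_ge0 ?bipow_ge0// ltW.
- by move=> x; rewrite mulr_ge0 ?bipow_ge0.
split=> [k x|k].
  rewrite [leRHS]addrC; apply: (le_trans _ (HC (u n x) (- 1 * v x + u k x))).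
  by rewrite -mulrBr mulN1r [- v x + _]addrC.
rewrite RintegralZl//; last by case: (bd k).
apply: (@le_trans _ _ (c / (Z + 1) * Z)); first by rewrite ler_wpM2l// ltW.
by rewrite mulrAC ler_pdivrMr ?ltr_wpDl// ler_pM2l// lerDl.
Qed.

Let cvg_diag : \int[leb]_x (g (u n x) * v x) @[n --> \oo] --> \int[leb]_x (g (v x) * v x).
Proof.
have [K K0 [Ku _]] := bipow_bound.
have iv := rint_nonlin a1 aP cg G2 GC bv bv.
apply: (@Rint_cvg_dom _ _ _ leb).
- by move=> n; exact: (rint_nonlin a1 aP cg G2 GC (bu n) bv).
- exact: iv.
- apply: filterS uv => x ux; apply: cvgM; last exact: cvg_cst.
  exact: (cvg_comp _ _ ux (@cg (v x))).
move=> c c0.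
have c'0 : 0 < c / (K + 1) by rewrite divr_gt0// ltr_wpDl.
have [C C0 HC] := nonlin_prod a1 aP cg G2 GC c'0.
exists (fun n x => c / (K + 1) * bipow (u n x)),
  (fun x => C * bipow (v x) + `|g (v x) * v x|); split.
- by move=> n; apply: rintZ; case: (bu n).
- by apply: rint_lin; [case: bv|exact: rint_norm].
- by move=> n x; rewrite mulr_ge0 ?bipow_ge0// ltW.
- by move=> x; rewrite addr_ge0// mulr_ge0 ?bipow_ge0.
split=> [n x|n].
  by apply: (le_trans (ler_normB _ _)); rewrite addrA lerD2r.
rewrite RintegralZl//; last by case: (bu n).
apply: (@le_trans _ _ (c / (K + 1) * K)); first by rewrite ler_wpM2l// ltW.
by rewrite mulrAC ler_pdivrMr ?ltr_wpDl// ler_pM2l// lerDl.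
Qed.

Let S (w : E0) := \int[leb]_x (g (w x) * w x).

(** Fatou lemma for W_n = kap (- g(u_n) u_n + b |u_n|^p* + C chi) + 2^a |v|^a - |u_n - v|^a.
By decay |u_n| < s0 off a fixed ball, whose indicator is chi, so that nonlin_coercive
makes W_n nonnegative.  The outcome contains both the semicontinuity of the integral of
- g(u) u and the control of |u_n - v|^a by its gap. *)
Let fatou_gap : exists2 kap, 0 < kap & forall eta, 0 < eta -> \forall n \near \oo,
  \int[leb]_x (`|u n x - v x| `^ a) + kap * S (u n) <= kap * S v + eta.
Proof.
have arith (k s s' z1 z2 z5 z6 F t : R) : z1 <= t / 2 -> 0 <= z2 ->
  - k * s + (z2 + (z6 + z5)) <= - k * s' + (z1 + (z6 + (- 1 * F + z5))) + t / 2 ->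
  F + k * s' <= k * s + t by move=> h1 h2; rewrite !mulNr; lra.
have [K K0 [Ku _]] := bipow_bound.
have [s0 s00 Hs] := nonlin_coercive a1 aP cg G2 GC.
pose kap := 2 `^ a * (2 / m).
have kap0 : 0 < kap by rewrite mulr_gt0 ?powR_gt0// divr_gt0.
exists kap => // eta eta0.
have eta2 : 0 < eta / 2 by rewrite divr_gt0.
(* kap b times the bound K of the p*-integrals is at most eta/2 *)
pose b := eta / 2 / (kap * (K + 1)).
have kK : 0 < kap * (K + 1) by rewrite mulr_gt0// ltr_wpDl.
have b0 : 0 < b by rewrite divr_gt0.
have [C C0 HC] := Hs _ b0.
have [K1 K10 HK1] := wpair_decay N2 p1 pq qN a1 aq M0.
pose t := sob_exp N p.
have t0 : 0 < t by exact: lt_trans ltr01 (sob_exp_gt1 N2 p1 pq qN).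
have st0 : 0 < s0 `^ t by exact: powR_gt0.
(* |u_n x| >= s0 forces |x| <= r by decay *)
pose r := Num.max 1 (K1 / s0 `^ t).
have r1 : 1 <= r by rewrite le_max lexx.
have r0 : 0 < r by exact: lt_le_trans r1.
pose B := [set x : 'rV[R]_N | enorm x <= r].
have mB : measurable B by exact: measurable_enorm_ball.
pose chi x : R := \1_B x.
have ichi : rint leb chi.
  apply: rint_ge0.
  - by apply: measurable_indic.
  - by move=> x; rewrite /chi indicE.
  - have lB : (leb B < +oo)%E by rewrite (leb_ball r0) ltry.
    by rewrite /chi integral_indic// setIT.
have out : {ae leb, forall x, forall n, s0 <= `|u n x| -> chi x = 1}.
  apply: ae_foralln => n; apply: filterS (HK1 _ (wu n) (UM n) (uM n)) => x /= Hx sx.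
  rewrite /chi indicE mem_set//= /B/= leNgt; apply/negP => rx.
  have x1 : 1 <= enorm x by exact: le_trans r1 (ltW rx).
  have h1 : enorm x <= enorm x ^+ N.-1.
    by rewrite -{1}(expr1 (enorm x)) ler_weXn2l// -ltnS prednK.
  have h2 : s0 `^ t <= `|u n x| `^ t.
    by apply: ge0_ler_powR; rewrite ?nnegrE// ltW.
  have h3 : K1 < s0 `^ t * enorm x.
    rewrite mulrC -ltr_pdivrMr//; apply: le_lt_trans rx.
    by rewrite le_max lexx orbT.
  have : s0 `^ t * enorm x <= `|u n x| `^ t * enorm x ^+ N.-1.
    by apply: ler_pM => //; [exact: powR_ge0|exact: enorm_ge0].
  by move=> h4; move: (lt_le_trans h3 (le_trans h4 Hx)); rewrite ltxx.
have iP (w : E0) : bipow_int p a w -> rint leb (fun x => `|w x| `^ P).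
  move=> [mw iw]; apply: (rint_le _ _ iw); first exact: measurable_normpow.
  by move=> x; rewrite ger0_norm ?powR_ge0// /bipow lerDr powR_ge0.
have ia (w : E0) : bipow_int p a w -> rint leb (fun x => `|w x| `^ a).
  move=> [mw iw]; apply: (rint_le _ _ iw); first exact: measurable_normpow.
  by move=> x; rewrite ger0_norm ?powR_ge0// /bipow lerDl powR_ge0.
have iF n : rint leb (fun x => `|u n x - v x| `^ a).
  have := ia _ (bipow_int_lin a1 aP (-1) bv (bu n)).
  by under eq_fun do rewrite mulN1r addrC.
pose h x := 2 `^ a * `|v x| `^ a.
have ih : rint leb h by apply: rintZ; exact: ia.
have ig (w : E0) : bipow_int p a w -> rint leb (fun x => g (w x) * w x).
  by move=> bw; exact: (rint_nonlin a1 aP cg G2 GC bw bw).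
pose W n x := - kap * (g (u n x) * u n x) + (kap * b * `|u n x| `^ P +
  (kap * C * chi x + (- 1 * `|u n x - v x| `^ a + h x))).
pose W0 x := - kap * (g (v x) * v x) + (kap * b * `|v x| `^ P + (kap * C * chi x + h x)).
have iW n : rint leb (W n).
  by apply: rint_lin; [exact: ig|apply: rint_lin; [exact: iP|do 2 apply: rint_lin => //]].
have iW0 : rint leb W0.
  by apply: rint_lin; [exact: ig|apply: rint_lin; [exact: iP|exact: rint_lin]].
have IW n : \int[leb]_x W n x = - kap * S (u n) + (kap * b * \int[leb]_x (`|u n x| `^ P) +
   (kap * C * \int[leb]_x chi x + (- 1 * \int[leb]_x (`|u n x - v x| `^ a) + \int[leb]_x h x))).
  have j1 : rint leb (fun x => - 1 * `|u n x - v x| `^ a + h x) by exact: rint_lin.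
  have j2 := rint_lin (kap * C) ichi j1.
  have j3 := rint_lin (kap * b) (iP _ (bu n)) j2.
  by rewrite (Rint_lin _ (ig _ (bu n)) j3) (Rint_lin _ (iP _ (bu n)) j2) (Rint_lin _ ichi j1)
    (Rint_lin _ (iF n) ih).
have IW0 : \int[leb]_x W0 x = - kap * S v + (kap * b * \int[leb]_x (`|v x| `^ P) +
   (kap * C * \int[leb]_x chi x + \int[leb]_x h x)).
  have j2 := rint_lin (kap * C) ichi ih.
  have j3 := rint_lin (kap * b) (iP _ bv) j2.
  by rewrite (Rint_lin _ (ig _ bv) j3) (Rint_lin _ (iP _ bv) j2) (Rint_lin _ ichi ih).
have Wpos n : {ae leb, forall x, 0 <= W n x}.
  apply: filterS out => x ox.
  have h1 := HC (u n x).
  have h2 : `|u n x - v x| `^ a <= 2 `^ a * (`|u n x| `^ a + `|v x| `^ a).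
    apply: (le_trans _ (powR_addl_le a0 (normr_ge0 _) (normr_ge0 _))).
    by apply: ge0_ler_powR; rewrite ?nnegrE ?addr_ge0 ?(ltW a0)// ler_normB.
  have h3 : (if s0 <= `|u n x| then 1 else 0) <= chi x.
    by case: ifP => [/(ox n) ->//|_]; rewrite /chi indicE.
  have h4 : kap * (m / 2 * `|u n x| `^ a) <= kap * (- (g (u n x) * u n x) + b * `|u n x| `^ P + C * chi x).
    by rewrite ler_pM2l//; apply: (le_trans h1); rewrite lerD2l ler_wpM2l.
  have h5 : kap * (m / 2 * `|u n x| `^ a) = 2 `^ a * `|u n x| `^ a.
    by rewrite /kap; field; rewrite gt_eqF.
  rewrite h5 in h4; rewrite /W /h.
  move: h2 h4; move: (`|u n x - v x| `^ a) (2 `^ a) (`|u n x| `^ a) (`|v x| `^ a) (g _ * _) (`|_| `^ P) (chi x).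
  by move=> z1 z2 z3 z4 z5 z6 z7 h2 h4; rewrite mulrDr in h2; lra.
have Wcv : {ae leb, forall x, W n x @[n --> \oo] --> W0 x}.
  apply: filterS uv => x ux.
  have ca : continuous (fun y : R => `|y| `^ a) by exact: continuous_normpow.
  have cP : continuous (fun y : R => `|y| `^ P) by exact: continuous_normpow.
  have d0 : `|u n x - v x| `^ a @[n --> \oo] --> 0.
    apply: (cvg_normpow0 a0); rewrite -(subrr (v x)); apply: cvgB => //; exact: cvg_cst.
  have -> : W0 x = - kap * (g (v x) * v x) + (kap * b * `|v x| `^ P +
    (kap * C * chi x + (- 1 * 0 + h x))) by rewrite /W0 mulr0 add0r.
  apply: cvgD; first (apply: cvgM; [exact: cvg_cst|]).
    by apply: cvgM => //; exact: (cvg_comp _ _ ux (@cg (v x))).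
  apply: cvgD; first (apply: cvgM; [exact: cvg_cst|exact: (cvg_comp _ _ ux (cP _))]).
  apply: cvgD; first exact: cvg_cst.
  apply: cvgD; last exact: cvg_cst.
  by apply: cvgM; [exact: cvg_cst|exact: d0].
have := fatou_eventually iW iW0 Wpos Wcv eta2; apply: filterS => n.
rewrite IW IW0.
have Pn : \int[leb]_x (`|u n x| `^ P) <= K.
  apply: (le_trans _ (Ku n)); apply: le_Rintegral => //; [exact: iP|by case: (bu n)|].
  by move=> x _; rewrite /bipow lerDr powR_ge0.
have P0' : 0 <= \int[leb]_x (`|v x| `^ P) by apply: Rintegral_ge0 => x _; exact: powR_ge0.
have kb : kap * b * \int[leb]_x (`|u n x| `^ P) <= eta / 2.
  apply: (@le_trans _ _ (kap * b * (K + 1))).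
    apply: ler_wpM2l; first by rewrite mulr_ge0// ltW.
    by apply: (le_trans Pn); rewrite lerDl.
  have -> : kap * b * (K + 1) = eta / 2 by rewrite /b; field; rewrite !gt_eqF// ltr_wpDl.
  exact: lexx.
have kb0 : 0 <= kap * b * \int[leb]_x (`|v x| `^ P).
  by apply: mulr_ge0 => //; apply: mulr_ge0; exact: ltW.
exact: (arith _ _ _ _ _ _ _ _ _ kb kb0).
Qed.

Let D0 n k : 0 <= D n k.
Proof. by apply: Rintegral_ge0 => x _; exact: convdef_ge0. Qed.

Let l0 : 0 < 2 * l.
Proof. by rewrite mulr_gt0//; case/andP: l01. Qed.

(** k tends to infinity first, then n: S (u n) is the only term without a known limit. *)
Let main_limit eta : 0 < eta -> \forall n \near \oo, \forall k \near \oo,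
  D n k / (2 * l) <= S (u n) - S v + eta.
Proof.
move=> eta0; have eta4 : 0 < eta / 4 by rewrite divr_gt0.
have /cvgrPdist_le/(_ _ eta4) k1 := kl; have /cvgrPdist_le/(_ _ eta4) h1 := e0.
have /cvgrPdist_le/(_ _ eta4) h2 := cvg_diag.
near=> n.
have a1' : `|ell - kinetic (U n)| <= eta / 4 by near: n.
have a2 : `|0 - e n| <= eta / 4 by near: n.
have a3 : `|S v - \int[leb]_x (g (u n x) * v x)| <= eta / 4 by near: n.
have /cvgrPdist_le/(_ _ eta4) h3 := @cvg_cross n.
near=> k.
have a4 : `|ell - kinetic (U k)| <= eta / 4 by near: k.
have a5 : `|\int[leb]_x (g (u n x) * v x) - \int[leb]_x (g (u n x) * u k x)| <= eta / 4 by near: k.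
apply: (le_trans (main n k)).
move: a1' a2 a3 a4 a5; rewrite !ler_norml -/(S (u n)).
move: (kinetic (U n)) (kinetic (U k)) (S (u n)) (S v) (e n) (\int[leb]_x (g (u n x) * v x))
  (\int[leb]_x (g (u n x) * u k x)) => z1 z2 z3 z4 z5 z6 z7.
move=> /andP[b1 b1'] /andP[b2 b2'] /andP[b3 b3'] /andP[b4 b4'] /andP[b5 b5'].
by lra.
Unshelve. all: by end_near. Qed.

Let S_lower eta : 0 < eta -> \forall n \near \oo, S v - S (u n) <= eta.
Proof.
move=> eta0; apply: filterS (main_limit eta0) => n [k _ /(_ k (leqnn k)) H].
have h : 0 <= D n k / (2 * l) by rewrite divr_ge0// ltW.
by have := le_trans h H; move: (S v) (S (u n)) => z1 z2; lra.
Qed.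

Let L_a_cvg eta : 0 < eta -> \forall n \near \oo,
  (powint a (fun x => u n x - v x)%R <= eta%:E)%E.
Proof.
move=> eta0; have [kap kap0 H] := fatou_gap.
have k1 : 0 < eta / (kap + 1) by rewrite divr_gt0// addr_gt0.
apply: filterS2 (H _ k1) (S_lower k1) => n h1 h2.
have iF : rint leb (fun x => `|u n x - v x| `^ a).
  have [mw iw] := bipow_int_lin a1 aP (-1) bv (bu n).
  have E : (fun x => - 1 * v x + u n x) = (fun x => u n x - v x).
    by apply/funext => x; rewrite mulN1r addrC.
  rewrite E in mw; have iw' : rint leb (fun x => bipow (u n x - v x)).
    by move: iw; under eq_fun do rewrite mulN1r addrC.
  apply: (rint_le _ _ iw'); first exact: measurable_normpow.
  by move=> x; rewrite ger0_norm ?powR_ge0// /bipow lerDl powR_ge0.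
rewrite /powint (RintE iF) lee_fin.
have h3 : kap * (S v - S (u n)) <= kap * (eta / (kap + 1)) by rewrite ler_pM2l.
have E : kap * (eta / (kap + 1)) + eta / (kap + 1) = eta by field; rewrite gt_eqF// addr_gt0.
rewrite -[leRHS]E; move: h1 h3; move: (\int[leb]_x _) (S v) (S (u n)) (eta / _) => z1 z2 z3 z4.
by rewrite mulrBr; lra.
Qed.

Let defect_small eta : 0 < eta -> \forall n \near \oo, \forall k \near \oo,
  (\int[leb]_x (convdef phi l (U n x) (U k x))%:E <= eta%:E)%E.
Proof.
move=> eta0; have [kap kap0 H] := fatou_gap.
have [c c0 cE] : exists2 c, 0 < c & (c / kap + c) * (2 * l) = eta.
  exists (eta / (2 * l) / (kap^-1 + 1)); first by rewrite !divr_gt0// addr_gt0// invr_gt0.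
  have k1 : kap^-1 + 1 != 0 by rewrite gt_eqF// addr_gt0// invr_gt0.
  have l1 : l != 0 by case/andP: l01 => /gt_eqF ->.
  have -> (x : R) : x / kap + x = x * (kap^-1 + 1) by rewrite mulrDr mulr1.
  by rewrite divfK// divfK// mulf_neq0// pnatr_eq0.
apply: filterS2 (H _ c0) (main_limit c0) => n h1; apply: filterS => k h2.
have [iD _] := kinetic_conv p1 pq C1 F1 F3 l01 (mU n) (mU k) (Ufin n) (Ufin k).
rewrite (RintE iD) lee_fin.
have F0 : 0 <= \int[leb]_x (`|u n x - v x| `^ a).
  by apply: Rintegral_ge0 => x _; exact: powR_ge0.
have h3 : S (u n) - S v <= c / kap.
  rewrite ler_pdivlMr// mulrBl; move: h1 F0.
  by rewrite ![_ * kap]mulrC; move: (\int[leb]_x _) (kap * S _) (kap * S _) => z1 z2 z3; lra.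
rewrite -cE -ler_pdivrMr//; apply: (le_trans h2).
by rewrite lerD2r.
Qed.

(** Off two small sets U_n0 and U_k are bounded by h; there, by convdef_gap, a distance at
least c/2 costs a defect at least gam, and Markov inequality bounds the measure of the
set where this happens. *)
Let cauchy_measure : exists s, extraction s /\
  {ae leb, forall x, cvg (U (s n) x @[n --> \oo])}.
Proof.
apply: cauchy_in_measure_subseq => c c0.
have c4 : 0 < c / 4 by rewrite divr_gt0.
have [h [hh h0 hm]] : exists h : R, [/\ 1 <= h, 0 < hpq p q h & M / hpq p q h <= c / 8].
  pose h := Num.max 1 ((M / (c / 8)) `^ p^-1).
  have h1 : 1 <= h by rewrite le_max lexx.
  have hp0 : 0 < hpq p q h by apply: hpq_gt0; exact: lt_le_trans h1.
  exists h; split => //; rewrite ler_pdivrMr// mulrC -ler_pdivrMr ?divr_gt0//.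
  rewrite hpq_ge1//; apply: (@le_trans _ _ (((M / (c / 8)) `^ p^-1) `^ p)).
    by rewrite -powRrM mulVf ?gt_eqF// powRr1// !divr_ge0// ltW.
  apply: ge0_ler_powR; rewrite ?nnegrE ?powR_ge0 ?(ltW p0)//.
    exact: le_trans h1.
  by rewrite le_max lexx orbT.
have [gam gam0 Hg] := convdef_gap p1 pq C1 F1 F3 F4 N h l01 (divr_gt0 c0 (ltr0Sn _ 1)).
pose Bad n := [set x | hpq p q h <= hpq p q (enorm (U n x))].
pose Gap n k := [set x | gam <= convdef phi l (U n x) (U k x)].
have mle (f : 'rV[R]_N -> R) (b : R) : measurable_fun setT f -> measurable [set x | b <= f x].
  move=> mf; rewrite -[X in measurable X]setTI.
  exact: (measurable_fun_le measurableT (measurable_cst b) mf).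
have mBad n : measurable (Bad n) by apply: mle; exact: measurable_hpq_comp.
have mGap n k : measurable (Gap n k).
  by apply: mle; exact: (measurable_convdef p1 pq C1 F1 F3).
have bBad n : (leb (Bad n) <= (c / 8)%:E)%E.
  apply: (@le_trans _ _ (M / hpq p q h)%:E); last by rewrite lee_fin.
  by apply: markov_le; [exact: measurable_hpq_comp|move=> x; exact: hpq_ge0|exact: h0|exact: (UM n)].
have gc : 0 < gam * (c / 8) by rewrite mulr_gt0// divr_gt0.
have [n0 _ /(_ n0 (leqnn n0)) [k0 _ Hk]] := defect_small gc.
have bGap k : (k0 <= k)%N -> (leb (Gap n0 k) <= (c / 8)%:E)%E.
  move=> kk; have -> : c / 8 = gam * (c / 8) / gam by field; rewrite gt_eqF.
  apply: markov_le => //; [exact: (measurable_convdef p1 pq C1 F1 F3)| |exact: (Hk k kk)].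
  by move=> x; exact: convdef_ge0.
have close k x : ~ Bad k x -> ~ Bad n0 x -> ~ Gap n0 k x -> `|U n0 x - U k x| < c / 2.
  move=> b1 b2 b3; apply: (le_lt_trans (mx_norm_le_enorm _)).
  have Hb j : ~ Bad j x -> enorm (U j x) <= h.
    move=> bj; rewrite leNgt; apply/negP => H; apply: bj; rewrite /Bad/=.
    by apply: hpq_homo => //; [exact: le_trans hh|exact: ltW].
  rewrite ltNge; apply/negP => H; apply: b3; rewrite /Gap/=.
  by apply: Hg => //; exact: Hb.
exists k0 => k kk; exists ((Bad k `|` Bad k0) `|` (Bad n0 `|` (Gap n0 k `|` Gap n0 k0))); split.
- by apply: measurableU; [exact: measurableU|apply: measurableU => //; exact: measurableU].
- have sub A B (b1 b2 : R) : measurable A -> measurable B -> (leb A <= b1%:E)%E ->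
      (leb B <= b2%:E)%E -> (leb (A `|` B) <= (b1 + b2)%:E)%E.
    move=> mA mB hA hB; apply: (le_trans (measureU2 leb mA mB)).
    by rewrite EFinD; exact: leeD.
  have h1 := sub _ _ _ _ (mBad k) (mBad k0) (bBad k) (bBad k0).
  have h2 := sub _ _ _ _ (mGap n0 k) (mGap n0 k0) (bGap k kk) (bGap k0 (leqnn _)).
  have h3 := sub _ _ _ _ (mBad n0) (measurableU _ _ (mGap n0 k) (mGap n0 k0)) (bBad n0) h2.
  have h4 := sub _ _ _ _ (measurableU _ _ (mBad k) (mBad k0))
    (measurableU _ _ (mBad n0) (measurableU _ _ (mGap n0 k) (mGap n0 k0))) h1 h3.
  by apply: (le_trans h4); rewrite lee_fin; lra.
- move=> x /not_orP[/not_orP[b1 b2] /not_orP[b3 /not_orP[b4 b5]]].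
  have k1 := close k x b1 b3 b4; have k2 := close k0 x b2 b3 b5.
  have -> : U k x - U k0 x = (U n0 x - U k0 x) - (U n0 x - U k x).
    by rewrite [RHS]addrC opprB addrA subrK.
  by apply: (le_lt_trans (ler_normB _ _)); lra.
Qed.

(** For the gradients: convdef_coercive dominates h(|U_k - V|) by a multiple of the defect
between a fixed U_n and U_k, of small integral, plus a fixed integrable function. *)
Lemma palais_smale_compactness : exists s, extraction s /\ forall c : R, 0 < c ->
  exists n0, forall n k, (n0 <= n)%N -> (n0 <= k)%N ->
    (powint a (fun x => u (s n) x - u (s k) x)%R <= c%:E)%E /\
    (rho p q (fun x => U (s n) x - U (s k) x)%R <= c%:E)%E.
Proof.
have [s [si sc]] := cauchy_measure.
exists s; split => //.
pose V x : 'rV[R]_N := \row_i ae_lim (fun n x => U (s n) x ord0 i) x.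
have mcoord n i : measurable_fun setT (fun x => U n x ord0 i).
  by apply: (@measurableT_comp _ _ _ _ _ _ (fun y : 'rV[R]_N => y ord0 i)) => //; exact: measurable_rV_coord.
have mV : measurable_fun setT V.
  apply: measurable_fun_rV => i; under eq_fun do rewrite mxE.
  by apply: measurable_ae_lim => n; exact: mcoord.
have UV : {ae leb, forall x, enorm (U (s n) x - V x) @[n --> \oo] --> 0}.
  apply: filterS sc => x /cvg_ex[y Uy]; apply: cvg_enorm => i; rewrite mxE.
  apply: cvg_ae_lim; apply/cvg_ex; exists (y ord0 i).
  exact: (cvg_comp _ _ Uy (@coord_continuous _ _ _ ord0 i y)).
have Vf : (rho p q V <= M%:E)%E.
  apply: (@fatou_le _ _ _ leb (fun n x => hpq p q (enorm (U (s n) x)))).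
  - by move=> n; exact: measurable_hpq_comp.
  - exact: measurable_hpq_comp.
  - by move=> n x; exact: hpq_ge0.
  - by move=> x; exact: hpq_ge0.
  - apply: filterS UV => x Ux.
    have H : enorm (U (s n) x) @[n --> \oo] --> enorm (V x).
      apply/subr_cvg0; apply/norm_cvg0P.
      apply: (squeeze_cvgr _ (cvg_cst (0 : R)) Ux); apply: nearW => n.
      by rewrite normr_ge0 ler_dist_enorm.
    have cc : continuous (fun y : R => hpq p q `|y|) by exact: continuous_hpq_norm.
    have := cvg_comp _ _ H (cc (enorm (V x))).
    rewrite /= ger0_norm ?enorm_ge0//; apply: cvg_trans; apply: near_eq_cvg.
    by apply: nearW => n; rewrite /= ger0_norm// enorm_ge0.
  - by apply: nearW => n; exact: UM.
have Vfin : (rho p q V < +oo)%E by apply: (le_lt_trans Vf); rewrite ltry.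
have rho_small eta : 0 < eta -> \forall k \near \oo,
    (rho p q (fun x => U (s k) x - V x)%R <= eta%:E)%E.
  move=> eta0; pose Q : R := 2 `^ q.
  have Q0 : 0 < Q by rewrite powR_gt0.
  pose b := eta / 2 / (Q * Cc).
  have b0 : 0 < b by rewrite !divr_gt0// mulr_gt0.
  have [n _ /(_ n (leqnn n)) Hn] := defect_small b0.
  have ih := rint_hpq (mU n) (Ufin n); have iV := rint_hpq mV Vfin.
  pose Gk k x := Q * Cc * convdef phi l (U n x) (U (s k) x).
  pose h x := Q * Cc * hpq p q (enorm (U n x)) + Q * hpq p q (enorm (V x)).
  have ihh : rint leb h by apply: rint_lin => //; exact: rintZ.
  have QC : 0 <= Q * Cc by rewrite mulr_ge0// ltW.
  have eE : eta = eta / 2 + eta / 2 by lra.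
  suff : \forall k \near \oo,
      (rho p q (fun x => U (s k) x - V x)%R <= (eta / 2 + eta / 2)%:E)%E by rewrite -eE.
  apply: (@int_small_dominated _ _ _ leb (fun k x => hpq p q (enorm (U (s k) x - V x))) Gk h).
  - by move=> k; apply: measurable_hpq_comp; exact: measurable_rVB.
  - move=> k; apply: measurable_funM => //; exact: (measurable_convdef p1 pq C1 F1 F3).
  - exact: (rint_measurable ihh).
  - by move=> k x; exact: hpq_ge0.
  - by move=> k x; rewrite mulr_ge0//; exact: convdef_ge0.
  - by move=> x; rewrite addr_ge0 ?mulr_ge0 ?hpq_ge0// ltW.
  - by rewrite (RintE ihh) ltry.
  - by apply: filterS UV => x Ux; apply: cvg_hpq0 => // k; exact: enorm_ge0.
  - apply: aeW => x k.
    apply: (@le_trans _ _ (Q * (hpq p q (enorm (U (s k) x)) + hpq p q (enorm (V x))))).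
      apply: (le_trans _ (hpq_add p1 pq (enorm_ge0 _) (enorm_ge0 _))).
      by apply: hpq_homo => //; [exact: enorm_ge0|rewrite -(enormN (V x)); exact: ler_enormD].
    have := coer (U n x) (U (s k) x); rewrite /Gk /h -(ler_pM2l Q0).
    move: (hpq p q _) (hpq p q _) (hpq p q _) (convdef _ _ _ _) => z1 z2 z3 z4.
    by rewrite !mulrDr !mulrA; lra.
  - have [k1 _ Hk1] := Hn; exists k1 => [|k /= kk]; first exact: I.
    have Hk := Hk1 (s k) (leq_trans kk (extraction_ge k si)).
    rewrite /Gk intZ//; [|exact: (measurable_convdef p1 pq C1 F1 F3)
      |by move=> x; exact: convdef_ge0].
    apply: (@le_trans _ _ ((Q * Cc)%:E * b%:E)%E).
      by apply: lee_wpmul2l; [rewrite lee_fin|exact: Hk].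
    rewrite -EFinM lee_fin /b mulrC divfK// gt_eqF// mulr_gt0//.
  - by rewrite divr_gt0.
move=> c c0.
have ca : 0 < c / (2 `^ a * 2) by rewrite divr_gt0// mulr_gt0// powR_gt0.
have cq : 0 < c / (2 `^ q * 2) by rewrite divr_gt0// mulr_gt0// powR_gt0.
have [n1 _ H1] := L_a_cvg ca; have [n2 _ H2] := rho_small _ cq.
exists (maxn n1 n2) => n k; rewrite !geq_max => /andP[n1n n2n] /andP[n1k n2k]; split.
  have h1 := H1 (s n) (leq_trans n1n (extraction_ge n si)).
  have h2 := H1 (s k) (leq_trans n1k (extraction_ge k si)).
  have E : (fun x => u (s n) x - u (s k) x) = (fun x => (u (s n) x - v x) + - (u (s k) x - v x)).
    by apply/funext => x; rewrite opprB addrA subrK.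
  have m1 j : measurable_fun setT (fun x => u j x - v x) by exact: measurable_funB.
  rewrite E; apply: (le_trans (powintD a0 (m1 _) (measurableT_comp (@oppr_measurable R setT) (m1 _)))).
  rewrite /= powintN; apply: (@le_trans _ _ ((2 `^ a)%:E * ((c / (2 `^ a * 2))%:E + (c / (2 `^ a * 2))%:E))%E).
    by apply: lee_wpmul2l; [rewrite lee_fin powR_ge0|exact: (leeD h1 h2)].
  rewrite -EFinD -EFinM lee_fin le_eqVlt; apply/orP; left; apply/eqP.
  by field; rewrite gt_eqF// powR_gt0.
have h1 := H2 n n2n; have h2 := H2 k n2k.
have E : (fun x => U (s n) x - U (s k) x) = (fun x => (U (s n) x - V x) + - (U (s k) x - V x)).
  by apply/funext => x; rewrite opprB addrA subrK.
have m1 j : measurable_fun setT (fun x => U j x - V x) by exact: measurable_rVB.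
have m2 j : measurable_fun setT (fun x => - (U j x - V x)).
  by have := measurable_rVZ (-1) (m1 j); under eq_fun do rewrite scaleN1r.
rewrite E; apply: (le_trans (rhoD p1 pq (m1 _) (m2 _))).
rewrite rhoN; apply: (@le_trans _ _ ((2 `^ q)%:E * ((c / (2 `^ q * 2))%:E + (c / (2 `^ q * 2))%:E))%E).
  by apply: lee_wpmul2l; [rewrite lee_fin powR_ge0|exact: (leeD h1 h2)].
rewrite -EFinD -EFinM lee_fin le_eqVlt; apply/orP; left; apply/eqP.
by field; rewrite gt_eqF// powR_gt0.
Qed.

End compactness.

(** * The weak Palais-Smale condition *)

Lemma root_small {R : realType} (Q s c : R) : 0 < Q -> 0 < s -> 0 < c ->
  exists2 d, 0 < d & forall b, 0 <= b -> b <= d -> (Q * (b + b)) `^ s^-1 <= c.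
Proof.
move=> Q0 s0 c0; have cs : 0 < c `^ s by exact: powR_gt0.
exists (c `^ s / (2 * Q)); first by rewrite divr_gt0// mulr_gt0.
move=> b b0 bd; have -> : c = (c `^ s) `^ s^-1 by rewrite -powRrM mulfV ?gt_eqF// powRr1// ltW.
apply: ge0_ler_powR; rewrite ?nnegrE ?invr_ge0 ?(ltW s0) ?(ltW cs)//.
  by rewrite mulr_ge0 ?addr_ge0// ltW.
move: bd; rewrite ler_pdivlMr ?mulr_gt0//; lra.
Qed.

Section palais_smale.
Context {R : realType} (N : nat) (p q a m : R) (phi g : R -> R).
Local Notation P := (crit_exp N p).
Local Notation leb := (@lebesgueN R N).
Local Notation E0 := ('rV[R]_N -> R).
Local Notation EV := ('rV[R]_N -> 'rV[R]_N).
Hypotheses (N2 : (2 <= N)%N) (p1 : 1 < p) (pq : p < q) (qN : q < N%:R) (a1 : 1 < a).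
Hypothesis aq : a <= crit_exp N p * conj_exp q / conj_exp p.
Hypotheses (C1 : C1_Rplus phi) (F1 : Phi1 phi) (F2 : Phi2 p q phi) (F3 : Phi3 p q phi)
  (F4 : Phi4 phi).
Hypotheses (cg : continuous g) (G2 : g2_hyp N p a m g) (GC : g_convention N p a m g).
Variables (W : completeNormedModType R) (i : E0 -> W).
Hypothesis HW : is_completion Drad (norm_W a p q) i.
Local Notation J := (J a p q phi g i).
Let aP : a < P := exp_lt_crit N2 p1 pq qN aq.
Let P0 : 0 < P := crit_exp_gt0 N2 p1 pq qN.
Let p0 : 0 < p. Proof. exact: lt_trans ltr01 p1. Qed.
Let q0 : 0 < q. Proof. exact: lt_trans p0 pq. Qed.
Let a0 : 0 < a. Proof. exact: lt_trans ltr01 a1. Qed.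
Let m0 : 0 < m. Proof. by case: G2. Qed.

(** functional_convex_ineq with y = 0. *)
Lemma neg_nonlin_le x uU : differentiable J x -> represents a p q i x uU ->
  - (\int[leb]_t (g (uU.1 t) * uU.1 t)) <= dual_norm ('d J x) * `|x|.
Proof.
have arith (k s d : R) : 0 <= k -> 0 <= 0 / 2 - k / 2 - 0 + s - d -> - s <= - d by lra.
move=> dJ ru; have l01 : 0 < (2^-1 : R) < 1 by rewrite invr_gt0 ltr0n/= invf_lt1// ltr1n.
have rz := represents_zero N2 p1 pq a1 HW.
have H := functional_convex_ineq N2 p1 pq qN a1 aq C1 F1 F3 F4 cg G2 GC HW l01 dJ ru rz.
have D0 : 0 <= (\int[leb]_t convdef phi 2^-1 (uU.2 t) 0) / (2 * 2^-1).
  apply: divr_ge0; last by rewrite mulr_ge0// invr_ge0.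
  by apply: Rintegral_ge0 => t _; exact: convdef_ge0.
have k0 : kinetic phi (fun=> 0 : 'rV[R]_N) = 0.
  rewrite /kinetic; under eq_Rintegral do rewrite enorm0 (phisq0 F1).
  by rewrite /Rintegral integral0.
have z0 : \int[leb]_t (g (uU.1 t) * 0) = 0.
  by under eq_Rintegral do rewrite mulr0; rewrite /Rintegral integral0.
have kU : 0 <= kinetic phi uU.2.
  by apply: Rintegral_ge0 => t _; exact: phisq_ge0.
have := le_trans D0 H; rewrite /= k0 z0 => h.
have h2 := ler_dual_norm (0 - x) dJ; rewrite sub0r normrN in h2.
have h3 : - ('d J x (- x) : R) <= `|'d J x (- x)| by rewrite -normrN; exact: ler_norm.
apply: (le_trans _ (le_trans h3 h2)).
rewrite sub0r in h.
exact: arith kU h.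
Qed.

(** By neg_nonlin_le, nonlin_coercive and wpair_sobolev, m/4 times the a-integral B of u
is at most |x| plus a constant, whereas |x| grows only like B^(1/a) with 1/a < 1. *)
Lemma palais_smale_bounded C : 0 <= C -> exists2 K, 0 <= K & forall x uU,
  differentiable J x -> dual_norm ('d J x) <= 1 -> represents a p q i x uU ->
  (rho p q uU.2 <= C%:E)%E -> (powint a uU.1 <= K%:E)%E /\ `|x| <= K.
Proof.
move=> C0.
have [s0 s00 Hs] := nonlin_coercive a1 aP cg G2 GC.
have [C' C'0 HC] := Hs _ ltr01.
have sP : 0 < s0 `^ P by exact: powR_gt0.
(* the indicator of |s| >= s0 is at most |s|^p* / s0^p* *)
pose k := 1 + C' / s0 `^ P.
have k0 : 0 < k by rewrite ltr_pwDl// divr_ge0// ltW.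
have e0 : 0 < m / (4 * k) by rewrite divr_gt0// mulr_gt0.
have [K1 K10 HK1] := wpair_sobolev N2 p1 pq qN a1 aq C0 e0.
have th : 0 < a^-1 < 1 by rewrite invr_gt0 a0 invf_lt1.
have Q0 : 0 <= (2 `^ a * 2) `^ a^-1 by exact: powR_ge0.
have m8 : 0 < m / 8 by rewrite divr_gt0.
have [K2 K20 HK2] := sublinear_powR Q0 th m8.
pose c2 := (2 `^ q * ((C + 1) + (C + 1))) `^ p^-1 + (2 `^ q * ((C + 1) + (C + 1))) `^ q^-1.
have c20 : 0 <= c2 by rewrite addr_ge0 ?powR_ge0.
pose Z := m / 8 + K2 + c2 + k * K1.
have kK : 0 <= k * K1 by rewrite mulr_ge0// ltW.
have Z0 : 0 <= Z by rewrite /Z; lra.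
pose B' := 8 / m * Z.
have B'0 : 0 <= B' by rewrite mulr_ge0// divr_ge0// ltW.
have arith (B S A n : R) : m / 2 * B <= S + k * A -> A <= m / (4 * k) * B + K1 -> S <= n ->
    n <= m / 8 * (B + 1) + K2 + c2 -> B <= B'.
  move=> h1 h2 h3 h4.
  have h5 : k * A <= m / 4 * B + k * K1.
    have -> : m / 4 * B + k * K1 = k * (m / (4 * k) * B + K1) by field; rewrite gt_eqF.
    by rewrite ler_pM2l.
  have h6 : m / 8 * B <= Z by rewrite /Z; lra.
  by rewrite /B' -invf_div -ler_pdivrMl ?invr_gt0// invrK.
exists (B' + (m / 8 * (B' + 1) + K2 + c2)).
  have : 0 <= m / 8 * (B' + 1) by rewrite mulr_ge0 ?addr_ge0// ltW.
  by move=> h; apply: (addr_ge0 B'0); apply: (addr_ge0 _ c20); exact: addr_ge0.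
move=> x uU dJ dn ru UC.
have wu := represents_wpair N2 p1 pq a1 ru; have [mu mU _] := wu.
have [bm bi] := wpair_bipow N2 p1 pq qN a1 aq wu.
have ia : rint leb (fun x => `|uU.1 x| `^ a).
  apply: (rint_le _ _ bi); first exact: measurable_normpow.
  by move=> t; rewrite ger0_norm ?powR_ge0// /bipow lerDl powR_ge0.
have iP : rint leb (fun x => `|uU.1 x| `^ P).
  apply: (rint_le _ _ bi); first exact: measurable_normpow.
  by move=> t; rewrite ger0_norm ?powR_ge0// /bipow lerDr powR_ge0.
have ig : rint leb (fun x => g (uU.1 x) * uU.1 x) := rint_nonlin a1 aP cg G2 GC (conj bm bi) (conj bm bi).
pose B := \int[leb]_x (`|uU.1 x| `^ a); pose A := \int[leb]_x (`|uU.1 x| `^ P).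
pose S := \int[leb]_x (g (uU.1 x) * uU.1 x).
have B0 : 0 <= B by apply: Rintegral_ge0 => t _; exact: powR_ge0.
have BE : powint a uU.1 = B%:E by rewrite /powint (RintE ia).
have h1 : m / 2 * B <= - S + k * A.
  have E : - S + k * A = \int[leb]_x (- 1 * (g (uU.1 x) * uU.1 x) + k * `|uU.1 x| `^ P).
    by rewrite (Rint_lin _ ig (rintZ k iP)) (RintegralZl _ measurableT iP) mulN1r.
  rewrite E -(RintegralZl _ measurableT ia); apply: le_Rintegral => //.
  - exact: rintZ.
  - by apply: rint_lin => //; exact: rintZ.
  - move=> t _; apply: (le_trans (HC _)); rewrite mulN1r -addrA lerD2l /k mulrDl lerD2l -mulrA.
    apply: ler_wpM2l => //; case: ifP => [st|_]; last by rewrite mulr_ge0 ?invr_ge0 ?powR_ge0.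
    rewrite mulrC ler_pdivlMr// mul1r; apply: ge0_ler_powR; rewrite ?nnegrE//; exact: ltW.
have h2 : A <= m / (4 * k) * B + K1.
  by rewrite -lee_fin EFinD EFinM -BE /A -(RintE iP); exact: HK1.
have h3 : - S <= `|x|.
  by apply: (le_trans (neg_nonlin_le dJ ru)); rewrite ler_piMl.
have B1 : 0 < B + 1 by rewrite ltr_wpDl.
have C1' : 0 < C + 1 by rewrite ltr_wpDl.
have hB : (powint a uU.1 <= (B + 1)%:E)%E by rewrite BE lee_fin lerDl.
have hC : (rho p q uU.2 <= (C + 1)%:E)%E by apply: (le_trans UC); rewrite lee_fin lerDl.
have h4 : `|x| <= m / 8 * (B + 1) + K2 + c2.
  apply: (le_trans (represents_norm N2 p1 pq a1 HW ru B1 C1' hB hC)).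
  rewrite -addrA /c2 lerD2r.
  have -> : 2 `^ a * (B + 1 + (B + 1)) = 2 `^ a * 2 * (B + 1) by ring.
  rewrite powRM ?mulr_ge0 ?powR_ge0 ?(ltW B1)//; apply: HK2; exact: ltW.
have BB := arith B (- S) A `|x| h1 h2 h3 h4.
split.
  rewrite BE lee_fin; apply: (le_trans BB); rewrite lerDl.
  have : 0 <= m / 8 * (B' + 1) by rewrite mulr_ge0 ?addr_ge0// ltW.
  by move=> h; apply: (addr_ge0 _ c20); exact: addr_ge0.
apply: (le_trans h4); apply: (@le_trans _ _ (m / 8 * (B' + 1) + K2 + c2)); last by rewrite lerDr.
by rewrite !lerD2r ler_pM2l// lerD2r.
Qed.

Lemma represents_cauchy (x : nat -> W) uU : (forall n, represents a p q i (x n) (uU n)) ->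
  (forall c : R, 0 < c -> exists n0, forall n k, (n0 <= n)%N -> (n0 <= k)%N ->
    (powint a (fun t => (uU n).1 t - (uU k).1 t)%R <= c%:E)%E /\
    (rho p q (fun t => (uU n).2 t - (uU k).2 t)%R <= c%:E)%E) ->
  cvg (x n @[n --> \oo]).
Proof.
have arith (c : R) : 0 < c -> c / 4 + c / 4 + c / 4 < c by move=> c0; lra.
move=> ru H; apply/cauchy_cvgP/cauchy_exP => c c0.
have c4 : 0 < c / 4 by rewrite divr_gt0.
have t2 (s : R) : 0 < 2 `^ s :> R by exact: powR_gt0.
have [d1 d10 Hd1] := root_small (t2 a) a0 c4.
have [d2 d20 Hd2] := root_small (t2 q) p0 c4.
have [d3 d30 Hd3] := root_small (t2 q) q0 c4.
pose d := Num.min d1 (Num.min d2 d3).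
have d0 : 0 < d by rewrite !lt_min d10 d20.
have [n0 Hn0] := H _ d0.
exists (x n0); exists n0 => // n /= nn.
have [h1 h2] := Hn0 n n0 nn (leqnn n0).
rewrite -ball_normE /ball_/= distrC.
have rl := represents_lin N2 p1 pq a1 HW (-1) (ru n0) (ru n).
have E : -1 *: x n0 + x n = x n - x n0 by rewrite scaleN1r addrC.
rewrite E in rl.
have E1 : (fun t => -1 * (uU n0).1 t + (uU n).1 t) = (fun t => (uU n).1 t - (uU n0).1 t).
  by apply/funext => t; rewrite mulN1r addrC.
have E2 : (fun t => -1 *: (uU n0).2 t + (uU n).2 t) = (fun t => (uU n).2 t - (uU n0).2 t).
  by apply/funext => t; rewrite scaleN1r addrC.
rewrite E1 E2 in rl.
have := represents_norm N2 p1 pq a1 HW rl d0 d0 h1 h2.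
have dd1 : d <= d1 by rewrite ge_min lexx.
have dd2 : d <= d2 by rewrite !ge_min lexx orbT.
have dd3 : d <= d3 by rewrite !ge_min lexx !orbT.
have k1 := Hd1 _ (ltW d0) dd1; have k2 := Hd2 _ (ltW d0) dd2; have k3 := Hd3 _ (ltW d0) dd3.
move=> h; apply: (le_lt_trans h); apply: (le_lt_trans (lerD (lerD k1 k2) k3)).
exact: arith.
Qed.

Lemma palais_smale (Y : completeNormedModType R) (iY : E0 -> Y) (j : {linear W -> Y}) :
  is_completion Drad (norm_Y p q) iY -> continuous j ->
  (forall f, Drad f -> j (i f) = iY f) -> weak_PS j J.
Proof.
move=> HY cj jE x _ dJ dn [M jM].
pose uU n := rep a p q i (x n).
have ru n : represents a p q i (x n) (uU n) by exact: (repP N2 p1 pq a1 HW).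
have wu n : wpair p q a (uU n) := represents_wpair N2 p1 pq a1 (ru n).
have M0 : 0 <= M by exact: le_trans (jM 0%N).
have [C C0 HC] := represents_Y N2 p1 pq a1 HY cj jE M0.
have UC n : (rho p q (uU n).2 <= C%:E)%E by exact: HC (ru n) (jM n).
have [K K0 HK] := palais_smale_bounded C0.
have [n0 _ Hn0] : \forall n \near \oo, dual_norm ('d J (x n)) <= 1.
  move/cvgrPdist_le : dn => /(_ 1 ltr01); apply: filterS => n.
  by rewrite sub0r normrN; apply: le_trans; exact: ler_norm.
have bd n : (n0 <= n)%N -> (powint a (uU n).1 <= K%:E)%E /\ `|x n| <= K.
  by move=> nn; exact: HK (dJ n) (Hn0 n nn) (ru n) (UC n).
pose M1 := Num.max C K.
have M10 : 0 <= M1 by rewrite le_max C0.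
have UM n : (rho p q (uU n).2 <= M1%:E)%E.
  by apply: (le_trans (UC n)); rewrite lee_fin le_max lexx.
have uM n : (n0 <= n)%N -> (powint a (uU n).1 <= M1%:E)%E.
  by move=> nn; apply: (le_trans (bd n nn).1); rewrite lee_fin le_max lexx orbT.
have [s1 [s1i [v [mv uv]]]] := wpair_compact N2 p1 pq qN a1 aq M10
  (fun n => wu (n0 + n)%N) (fun n => UM (n0 + n)%N) (fun n => uM _ (leq_addr n n0)).
have [Cp Cp0 HCp] := phisq_upper p1 pq F3.
have kb n : `|kinetic phi (uU (n0 + s1 n)%N).2| <= Cp * C.
  have [_ mU _] := wu (n0 + s1 n)%N.
  have [_ Uf] := wpair_finite N2 p1 pq a1 (wu (n0 + s1 n)%N).
  have ik := rint_kinetic p1 pq C1 F1 F3 mU Uf; have ih := rint_hpq mU Uf.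
  rewrite ger0_norm; last by apply: Rintegral_ge0 => t _; exact: phisq_ge0.
  apply: (@le_trans _ _ (\int[leb]_t (Cp * hpq p q (enorm ((uU (n0 + s1 n)%N).2 t))))).
    by apply: le_Rintegral => //; [exact: rintZ|move=> t _; exact: HCp (enorm_ge0 _)].
  rewrite (RintegralZl _ measurableT ih); apply: ler_wpM2l; first exact: ltW.
  by rewrite -lee_fin -(RintE ih); exact: UC.
have [s2 [s2i /cvg_ex[ell kl]]] := bounded_subseq kb.
pose s n := (n0 + s1 (s2 n))%N.
have si : extraction s by move=> k n kn; rewrite /s ltn_add2l; apply: s1i; exact: s2i.
have sn0 n : (n0 <= s n)%N by exact: leq_addr.
pose e n := `|dual_norm ('d J (x (s n)))| * (K + K).
have e0 : e n @[n --> \oo] --> 0.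
  rewrite -(mul0r (K + K)); apply: cvgM; last exact: cvg_cst.
  by rewrite -(normr0 R); apply: cvg_norm; exact: (cvg_comp _ _ (extraction_cvg si) dn).
have [l l01 [Cc Cc0 coer]] := convdef_coercive p1 pq C1 F2 F3 F4 N.
have uv2 : {ae leb, forall t, (uU (s n)).1 t @[n --> \oo] --> v t}.
  by apply: filterS uv => t ut; exact: (cvg_comp _ _ (extraction_cvg s2i) ut).
have main n k : \int[leb]_t convdef phi l ((uU (s n)).2 t) ((uU (s k)).2 t) / (2 * l) <=
    kinetic phi (uU (s k)).2 / 2 - kinetic phi (uU (s n)).2 / 2
    - \int[leb]_t (g ((uU (s n)).1 t) * (uU (s k)).1 t)
    + \int[leb]_t (g ((uU (s n)).1 t) * (uU (s n)).1 t) + e n.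
  have H := functional_convex_ineq N2 p1 pq qN a1 aq C1 F1 F3 F4 cg G2 GC HW l01
    (dJ (s n)) (ru (s n)) (ru (s k)).
  apply: (le_trans H); rewrite lerD2l.
  have h2 := ler_dual_norm (x (s k) - x (s n)) (dJ (s n)).
  have h3 : - ('d J (x (s n)) (x (s k) - x (s n)) : R) <= `|'d J (x (s n)) (x (s k) - x (s n))|.
    by rewrite -normrN; exact: ler_norm.
  apply: (le_trans h3); apply: (le_trans h2).
  apply: (@le_trans _ _ (`|dual_norm ('d J (x (s n)))| * `|x (s k) - x (s n)|)).
    by apply: ler_wpM2r => //; exact: ler_norm.
  apply: ler_wpM2l => //; apply: (le_trans (ler_normB _ _)).
  by apply: lerD; [exact: (bd _ (sn0 k)).2|exact: (bd _ (sn0 n)).2].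
have wu2 n : wpair p q a ((uU (s n)).1, (uU (s n)).2) by rewrite -surjective_pairing.
have [s3 [s3i H3]] := palais_smale_compactness N2 p1 pq qN a1 aq C1 F1 F3 F4 cg G2 GC l01
  Cc0 coer M10 wu2 (fun n => UM (s n)) (fun n => uM _ (sn0 n)) mv uv2 kl e0 main.
exists (s \o s3); split; first exact: extraction_comp.
exact: (represents_cauchy (fun n => ru (s (s3 n))) H3).
Qed.

End palais_smale.

Theorem theorem2p3 (R : realType) (N : nat) (p q a m : R) (phi g : R -> R)
  (W Y : completeNormedModType R)
  (iW : ('rV[R]_N -> R) -> W) (iY : ('rV[R]_N -> R) -> Y)
  (j : {linear W -> Y}) :
  (2 <= N)%N -> 1 < p -> p < q -> q < Num.min N%:R (crit_exp N p) ->
  crit_exp N p * conj_exp N%:R / conj_exp p <= a ->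
  a <= crit_exp N p * conj_exp q / conj_exp p ->
  C1_Rplus phi -> Phi1 phi -> Phi2 p q phi -> Phi3 p q phi -> Phi4 phi ->
  continuous g -> g1_hyp N p g -> g2_hyp N p a m g -> BL g ->
  g_convention N p a m g ->
  is_completion Drad (norm_W a p q) iW ->
  is_completion Drad (norm_Y p q) iY ->
  continuous j -> (forall f, Drad f -> j (iW f) = iY f) ->
  weak_PS j (J a p q phi g iW).
Proof.
move=> N2 p1 pq; rewrite lt_min => /andP[qN _] _ aq C1 F1 F2 F3 F4 cg _ G2 _ GC HW HY cj jE.
have a1 : 1 < a by have [/andP[]] := G2.
exact: (palais_smale N2 p1 pq qN a1 aq C1 F1 F2 F3 F4 cg G2 GC HW HY cj jE).
Qed.
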